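(* Let $\alpha > -1$, $\sigma>0$ and $1\le p,q \le \infty$. (a) If $\alpha \ge -1/2$, then $J^{\alpha,\sigma}$ is bounded from $L^p(d\mu_{\alpha})$ to $L^q(d\mu_{\alpha})$ if and only if $$\frac{1}{p} - \frac{\sigma}{\alpha+1} \le \frac{1}q \le \frac{1}{p} \quad \text{and} \quad \bigg(\frac{1}p,\frac1{q}\bigg) \notin \bigg\{ \Big(\frac{\sigma}{\alpha+1},0\Big),\Big(1,1-\frac{\sigma}{\alpha+1}\Big)\bigg\}.$$ (b) If $\alpha < -1/2$, then $J^{\alpha,\sigma}$ is bounded from $L^p(d\mu_{\alpha})$ to $L^q(d\mu_{\alpha})$ if and only if $p=q$.
   Context: For $\alpha>-1$ let $d\mu_\alpha(x)=x^{2\alpha+1}dx$ on $\mathbb{R}_+=(0,\infty)$, let $I_\alpha$ denote the modified Bessel function of the first kind of order $\alpha$, and for $t,x,y>0$ let $$W_t^{\alpha}(x,y)=\frac{1}{2t}\exp\Big(-\frac{x^2+y^2}{4t}\Big)(xy)^{-\alpha}I_\alpha\Big(\frac{xy}{2t}\Big).$$ For $\sigma>0$ define $$H^{\alpha,\sigma}(x,y)=\frac1{\Gamma(\sigma)}\int_0^\infty e^{-t}W_t^\alpha(x,y)\,t^{\sigma-1}\,dt,\qquad J^{\alpha,\sigma}f(x)=\int_0^\infty H^{\alpha,\sigma}(x,y)f(y)\,d\mu_\alpha(y),\qquad x,y>0.$$ Boundedness from $L^p$ to $L^q$ means that for every $f\in L^p$ the integral defining the operator converges for a.e. $x$ and the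 norm inequality holds with a constant independent of $f$. Convention: $1/\infty=0$. *)

(* Defs.v *)
From HB Require Import structures.
From mathcomp Require Import all_boot all_order all_algebra.
From mathcomp Require Import all_classical all_reals all_analysis.
From mathcomp Require Import measurable_realfun.

Set Implicit Arguments.
Unset Strict Implicit.
Unset Printing Implicit Defensive.

Import Order.TTheory GRing.Theory Num.Theory.
Import numFieldNormedType.Exports.

Local Open Scope classical_set_scope.
Local Open Scope ring_scope.

(* Only meaningful for s > 0, where the integrand is integrable. *)
Definition Gamma (R : realType) (s : R) : R :=
  \int[@lebesgue_measure R]_(t in `]0, +oo[) (t `^ (s - 1) * expR (- t)).

(* Only meaningful for alpha > -1 and z > 0; there every argument of Gamma is
   positive. *)
Definition besselI (R : realType) (alpha z : R) : R :=
  limn (series (fun n : nat =>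
    (z / 2) `^ (2 * n%:R + alpha) / (n`!%:R * Gamma (n%:R + alpha + 1)))).

Definition heat_kernel (R : realType) (alpha t x y : R) : R :=
  (2 * t)^-1 * expR (- ((x ^+ 2 + y ^+ 2) / (4 * t))) * (x * y) `^ (- alpha)
    * besselI alpha (x * y / (2 * t)).

(* The underlying space is the whole real line, but mu_ alpha does not charge
   the complement of (0, +oo), so the values of functions there are
   irrelevant. *)
Definition mu_ (R : realType) (alpha : R) (A : set (measurableTypeR R)) : \bar R :=
  (\int[@lebesgue_measure R]_(x in A `&` `]0%R, +oo[)
     (x `^ (2 * alpha + 1))%:E)%E.

Section mu_measure.
Context {R : realType} (alpha : R).
Local Open Scope ereal_scope.

Let mu0 : mu_ alpha set0 = 0.
Proof. by rewrite /mu_ set0I integral_set0. Qed.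

Let mu_ge0 A : 0 <= mu_ alpha A.
Proof. by apply: integral_ge0 => x _; rewrite lee_fin powR_ge0. Qed.

Let mu_sigma_additive : semi_sigma_additive (mu_ alpha).
Proof.
move=> F mF tF mUF; rewrite /mu_; apply: cvg_toP.
  apply: ereal_nondecreasing_is_cvgn => m n mn.
  apply: lee_sum_nneg_natr => // k _ _; apply: integral_ge0 => /= x _.
  by rewrite lee_fin powR_ge0.
rewrite setI_bigcupl ge0_integral_bigcup//=.
- by move=> k; apply: measurableI => //; exact: mF.
- by apply/measurable_EFinP/measurable_funTS; exact: measurable_powR.
- by move=> x _; rewrite lee_fin powR_ge0.
- apply/trivIsetP => /= i j _ _ ij; rewrite setIACA.
  by move/trivIsetP : tF => ->//; rewrite set0I.
Qed.

HB.instance Definition _ := isMeasure.Build _ _ _ (mu_ alpha)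
  mu0 mu_ge0 mu_sigma_additive.

End mu_measure.

(* Extended-real valued: the integral diverges on the diagonal x = y when
   sigma <= 1/2. *)
Definition potential_kernel (R : realType) (alpha sigma x y : R) : \bar R :=
  ((Gamma sigma)^-1%:E *
   \int[@lebesgue_measure R]_(t in `]0%R, +oo[)
     (expR (- t) * heat_kernel alpha t x y * t `^ (sigma - 1))%:E)%E.

Definition potential (R : realType) (alpha sigma : R) (f : R -> R) (x : R) :
    \bar R :=
  (\int[mu_ alpha]_(y in `]0%R, +oo[)
     (potential_kernel alpha sigma x y * (f y)%:E))%E.

Definition potential_bounded (R : realType) (alpha sigma : R) (p q : \bar R) :
    Prop :=
  exists C : R, forall f : measurableTypeR R -> R, f \in Lfun (mu_ alpha) p ->
    {ae mu_ alpha, forall x, (mu_ alpha).-integrable `]0, +oo[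
      (fun y => (potential_kernel alpha sigma x y * (f y)%:E)%E)} /\
    ('N[mu_ alpha]_q [potential alpha sigma f]
       <= C%:E * 'N[mu_ alpha]_p [EFin \o f])%E.

(* Main.v *)
From HB Require Import structures.
Require Import Defs.
From mathcomp Require Import all_boot all_order all_algebra.
From mathcomp Require Import all_classical all_reals all_analysis.
From mathcomp Require Import measurable_realfun ess_sup_inf lra ring.

(** Write [h = a + 1], so that [mu_ a] is [x ^ (2 h - 1) dx] on the half-line.
    The kernel of the potential is the average of the heat kernels [W_t] against
    [t ^ (s - 1) exp (- t) dt / Gamma s], and the proof uses little about [W_t]:
    it is symmetric, of total mass one, and bounded by a multiple of [t ^ (- h)]
    when [a >= -1/2].  All of this is read off the Bessel series, multiplied out
    into the nonnegative series [heat_series], which makes sense for all real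
    [x] and [y].  Integrated against a Gaussian [exp (- b y ^ 2)], its terms give
    Gaussian moments, whose Gamma factors cancel those of the coefficients, and an
    exponential series remains ([heat_series_gauss]).  The case [b = 0] is the
    total mass.  The sup bound ([heat_series_le]) holds because for [a >= -1/2]
    the coefficients are at most those of the exponential series
    ([Gamma_double_fact]).

    Sufficiency.  Total mass one makes the potential a contraction of [L^oo] and,
    by symmetry, of [L^1].  The two facts on mass and sup give
    [W_t : L^p -> L^oo] with norm [O (t ^ (- h / p))] ([heat_avg]), integrable in
    time exactly when [h / p < s]: this is [q = oo], and its dual is [p = 1].
    For [1 < p <= q < oo] the bilinear form [(f, g) |-> int g K f] is split
    according to which of [g x ^ q'] and [f y ^ p] is the larger, with [q'] dual to
    [q] ([bilinear_bound]).  Then the kernel acts on a truncated function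
    only, for which [W_t] has both the bound by the truncation height and the
    bound by [t ^ (- h / p)]; splitting the time integral where they agree gives
    exactly the powers that are needed, the limiting case of the order
    [s = h (1/p - 1/q)] included ([strong_bound_pq]).  When [p = q] the mass alone
    suffices ([strong_bound_pp]), which covers all [a > -1].

    Necessity.  By the Gaussian identity, the potential of [exp (- b y ^ 2)] is an
    explicit integral in time.  Testing with [b -> 0] and [b -> oo] yields the two
    inequalities between [1/p] and [1/q] ([bounded_scaling]).  At the corner
    [p = 1, 1/q = 1 - s/h], the normalized Gaussians approach a point mass and the
    norms of their potentials diverge logarithmically ([endpoint_unbounded] and
    [endpoint_unbounded_sup]); the corner [q = oo] is its dual.  Finally, if
    [a < -1/2], the measure of the unit interval at [N] tends to zero as
    [N] grows, whereas the potential of the indicator of a larger interval, of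
    fixed length, stays bounded below there, since at times of order one [W_t]
    keeps at least half of its mass within a bounded distance ([heat_local]); so [p < q] is impossible ([bounded_local]). *)

Set Implicit Arguments.
Unset Strict Implicit.
Unset Printing Implicit Defensive.

Import Order.TTheory GRing.Theory Num.Theory.
Import numFieldNormedType.Exports.

Local Open Scope classical_set_scope.
Local Open Scope ring_scope.

(** * The power measures on the half-line *)
Section power_measure.
Context {R : realType}.
Implicit Types (a s x : R).
Local Notation leb := (@lebesgue_measure R).
Local Notation pos := (`]0%R, +oo[%classic : set R).

Lemma continuous_powR s x : 0 < x -> {for x, continuous (fun y : R => y `^ s)}.
Proof.
move=> x0; apply: differentiable_continuous; apply/derivable1_diffP.
by apply: derivable_powR; rewrite in_itv/= x0.
Qed.

Lemma within_continuous_powR s (A : set R) : (forall x, A x -> 0 < x) ->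
  {within A, continuous (fun y : R => y `^ s)}.
Proof.
move=> A0; apply: continuous_in_subspaceT => x /[!inE] Ax.
exact/continuous_powR/A0.
Qed.

Import HBNNSimple.

(** The definition of [mu_] is the case of indicators; monotone convergence along
    simple functions does the rest. *)
Lemma integral_muE a (f : measurableTypeR R -> \bar R) : measurable_fun setT f ->
  (forall x, 0 <= f x)%E ->
  (\int[mu_ a]_x f x = \int[leb]_(x in pos) (f x * (x `^ (2 * a + 1))%:E))%E.
Proof.
move=> mf f0.
have mw D : measurable_fun D (fun x : R => (x `^ (2 * a + 1))%:E).
  by apply/measurable_EFinP/measurable_funTS; exact: measurable_powR.
pose f_ := nnsfun_approx measurableT mf.
transitivity (limn (fun n => \int[mu_ a]_x (f_ n x)%:E)%E).
  rewrite -monotone_convergence//.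
  - by apply: eq_integral => y _; apply/esym/cvg_lim => //; exact: cvg_nnsfun_approx.
  - by move=> n; apply/measurable_EFinP; exact: measurable_funP.
  - by move=> n y _; rewrite lee_fin.
  - by move=> y _ m n mn; rewrite lee_fin; exact/lefP/nd_nnsfun_approx.
rewrite [X in limn X](_ : _ = (fun n =>
    \int[leb]_(x in pos) ((f_ n x)%:E * (x `^ (2 * a + 1))%:E))%E).
  rewrite -monotone_convergence//.
  - apply: eq_integral => y _; apply/cvg_lim => //.
    apply: cvgeZr => //; exact: cvg_nnsfun_approx.
  - move=> k; apply: emeasurable_funM; last exact: mw.
    by apply/measurable_EFinP/measurable_funTS.
  - by move=> k x _; rewrite mule_ge0// lee_fin// powR_ge0.
  - move=> x _ m k mk; rewrite lee_wpmul2r// ?lee_fin ?powR_ge0//.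
    exact/lefP/nd_nnsfun_approx.
apply/funext => n; rewrite integralT_nnsfun sintegralE.
transitivity (\sum_(k \in range (f_ n))
    \int[leb]_(x in pos) ((k * \1_(f_ n @^-1` [set k]) x)%:E *
       (x `^ (2 * a + 1))%:E))%E; last first.
  rewrite -ge0_integral_fsum//.
  - apply: eq_integral => x _; rewrite (fimfunE (f_ n)) -fsumEFin//.
    rewrite ge0_mule_fsuml// => r; exact: nnfun_muleindic_ge0.
  - move=> r; apply: emeasurable_funM; last exact: mw.
    by apply/measurable_EFinP/measurable_funTS/measurable_funM.
  - by move=> r x _; rewrite mule_ge0 ?nnfun_muleindic_ge0// lee_fin powR_ge0.
apply: eq_fsbigr => r _.
have [r0|r0] := ltP r 0.
  rewrite preimage_nnfun0//= measure0 mule0 integral0_eq// => x _.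
  by rewrite indic0 mulr0 mul0e.
under eq_integral do rewrite EFinM -muleA.
rewrite ge0_integralZl//; last 2 first.
- by apply: emeasurable_funM; [|exact: mw]; apply/measurable_EFinP/measurable_funTS.
- by move=> x _; rewrite mule_ge0// lee_fin// powR_ge0.
congr (_ * _)%E.
rewrite /= /mu_ setIC integral_mkcondr/=; apply: eq_integral => x _.
by rewrite /patch indicE; case: ifPn => // _; rewrite (mul1e,mul0e).
Qed.

Lemma mu_le0 a : mu_ a `]-oo, 0]%classic = 0%E.
Proof.
rewrite /= /mu_ (_ : _ `&` _ = set0) ?integral_set0//.
rewrite -subset0 => x [] /=; rewrite !in_itv/= andbT => x0 /lt_le_trans => /(_ _ x0).
by rewrite ltxx.
Qed.

Let mu_sigma_finite a : sigma_finite setT (@mu_ R a).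
Proof.
exists (fun n : nat => `]-oo, 0] `|` `[n.+1%:R^-1, n.+1%:R]).
  apply/esym; rewrite -subTset => x _.
  have [x0|x0] := leP x 0; first by exists 0%N => //; left; rewrite /= in_itv.
  pose n := Num.truncn (x + x^-1).
  have xn : x + x^-1 <= n.+1%:R by rewrite ltW// truncnS_gt.
  have xi0 : 0 < x^-1 by rewrite invr_gt0.
  exists n => //; right; rewrite /= in_itv/=; apply/andP; split.
    rewrite -[leRHS]invrK lef_pV2 ?posrE//; apply: le_trans xn.
    by rewrite lerDr ltW.
  by apply: le_trans xn; rewrite lerDl ltW.
move=> n; split; first exact: measurableU.
have Ip : `[n.+1%:R^-1, n.+1%:R] `<=` pos.
  move=> x /=; rewrite !in_itv/= andbT => /andP[+ _].
  by apply: lt_le_trans; rewrite invr_gt0.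
apply: (@le_lt_trans _ _
    (\int[leb]_(x in `[(n.+1%:R^-1)%R, n.+1%:R%R]) (x `^ (2 * a + 1))%:E)%E).
  rewrite /= /mu_ setIUl (_ : `]-oo, 0] `&` _ = set0) ?set0U; last first.
    rewrite -subset0 => x [] /=; rewrite !in_itv/= andbT => x0 /lt_le_trans => /(_ _ x0).
    by rewrite ltxx.
  by rewrite (setIidl Ip).
have : leb.-integrable `[n.+1%:R^-1, n.+1%:R]
    (EFin \o (fun x : R => x `^ (2 * a + 1))).
  apply: continuous_compact_integrable; first exact: segment_compact.
  by apply: within_continuous_powR => x /Ip; rewrite /= in_itv/= andbT.
move=> /integrableP[_]; under eq_integral do rewrite /= ger0_norm ?powR_ge0//.
by [].
Qed.

HB.instance Definition _ a :=
  @isSigmaFinite.Build _ _ _ (@mu_ R a) (mu_sigma_finite a).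
HB.instance Definition _ a :=
  @isSFinite.Build _ _ _ (@mu_ R a) (sfinite_measure_sigma_finite (mu_sigma_finite a)).

End power_measure.

Section half_line.
Context {R : realType}.
Implicit Types (a s x b c r : R).
Local Notation leb := (@lebesgue_measure R).
Local Notation pos := (`]0%R, +oo[%classic : set R).

Import HBNNSimple.

(** A simple function below [g] keeps its integral when it is cut off to the
    half-line, and the cut-off function lies below [u] everywhere. *)
Lemma le_integral_pos a (g u : measurableTypeR R -> \bar R) :
  (forall x, 0 <= g x)%E -> (forall x, 0 <= u x)%E ->
  (forall x, 0 < x -> (g x <= u x)%E) ->
  (\int[mu_ a]_x g x <= \int[mu_ a]_x u x)%E.
Proof.
move=> g0 u0 gu; rewrite !ge0_integralTE//.
apply: ge_ereal_sup => _ [h /= hg <-].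
have mp : measurable (pos : set (measurableTypeR R)) by [].
have pE x : proj_nnsfun h mp x = if x \in (pos : set (measurableTypeR R)) then h x else 0.
  by have := congr1 (fun f => f x) (mrestrict h mp); rewrite patchE => <-.
rewrite (_ : sintegral _ h = sintegral (mu_ a) (proj_nnsfun h mp)).
  apply: ereal_sup_ubound; exists (proj_nnsfun h mp) => //= x.
  rewrite mindicE; case: (boolP (x \in _)); last by rewrite mulr0.
  by rewrite inE /= in_itv/= andbT mulr1 => x0; apply: le_trans (gu _ x0).
have mh (k : {nnsfun measurableTypeR R >-> R}) :
    measurable_fun (setT : set (measurableTypeR R))
      (fun x : measurableTypeR R => (k x)%:E).
  by apply/measurable_EFinP; exact: measurable_funP.
rewrite -!integralT_nnsfun.
have Dp : setT `\` `]-oo, 0%R]%classic `<=` pos.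
  by move=> x /= [_] /negP; rewrite !in_itv/= andbT -ltNge.
rewrite (ge0_negligible_integral _ _ _ _ (mu_le0 a))//; last first.
  by move=> x _; rewrite lee_fin.
rewrite [RHS](ge0_negligible_integral _ _ _ _ (mu_le0 a))//; last first.
  by move=> x _; rewrite lee_fin.
apply: eq_integral => x /[!inE] /Dp xp.
by rewrite pE mem_set.
Qed.

(** Reduces estimates on the half-line to compact intervals away from zero, where
    the fundamental theorem of calculus, integration by parts and substitution
    apply directly. *)
Lemma integral_le_compact (D : set R) (f : R -> \bar R) (M : \bar R) :
  measurable D -> D `<=` pos -> measurable_fun D f ->
  (forall x, D x -> 0 <= f x)%E ->
  (forall b c, 0 < b -> b < c ->
     (\int[leb]_(x in D `&` `[b, c]) f x <= M)%E) ->
  (\int[leb]_(x in D) f x <= M)%E.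
Proof.
move=> mD Dp mf f0 fM.
pose K (n : nat) : set R := `[n.+2%:R^-1, n.+2%:R]%classic.
have DK : D = \bigcup_n (D `&` K n).
  rewrite -setI_bigcupr setIidl// => x /Dp; rewrite /= in_itv/= andbT => x0.
  pose n := Num.truncn (x + x^-1).
  have xn : x + x^-1 <= n.+2%:R.
    by rewrite (le_trans (ltW (truncnS_gt _)))// ler_nat.
  have xi0 : 0 < x^-1 by rewrite invr_gt0.
  exists n => //; rewrite /K /= in_itv/=; apply/andP; split.
    rewrite -[leRHS]invrK lef_pV2 ?posrE//; apply: le_trans xn.
    by rewrite lerDr ltW.
  by apply: le_trans xn; rewrite lerDl ltW.
rewrite {1}DK.
have cv : ((\int[leb]_(x in D `&` K i) f x)%E @[i --> \oo] -->
    (\int[leb]_(x in \bigcup_i (D `&` K i)) f x)%E).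
  apply: ge0_nondecreasing_set_cvg_integral.
  - move=> m n mn; rewrite subsetEset => x [Dx]; rewrite /K /= !in_itv/=.
    move=> /andP[m1 m2]; split => //; apply/andP; split.
      by apply: le_trans m1; rewrite lef_pV2 ?posrE// ler_nat.
    by apply: le_trans m2 _; rewrite ler_nat.
  - by move=> i; apply: measurableI; [exact: mD|exact: measurable_itv].
  - by move=> i; apply: measurable_funS mf => // x [].
  - by move=> i x [Dx _]; exact: f0.
rewrite -(cvg_lim _ cv)//; apply: lime_le.
  by apply/cvg_ex; eexists; exact: cv.
apply: nearW => n; apply: fM; first by rewrite invr_gt0.
by rewrite (@lt_le_trans _ _ 1)// ?invf_lt1 ?ltr1n// ler1n.
Qed.

Lemma integral_powR_itv s b c : s != 0 -> 0 < b -> b < c ->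
  (\int[leb]_(x in `[b, c]) (x `^ (s - 1))%:E = ((c `^ s - b `^ s) / s)%:E)%E.
Proof.
move=> s0 b0 bc; have c0 := lt_trans b0 bc.
have cF x : 0 < x -> {for x, continuous (fun x : R => s^-1 * x `^ s)}.
  move=> x0; apply: cvgM; first exact: cvg_cst.
  exact: continuous_powR.
rewrite (@continuous_FTC2 _ _ (fun x => s^-1 * x `^ s))//.
- by rewrite -EFinB -mulrBr mulrC.
- apply: within_continuous_powR => x /=; rewrite in_itv/= => /andP[bx _].
  exact: lt_le_trans bx.
- split.
  + move=> x; rewrite in_itv/= => /andP[bx _].
    by apply: derivableM => //; apply: derivable_powR; rewrite in_itv/= (lt_trans b0).
  + by apply: cvg_at_right_filter; exact: cF.
  + by apply: cvg_at_left_filter; exact: cF.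
- move=> x; rewrite in_itv/= => /andP[bx _]; have x0 := lt_trans b0 bx.
  rewrite derive1E deriveM//; last by apply: derivable_powR; rewrite in_itv/= x0.
  rewrite derive_cst scaler0 addr0 -derive1E powR_derive1 ?in_itv/= ?x0//.
  by rewrite /GRing.scale/= mulrA mulVf// mul1r.
Qed.

Let mpow D s : measurable_fun D (fun x : R => (x `^ s)%:E).
Proof. by apply/measurable_EFinP/measurable_funTS; exact: measurable_powR. Qed.

Lemma integral_powR_near0 s r : 0 < s -> 0 < r ->
  (\int[leb]_(x in `]0%R, r]) (x `^ (s - 1))%:E <= (r `^ s / s)%:E)%E.
Proof.
move=> s0 r0; apply: integral_le_compact => //.
- by move=> x /=; rewrite !in_itv/= andbT => /andP[].
- by move=> x _; rewrite lee_fin powR_ge0.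
move=> b c b0 bc; set e := Num.min b (r / 2).
have e0 : 0 < e by rewrite lt_min b0 divr_gt0.
have er : e < r by rewrite gt_min ltr_pdivrMr// mulr_natr mulr2n ltrDl r0 orbT.
apply: (@le_trans _ _ (\int[leb]_(x in `[e, r]) (x `^ (s - 1))%:E)%E).
  apply: ge0_subset_integral => //; first by apply: measurableI.
  - exact: mpow.
  - by move=> x _; rewrite lee_fin powR_ge0.
  - move=> x [] /=; rewrite !in_itv/= => /andP[_ ->] /andP[bx _]; rewrite andbT.
    by rewrite ge_min bx.
rewrite integral_powR_itv ?gt_eqF// lee_fin ler_pM2r ?invr_gt0//.
by rewrite gerBl powR_ge0.
Qed.

Lemma integral_powR_neary s r : s < 0 -> 0 < r ->
  (\int[leb]_(x in `]r, +oo[) (x `^ (s - 1))%:E <= (r `^ s / - s)%:E)%E.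
Proof.
move=> s0 r0; apply: integral_le_compact => //.
- by move=> x /=; rewrite !in_itv/= !andbT; exact: lt_trans.
- by move=> x _; rewrite lee_fin powR_ge0.
move=> b c b0 bc; set e := Num.max c (r + 1).
have re : r < e by rewrite lt_max ltrDl ltr01 orbT.
apply: (@le_trans _ _ (\int[leb]_(x in `[r, e]) (x `^ (s - 1))%:E)%E).
  apply: ge0_subset_integral => //; first by apply: measurableI.
  - exact: mpow.
  - by move=> x _; rewrite lee_fin powR_ge0.
  - move=> x [] /=; rewrite !in_itv/= andbT => rx /andP[_ xc]; rewrite (ltW rx).
    by rewrite le_max xc.
rewrite integral_powR_itv ?lt_eqF// lee_fin invrN mulrN -mulNr.
by rewrite ler_nM2r ?invr_lt0// lerBrDl subrr powR_ge0.
Qed.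

End half_line.

(** * The Gamma function *)
Section gamma.
Context {R : realType}.
Implicit Types (a s x b c r : R).
Local Notation leb := (@lebesgue_measure R).
Local Notation pos := (`]0%R, +oo[%classic : set R).

Let g s (t : R) : R := t `^ (s - 1) * expR (- t).

Let g_ge0 s t : 0 <= g s t. Proof. by rewrite mulr_ge0// ?powR_ge0 ?expR_ge0. Qed.

Let mg D s : measurable_fun D (fun t => (g s t)%:E).
Proof.
apply/measurable_EFinP/measurable_funTS/measurable_funM.
  exact: measurable_powR.
by apply: measurableT_comp; [exact: measurable_expR|exact: measurable_funN].
Qed.

(** The inequality [t / s <= exp (t / s)], raised to the power [s]. *)
Lemma powR_expRN_le s t : 0 < s -> 0 <= t -> t `^ s * expR (- t) <= s `^ s.
Proof.
move=> s0 t0; rewrite expRN ler_pdivrMr ?expR_gt0//.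
have -> : expR t = expR (t / s) `^ s by rewrite -expRM divfK ?gt_eqF.
rewrite -powRM ?expR_ge0 ?(ltW s0)//; apply: ge0_ler_powR; rewrite ?nnegrE ?(ltW s0)//.
  by rewrite mulr_ge0 ?expR_ge0// ltW.
rewrite -ler_pdivrMl// mulrC; apply: le_trans (expR_ge1Dx _).
by rewrite lerDr.
Qed.

Let Gamma_lty s : 0 < s -> (\int[leb]_(t in pos) (g s t)%:E < +oo)%E.
Proof.
move=> s0; rewrite (_ : pos = `]0, 1] `|` `]1, +oo[); last first.
  by rewrite -itv_bndbnd_setU// bnd_simp.
rewrite ge0_integral_setU//; last 3 first.
- exact: mg.
- by move=> t _; rewrite lee_fin.
- apply/eqP; rewrite -subset0 => x [] /=; rewrite !in_itv/= andbT => /andP[_ x1].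
  by rewrite ltNge x1.
have mp D u : measurable_fun D (fun x : R => (x `^ u)%:E).
  by apply/measurable_EFinP/measurable_funTS; exact: measurable_powR.
rewrite lte_add_pinfty//.
- apply: (@le_lt_trans _ _ (\int[leb]_(t in `]0%R, 1%R]) (t `^ (s - 1))%:E)%E).
    apply: ge0_le_integral => //; [|exact: mg|exact: mp|].
      by move=> x _; rewrite lee_fin.
    move=> x /=; rewrite in_itv/= => /andP[x0 _]; rewrite lee_fin ler_piMr ?powR_ge0//.
    by rewrite expR_le1 oppr_le0 ltW.
  exact: le_lt_trans (integral_powR_near0 s0 ltr01) (ltry _).
- apply: (@le_lt_trans _ _ (\int[leb]_(t in `]1%R, +oo[)
     (((s + 1) `^ (s + 1))%:E * (t `^ (- 1 - 1))%:E))%E).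
    apply: ge0_le_integral => //; [|exact: mg| |].
    + by move=> x _; rewrite lee_fin.
    + apply: measurable_funeM; exact: mp.
    move=> x /=; rewrite in_itv/= andbT => x1; rewrite -EFinM lee_fin.
    have x0 : 0 < x := lt_trans ltr01 x1.
    rewrite /g (_ : s - 1 = s + 1 + (-1 - 1)); last by ring.
    rewrite powRD ?(gt_eqF x0) ?implybT// mulrAC ler_wpM2r ?powR_ge0//.
    by apply: powR_expRN_le; rewrite ?addr_gt0// ltW.
  rewrite ge0_integralZl//; last 3 first.
  + exact: mp.
  + by move=> x _; rewrite lee_fin powR_ge0.
  + by rewrite lee_fin powR_ge0.
  rewrite lte_mul_pinfty// ?lee_fin ?powR_ge0//.
  exact: le_lt_trans (integral_powR_neary (ltrN10 R) ltr01) (ltry _).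
Qed.

Lemma integral_Gamma s : 0 < s ->
  (\int[leb]_(t in pos) (t `^ (s - 1) * expR (- t))%:E = (Gamma s)%:E)%E.
Proof.
move=> s0; rewrite /Gamma /Rintegral fineK//.
rewrite ge0_fin_numE; first exact: Gamma_lty.
by apply: integral_ge0 => t _; rewrite lee_fin; exact: g_ge0.
Qed.

(** A lower bound uniform in [s], from the interval [1, 2] alone; it reduces the
    convergence of the Bessel series to that of an exponential series. *)
Lemma Gamma_ge s : 0 < s -> expR (- 2) / 2 <= Gamma s.
Proof.
move=> s0; rewrite -lee_fin -integral_Gamma//.
apply: (@le_trans _ _ (\int[leb]_(t in `[1%R, 2%R]) (cst (expR (- 2) / 2)%:E t))%E).
  rewrite integral_cst//= lebesgue_measure_itv/= lte_fin ltr1n.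
  by rewrite -EFinB -EFinM lee_fin -addn1 natrD addrK mulr1.
apply: (@le_trans _ _ (\int[leb]_(t in `[1%R, 2%R]) (g s t)%:E)%E).
  apply: ge0_le_integral => //; [|exact: mg|].
    by move=> x _; rewrite lee_fin divr_ge0 ?expR_ge0.
  move=> x /=; rewrite in_itv/= => /andP[x1 x2]; rewrite lee_fin mulrC.
  have x0 : 0 < x := lt_le_trans ltr01 x1.
  apply: ler_pM; rewrite ?expR_ge0 ?invr_ge0// ?ler_expR ?lerN2//.
  apply: (@le_trans _ _ (x `^ (-1))).
    by rewrite powR_inv1 ?(ltW x0)// lef_pV2 ?posrE.
  by apply: ler_powR => //; rewrite lerDr ltW.
apply: ge0_subset_integral => //; first exact: mg.
- by move=> x _; rewrite lee_fin.
- by move=> x /=; rewrite !in_itv/= andbT => /andP[+ _]; exact: lt_le_trans.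
Qed.

Lemma Gamma_gt0 s : 0 < s -> 0 < Gamma s.
Proof. by move=> s0; rewrite (lt_le_trans _ (Gamma_ge s0))// divr_gt0 ?expR_gt0. Qed.

Let boundary_small s c0 M : 0 < s -> 0 < c0 ->
  (forall c, c0 < c -> (M <= Gamma (s + 1) + c `^ s * expR (- c))) ->
  M <= Gamma (s + 1).
Proof.
move=> s0 c00 H; rewrite -[leRHS]addr0; apply/ler_addgt0Pl => e e0; rewrite addr0.
set K := (s + 1) `^ (s + 1).
have K0 : 0 < K by apply: powR_gt0; rewrite addr_gt0.
pose c := Num.max (c0 + 1) (K / e).
have cc0 : c0 < c by rewrite lt_max ltrDl ltr01.
have c_gt0 := lt_trans c00 cc0.
apply: (le_trans (H _ cc0)); rewrite addrC lerD2r.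
have : c * (c `^ s * expR (- c)) <= K.
  rewrite mulrA -[X in X * _ * _](powRr1 (ltW c_gt0)) -powRD ?(gt_eqF c_gt0) ?implybT//.
  by rewrite addrC; apply: powR_expRN_le; rewrite ?addr_gt0// ltW.
rewrite -ler_pdivlMl// => /le_trans; apply.
rewrite ler_pdivrMl// -ler_pdivrMr//.
by rewrite le_max lexx orbT.
Qed.

(** Integration by parts on compact intervals: the boundary term at the left end
    has the favourable sign, and the one at the right end vanishes in the limit. *)
Lemma Gamma_succ_ge s : 0 < s -> s * Gamma s <= Gamma (s + 1).
Proof.
move=> s0; rewrite -ler_pdivlMl// -lee_fin -integral_Gamma//.
apply: integral_le_compact => //.
  exact: mg.
  by move=> x _; rewrite lee_fin; exact: g_ge0.
move=> b c0 b0 bc0; rewrite setIidr; last first.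
  by move=> x /=; rewrite !in_itv/= andbT => /andP[+ _]; exact: lt_le_trans.
set I := (X in (X <= _)%E).
have I0 : (0 <= I)%E by apply: integral_ge0 => x _; rewrite lee_fin; exact: g_ge0.
have key c : c0 < c -> (s%:E * I <= (Gamma (s + 1) + c `^ s * expR (- c))%:E)%E.
  move=> c0c; have bc := lt_trans bc0 c0c.
  have bpos x : b <= x -> 0 < x by exact: lt_le_trans.
  have cpow u x : b <= x -> {for x, continuous (fun y : R => y `^ u)}.
    by move=> /bpos; exact: continuous_powR.
  have cexp : continuous (fun x : R => - expR (- x)).
    move=> x; apply: cvgN; apply: continuous_comp; first exact: continuousN.
    exact: continuous_expR.
  have cexp' : continuous (fun x : R => expR (- x)).
    move=> x; apply: continuous_comp; first exact: continuousN.
    exact: continuous_expR.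
  have := @integration_by_parts R (fun x => x `^ s) (fun x => - expR (- x))
    (fun x => s * x `^ (s - 1)) (fun x => expR (- x)) b c bc.
  move=> IBP.
  have {}IBP : (\int[leb]_(x in `[b, c]) (x `^ s * expR (- x))%:E =
     (c `^ s * - expR (- c) - b `^ s * - expR (- b))%:E -
     \int[leb]_(x in `[b, c]) (s * x `^ (s - 1) * - expR (- x))%:E)%E.
    apply: IBP.
    - apply: continuous_in_subspaceT => x /[!inE]/=; rewrite in_itv/= => /andP[bx _].
      by apply: cvgM; [exact: cvg_cst|exact: cpow].
    - split.
      + move=> x; rewrite in_itv/= => /andP[/ltW/bpos x0 _].
        by apply: derivable_powR; rewrite in_itv/= x0.
      + by apply: cvg_at_right_filter; exact: cpow.
      + by apply: cvg_at_left_filter; apply: cpow; exact: ltW.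
    - move=> x; rewrite in_itv/= => /andP[/ltW/bpos x0 _].
      by rewrite powR_derive1// in_itv/= x0.
    - exact: continuous_subspaceT.
    - split.
      + by move=> x _; exact: ex_derive.
      + by apply: cvg_at_right_filter; exact: cexp.
      + by apply: cvg_at_left_filter; exact: cexp.
    - move=> x _; rewrite derive1E derive_val.
      by rewrite mulrN1 opprK.
  have IE : (s%:E * \int[leb]_(x in `[b, c]) (g s x)%:E =
      \int[leb]_(x in `[b, c]) (x `^ s * expR (- x))%:E +
      (c `^ s * expR (- c) - b `^ s * expR (- b))%:E)%E.
    rewrite IBP.
    have -> : (\int[leb]_(x in `[b, c]) (s * x `^ (s - 1) * - expR (- x))%:E =
        - (s%:E * \int[leb]_(x in `[b, c]) (g s x)%:E))%E.
      rewrite -ge0_integralZl//; last 3 first.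
      + exact: mg.
      + by move=> x _; rewrite lee_fin.
      + by rewrite lee_fin ltW.
      rewrite -integral_ge0N//; last first.
        by move=> x _; rewrite -EFinM lee_fin mulr_ge0// ltW.
      by apply: eq_integral => x _; rewrite -EFinM -EFinN /g mulrN mulrA.
    rewrite oppeK addeAC -EFinD [X in (X%:E + _)%E](_ : _ = 0%R) ?add0e//.
    by ring.
  apply: (@le_trans _ _ (s%:E * \int[leb]_(x in `[b, c]) (g s x)%:E)%E).
    rewrite lee_pmul2l//; apply: ge0_subset_integral => //; first exact: mg.
    + by move=> x _; rewrite lee_fin; exact: g_ge0.
    + by move=> x /=; rewrite !in_itv/= => /andP[-> /le_trans -> //]; exact: ltW.
  rewrite IE [leRHS]EFinD; apply: leeD.
    rewrite -integral_Gamma ?addr_gt0// addrK.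
    apply: ge0_subset_integral => //.
    + by have := @mg pos (s + 1); rewrite /g addrK.
    + by move=> x _; rewrite lee_fin mulr_ge0// ?powR_ge0 ?expR_ge0.
    + by move=> x /=; rewrite !in_itv/= andbT => /andP[+ _]; exact: lt_le_trans.
  by rewrite lee_fin gerBl mulr_ge0// ?powR_ge0 ?expR_ge0.
have Ifin : I \is a fin_num.
  rewrite ge0_fin_numE//; have := key (c0 + 1); rewrite ltrDl ltr01 => /(_ isT).
  by case: (I) I0 => [r _ _|_|//]; rewrite ?ltry// gt0_muley ?lte_fin// leye_eq.
move: key; rewrite -(fineK Ifin) => key; rewrite lee_fin ler_pdivlMl//.
by apply: (boundary_small s0 (lt_trans b0 bc0)) => c /key; rewrite -EFinM lee_fin.
Qed.

End gamma.

(** * Gaussian moments *)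
Section gaussian_moments.
Context {R : realType}.
Implicit Types (a s x b c e r : R).
Local Notation leb := (@lebesgue_measure R).
Local Notation pos := (`]0%R, +oo[%classic : set R).

Let g s (t : R) : R := t `^ (s - 1) * expR (- t).
Let k s c (y : R) : R := y `^ (2 * s - 1) * expR (- (c * y ^+ 2)).

Let g_ge0 s t : 0 <= g s t. Proof. by rewrite mulr_ge0// ?powR_ge0 ?expR_ge0. Qed.
Let k_ge0 s c t : 0 <= k s c t. Proof. by rewrite mulr_ge0// ?powR_ge0 ?expR_ge0. Qed.

Let mg D s : measurable_fun D (fun t => (g s t)%:E).
Proof.
apply/measurable_EFinP/measurable_funTS/measurable_funM.
  exact: measurable_powR.
by apply: measurableT_comp; [exact: measurable_expR|exact: measurable_funN].
Qed.

Let mk D s c : measurable_fun D (fun t => (k s c t)%:E).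
Proof.
apply/measurable_EFinP/measurable_funTS/measurable_funM.
  exact: measurable_powR.
apply: measurableT_comp; [exact: measurable_expR|apply: measurable_funN].
by apply: measurable_funM => //; exact: measurable_funX.
Qed.

Let subst s c b e : 0 < c -> 0 < b -> b < e ->
  (\int[leb]_(t in `[(c * b ^+ 2)%R, (c * e ^+ 2)%R]) (g s t)%:E =
  (2 * c `^ s)%:E * \int[leb]_(y in `[b, e]) (k s c y)%:E)%E.
Proof.
move=> c0 b0 be.
have dF x : derivable (fun y : R => c * y ^+ 2) x 1 by exact: ex_derive.
have F' : (fun y : R => c * y ^+ 2)^`()%classic = (fun y => 2 * c * y).
  apply/funext => x; rewrite derive1E derive_val.
  by rewrite /GRing.scale/=; ring.
have cF' : continuous (fun y : R => 2 * c * y) by exact: mulrl_continuous.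
have cF : continuous (fun y : R => c * y ^+ 2).
  by move=> x; apply: cvgM; [exact: cvg_cst|exact: exprn_continuous].
have := @integration_by_substitution_increasing R (fun y => c * y ^+ 2) (g s) b e (ltW be).
rewrite F' => ->.
- rewrite -ge0_integralZl//; last 3 first.
  + exact: mk.
  + by move=> y _; rewrite lee_fin.
  + by rewrite lee_fin mulr_ge0// powR_ge0.
  apply: eq_integral => y /[!inE]/=; rewrite in_itv/= => /andP[bY _].
  have y0 : 0 < y := lt_le_trans b0 bY.
  rewrite -EFinM; congr EFin.
  transitivity (g s (c * y ^+ 2) * (2 * c * y)); first by [].
  rewrite /g /k.
  rewrite powRM ?(ltW c0) ?sqr_ge0// -powR_mulrn ?(ltW y0)// -powRrM.
  have -> : c `^ s = c * c `^ (s - 1).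
    rewrite -[X in X * _](powRr1 (ltW c0)) -powRD ?(gt_eqF c0) ?implybT//.
    by congr (_ `^ _); ring.
  have -> : y `^ (2 * s - 1) = y * y `^ (2 * (s - 1)).
    rewrite -{2}(powRr1 (ltW y0)) -powRD ?(gt_eqF y0) ?implybT//.
    by congr (_ `^ _); ring.
  by ring.
- by move=> x y; rewrite !in_itv/= => /andP[bx _] /andP[bY _] xy;
    rewrite ltr_pM2l// ltr_pXn2r// ?nnegrE ?(le_trans (ltW b0)).
- by move=> x _; exact: cF'.
- by apply: cvgP; apply: cvg_at_right_filter; exact: cF'.
- by apply: cvgP; apply: cvg_at_left_filter; exact: cF'.
- split.
  + by move=> x _; exact: dF.
  + by apply: cvg_at_right_filter; exact: cF.
  + by apply: cvg_at_left_filter; exact: cF.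
- apply: continuous_in_subspaceT => x /[!inE]/=; rewrite in_itv/= => /andP[bx _].
  apply: cvgM.
    by apply: continuous_powR; apply: lt_le_trans bx; rewrite mulr_gt0 ?exprn_gt0.
  apply: continuous_comp; first exact: continuousN.
  exact: continuous_expR.
Qed.

Let sub_pos b e : 0 < b -> (`[b, e]%classic : set R) `<=` pos.
Proof. by move=> b0 x /=; rewrite !in_itv/= andbT => /andP[+ _]; exact: lt_le_trans. Qed.

(** The substitution [t = c y ^ 2] turns a Gaussian moment into a Gamma
    integral. *)
Lemma integral_gauss s c : 0 < s -> 0 < c ->
  (\int[leb]_(y in pos) (y `^ (2 * s - 1) * expR (- (c * y ^+ 2)))%:E =
   (c `^ (- s) * Gamma s / 2)%:E)%E.
Proof.
move=> s0 c0.
have K0 : 0 < 2 * c `^ s by rewrite mulr_gt0// powR_gt0.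
have GE : (\int[leb]_(t in pos) (g s t)%:E =
    (2 * c `^ s)%:E * \int[leb]_(y in pos) (k s c y)%:E)%E.
  apply/eqP; rewrite eq_le; apply/andP; split.
    apply: integral_le_compact => //.
    - by move=> x _; rewrite lee_fin.
    move=> b e b0 be; rewrite (setIidr (@sub_pos _ _ b0)).
    have e0 := lt_trans b0 be.
    pose sq x := Num.sqrt (x / c).
    have sqE x : 0 < x -> c * (sq x) ^+ 2 = x.
      by move=> x0; rewrite sqr_sqrtr ?divr_ge0 ?(ltW x0) ?(ltW c0)// mulrC divfK ?gt_eqF.
    rewrite -[in X in (X <= _)%E](sqE _ b0) -[in X in (X <= _)%E](sqE _ e0).
    have sb0 : 0 < sq b by rewrite sqrtr_gt0 divr_gt0.
    have sbe : sq b < sq e by rewrite ltr_sqrt ?divr_gt0// ltr_pM2r ?invr_gt0.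
    rewrite subst// lee_pmul2l//; apply: ge0_subset_integral => //.
    - exact: mk.
    - by move=> x _; rewrite lee_fin.
    - exact: (sub_pos sb0).
  rewrite -lee_pdivlMl//; apply: integral_le_compact => //.
  - by move=> x _; rewrite lee_fin.
  move=> b e b0 be; rewrite (setIidr (@sub_pos _ _ b0)).
  rewrite lee_pdivlMl// -subst//; apply: ge0_subset_integral => //.
  - exact: mg.
  - by move=> x _; rewrite lee_fin.
  - by apply: sub_pos; rewrite mulr_gt0// exprn_gt0.
move: GE; rewrite integral_Gamma//; set X := (X in (_ = _ * X)%E) => GE.
have X0 : (0 <= X)%E by apply: integral_ge0 => y _; rewrite lee_fin.
transitivity X => //.
move: X X0 GE => [r _ [->]|_|//]; last by rewrite gt0_muley// lte_fin.
congr EFin; rewrite powRN; field.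
by rewrite gt_eqF ?powR_gt0.
Qed.

(** The factor [y ^ (2 n)] raises the index of the measure from [a] to [a + n]. *)
Lemma mu_gauss_moment a n c : -1 < a -> 0 < c ->
  (\int[mu_ a]_y ((y ^+ 2) ^+ n * expR (- (c * y ^+ 2)))%:E =
   (c `^ (- (n%:R + a + 1)) * Gamma (n%:R + a + 1) / 2)%:E)%E.
Proof.
move=> a1 c0; rewrite integral_muE; last 2 first.
- apply/measurable_EFinP; apply: measurable_funM.
    by apply: measurable_funX; exact: measurable_funX.
  apply: measurableT_comp; [exact: measurable_expR|apply: measurable_funN].
  by apply: measurable_funM => //; exact: measurable_funX.
- by move=> y; rewrite lee_fin mulr_ge0// ?expR_ge0// exprn_ge0// sqr_ge0.
rewrite -integral_gauss//; last first.
  by rewrite -addrA ltr_wpDl// -ltrBlDr sub0r.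
apply: eq_integral => y /[!inE]/=; rewrite in_itv/= andbT => y0.
rewrite -EFinM; congr EFin; rewrite mulrAC; congr (_ * _).
rewrite -exprM -powR_mulrn ?(ltW y0)// -powRD ?(gt_eqF y0) ?implybT//.
by congr (_ `^ _); rewrite natrM; ring.
Qed.

End gaussian_moments.

(** * The heat kernel as a nonnegative series *)
Section heat_semigroup.
Context {R : realType}.
Implicit Types (a s t x y b c r u : R).

(** The [n]-th term of the Bessel series in the heat kernel, multiplied out: with
    [u = x ^ 2 / 4 t] and [v = y ^ 2 / 4 t] it is
    [2 (4 t) ^ (- a - 1) exp (- u - v) (u v) ^ n / (n! Gamma (n + a + 1))].  The
    powers [(x y) ^ (- a)] and [(x y) ^ a] have cancelled, so the term is defined
    and nonnegative on the whole plane.  The inverse of [4 t] is a real power to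
    make the term a composition of measurable functions in [t] as well. *)
Definition heat_term a (n : nat) t x y : R :=
  2 * (4 * t) `^ (- (a + 1)) * expR (- (x ^+ 2 * (4 * t) `^ (- 1)))
  * expR (- (y ^+ 2 * (4 * t) `^ (- 1)))
  * (x ^+ 2 * (4 * t) `^ (- 1) * (y ^+ 2 * (4 * t) `^ (- 1))) ^+ n
  / (n`!%:R * Gamma (n%:R + a + 1)).

Definition heat_series a t x y : \bar R :=
  (\sum_(n <oo) (heat_term a n t x y)%:E)%E.

Lemma Gamma_ge0 s : 0 <= Gamma s.
Proof.
rewrite /Gamma /Rintegral fine_ge0// integral_ge0// => t _.
by rewrite lee_fin mulr_ge0// ?powR_ge0 ?expR_ge0.
Qed.

Lemma heat_term_ge0 a n t x y : 0 <= heat_term a n t x y.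
Proof.
apply: divr_ge0; last by rewrite mulr_ge0 ?Gamma_ge0.
apply: mulr_ge0; last first.
  by rewrite exprn_ge0//; apply: mulr_ge0; apply: mulr_ge0; rewrite ?sqr_ge0 ?powR_ge0.
by rewrite !mulr_ge0 ?expR_ge0 ?powR_ge0.
Qed.

Lemma heat_series_ge0 a t x y : (0 <= heat_series a t x y)%E.
Proof. by apply: nneseries_ge0 => n _ _; rewrite lee_fin heat_term_ge0. Qed.

Lemma heat_seriesC a t x y : heat_series a t x y = heat_series a t y x.
Proof.
apply: eq_eseriesr => n _; congr EFin; rewrite /heat_term.
by rewrite (mulrC (x ^+ 2 * _) (y ^+ 2 * _)) [2 * _ * _ * _]mulrAC.
Qed.

Lemma measurable_heat_term a n d (T : measurableType d) (f g h : T -> R) :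
  measurable_fun setT f -> measurable_fun setT g -> measurable_fun setT h ->
  measurable_fun setT (fun z => heat_term a n (f z) (g z) (h z)).
Proof.
move=> mf mg mh.
have m4 e : measurable_fun setT (fun z => (4 * f z) `^ e).
  apply: (measurableT_comp (measurable_powR e)).
  by apply: measurable_funM.
have mS (k : T -> R) : measurable_fun setT k ->
    measurable_fun setT (fun z => k z ^+ 2 * (4 * f z) `^ (-1)).
  by move=> mk; apply: measurable_funM => //; exact: measurable_funX.
have mE (k : T -> R) : measurable_fun setT k ->
    measurable_fun setT (fun z => expR (- (k z ^+ 2 * (4 * f z) `^ (-1)))).
  move=> mk; apply: (measurableT_comp (@measurable_expR R)).
  by apply: measurable_funN; exact: mS.
rewrite /heat_term; apply: measurable_funM => //.
apply: measurable_funM; last by apply: measurable_funX; apply: measurable_funM; exact: mS.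
apply: measurable_funM; last exact: mE.
apply: measurable_funM; last exact: mE.
exact: measurable_funM.
Qed.

Lemma measurable_heat_series a d (T : measurableType d) (f g h : T -> R) :
  measurable_fun setT f -> measurable_fun setT g -> measurable_fun setT h ->
  measurable_fun setT (fun z => heat_series a (f z) (g z) (h z)).
Proof.
move=> mf mg mh; apply: ge0_emeasurable_sum => //.
  by move=> n z _ _; rewrite lee_fin heat_term_ge0.
by move=> n _; apply/measurable_EFinP; exact: measurable_heat_term.
Qed.

Lemma nneseries_EFin (w : R ^nat) : cvgn (series w) ->
  (\sum_(n <oo) (w n)%:E = (limn (series w))%:E)%E.
Proof.
move=> cw; rewrite -EFin_lim//; congr (limn _); apply/funext => n.
by rewrite sumEFin.
Qed.

Lemma nneseries_expR u : (\sum_(n <oo) (u ^+ n / n`!%:R)%:E = (expR u)%:E)%E.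
Proof.
by rewrite nneseries_EFin//; exact: is_cvg_series_exp_coeff.
Qed.

(** Term by term, the Gamma factor of the Gaussian moment cancels the one in the
    coefficient, and an exponential series remains.  This identity provides the
    mass and all the lower bounds below.  Negative [b] is allowed and
    gives exponential moments in [y ^ 2]. *)
Lemma heat_series_gauss a t b x : -1 < a -> 0 < t -> 0 < 1 + 4 * b * t ->
  (\int[mu_ a]_y ((expR (- (b * y ^+ 2)))%:E * heat_series a t x y) =
   ((1 + 4 * b * t) `^ (- (a + 1))
     * expR (- (b * x ^+ 2 / (1 + 4 * b * t))))%:E)%E.
Proof.
move=> a1 t0 D0; set D := 1 + 4 * b * t in D0 *.
have T0 : 0 < 4 * t by rewrite mulr_gt0.
set T := 4 * t in T0 *; set h := a + 1.
have h0 : 0 < h by rewrite -ltrBlDr sub0r.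
set u := x ^+ 2 / T.
have u0 : 0 <= u by rewrite divr_ge0 ?sqr_ge0 ?ltW.
pose A n := 2 * T `^ (- h) * expR (- u) * (u / T) ^+ n / (n`!%:R * Gamma (n%:R + a + 1)).
pose c := D / T.
have c0 : 0 < c by rewrite divr_gt0.
have G0 n : 0 < Gamma (n%:R + a + 1).
  by apply: Gamma_gt0; rewrite -addrA ltr_wpDl.
have A0 n : 0 <= A n.
  apply: divr_ge0; last by rewrite mulr_ge0 ?Gamma_ge0.
  apply: mulr_ge0; last by rewrite exprn_ge0// divr_ge0// ltW.
  by rewrite !mulr_ge0 ?expR_ge0 ?powR_ge0.
have termE n y : expR (- (b * y ^+ 2)) * heat_term a n t x y =
    A n * ((y ^+ 2) ^+ n * expR (- (c * y ^+ 2))).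
  rewrite /heat_term -/T powR_inv1 ?(ltW T0)// -/u -/h.
  rewrite (_ : - (c * y ^+ 2) = - (b * y ^+ 2) + - (y ^+ 2 / T)); last first.
    by rewrite /c /D /T; field; rewrite gt_eqF.
  rewrite expRD /A !exprMn; ring.
under eq_integral => y _.
  rewrite -nneseriesZl; last by move=> n _; rewrite lee_fin heat_term_ge0.
  under eq_eseriesr => n _ do rewrite -EFinM termE.
  over.
rewrite integral_nneseries//; last 2 first.
- move=> n; apply/measurable_EFinP; apply: measurable_funM => //.
  apply: measurable_funM; first by apply: measurable_funX; exact: measurable_funX.
  apply: measurableT_comp; [exact: measurable_expR|apply: measurable_funN].
  by apply: measurable_funM => //; exact: measurable_funX.
- by move=> n y _; rewrite lee_fin mulr_ge0// mulr_ge0 ?expR_ge0// exprn_ge0// sqr_ge0.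
transitivity (\sum_(n <oo) ((D `^ (- h) * expR (- u))%:E *
    ((u / D) ^+ n / n`!%:R)%:E))%E; last first.
  rewrite nneseriesZl; last first.
    move=> n _; rewrite lee_fin divr_ge0// exprn_ge0// divr_ge0// ltW//.
  rewrite nneseries_expR -EFinM; congr EFin; rewrite -[LHS]mulrA -expRD.
  congr (_ * expR _).
  by rewrite /u /D /T; field; rewrite ?gt_eqF.
apply: eq_eseriesr => n _.
under eq_integral do rewrite EFinM.
rewrite ge0_integralZl_EFin//; last 2 first.
- by move=> y _; rewrite lee_fin mulr_ge0 ?expR_ge0// exprn_ge0// sqr_ge0.
- apply/measurable_EFinP.
  apply: measurable_funM; first by apply: measurable_funX; exact: measurable_funX.
  apply: measurableT_comp; [exact: measurable_expR|apply: measurable_funN].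
  by apply: measurable_funM => //; exact: measurable_funX.
rewrite mu_gauss_moment// -!EFinM; congr EFin.
have -> : c `^ (- (n%:R + a + 1)) = D `^ (- h) * T `^ h * (T / D) ^+ n.
  rewrite (_ : - (n%:R + a + 1) = - h - n%:R); last by rewrite /h; ring.
  rewrite powRD ?(gt_eqF c0) ?implybT// powR_invn ?(ltW c0)// -exprVn invf_div.
  congr (_ * _); rewrite powRM ?invr_ge0 ?(ltW D0) ?(ltW T0)//.
  by rewrite -(powR_inv1 (ltW T0)) -powRrM mulN1r opprK.
have -> : (u / D) ^+ n = (u / T) ^+ n * (T / D) ^+ n.
  by rewrite -exprMn; congr (_ ^+ _); field; rewrite !gt_eqF.
rewrite /A powRN; field.
by rewrite !gt_eqF ?powR_gt0 ?G0// ltr0n fact_gt0.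
Qed.

Lemma heat_series_total a t x : -1 < a -> 0 < t ->
  (\int[mu_ a]_y heat_series a t x y = 1)%E.
Proof.
move=> a1 t0; have := @heat_series_gauss a t 0 x a1 t0.
rewrite mulr0 mul0r addr0 powR1 !mul0r oppr0 expR0 mul1r => <-//.
by apply: eq_integral => y _; rewrite mul0r oppr0 expR0 mul1e.
Qed.

(** For [a >= -1/2] the coefficients of the Bessel series are dominated by those
    of an exponential: both sides are products, and [k + a >= k - 1/2] factor by
    factor. *)
Lemma Gamma_double_fact a n : - (1 / 2) <= a ->
  Gamma (a + 1) * (n.*2)`!%:R <= 4 ^+ n * n`!%:R * Gamma (n%:R + a + 1).
Proof.
move=> a2; elim: n => [|n IH]; first by rewrite double0 fact0 add0r expr0 !mul1r mulr1.
have pos1 : 0 < n%:R + a + 1.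
  by rewrite -addrA ltr_wpDl//; lra.
have -> : n.+1%:R + a + 1 = (n%:R + a + 1) + 1 :> R.
  by rewrite -natr1; ring.
have GG' := Gamma_succ_ge pos1.
apply: (@le_trans _ _ (4 ^+ n.+1 * n.+1`!%:R * ((n%:R + a + 1) * Gamma (n%:R + a + 1)))); last first.
  by rewrite ler_wpM2l// mulr_ge0// exprn_ge0.
rewrite doubleS !factS !natrM exprS.
rewrite [leLHS](_ : _ = (n.*2.+2)%:R * (n.*2.+1)%:R * (Gamma (a + 1) * n.*2`!%:R)); last by ring.
rewrite [leRHS](_ : _ = (4 * n.+1%:R * (n%:R + a + 1)) * (4 ^+ n * n`!%:R * Gamma (n%:R + a + 1)));
  last by ring.
apply: ler_pM => //; first by rewrite mulr_ge0// Gamma_ge0.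
have -> : (n.*2.+2)%:R = 2 * (n.+1)%:R :> R by rewrite -doubleS -mul2n natrM.
have -> : (n.*2.+1)%:R = 2 * n%:R + 1 :> R by rewrite -natr1 -mul2n natrM.
have -> : 4 * n.+1%:R * (n%:R + a + 1) = 2 * n.+1%:R * (2 * (n%:R + a + 1)) by ring.
by rewrite ler_wpM2l//; lra.
Qed.

Lemma series_even_exp_le (w : R) N : 0 <= w ->
  \sum_(0 <= n < N) w ^+ n.*2 / (n.*2)`!%:R <= expR w.
Proof.
move=> w0; apply: (@le_trans _ _ (\sum_(0 <= n < N.*2) w ^+ n / n`!%:R)).
  elim: N => [|N IH]; first by rewrite !big_nil.
  rewrite doubleS !big_nat_recr//= -addrA lerD// lerDl.
  by rewrite divr_ge0// exprn_ge0.
have : (\sum_(0 <= n < N.*2) (w ^+ n / n`!%:R)%:E <= (expR w)%:E)%E.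
  rewrite -nneseries_expR; apply: nneseries_lim_ge => n _.
  by rewrite lee_fin divr_ge0// exprn_ge0.
by rewrite sumEFin lee_fin.
Qed.

End heat_semigroup.

Section heat_kernel.
Context {R : realType}.
Implicit Types (a s t x y b c r u : R).

(** After the domination above, the Bessel series contributes at most
    [exp (2 |x y| / 4 t)], which the Gaussian factor [exp (- (x^2 + y^2) / 4 t)]
    absorbs. *)
Lemma heat_series_le a t x y : - (1 / 2) <= a -> 0 < t ->
  (heat_series a t x y <=
    (2 * 4 `^ (- (a + 1)) / Gamma (a + 1) * t `^ (- (a + 1)))%:E)%E.
Proof.
move=> a2 t0; have T0 : 0 < 4 * t by rewrite mulr_gt0.
have G0 : 0 < Gamma (a + 1) by apply: Gamma_gt0; lra.
apply: lime_le.
  by apply: is_cvg_nneseries => n _ _; rewrite lee_fin heat_term_ge0.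
apply: nearW => N; rewrite sumEFin lee_fin.
set u := x ^+ 2 / (4 * t); set v := y ^+ 2 / (4 * t).
set w := `|x * y| / (4 * t).
have w0 : 0 <= w by rewrite divr_ge0// ltW.
have uvw : u * v = w ^+ 2.
  by rewrite /u /v /w exprMn real_normK ?num_real// exprMn exprVn; field; rewrite gt_eqF.
have wuv : 2 * w <= u + v.
  rewrite /u /v /w -mulrDl mulrA ler_pM2r ?invr_gt0// normrM.
  rewrite -(real_normK (num_real x)) -(real_normK (num_real y)).
  have := sqr_ge0 (`|x| - `|y|); rewrite sqrrB; lra.
set P := 2 * (4 * t) `^ (- (a + 1)).
have P0 : 0 <= P by rewrite mulr_ge0// powR_ge0.
set E := P * expR (- u) * expR (- v).
have E0 : 0 <= E by rewrite (mulr_ge0 (mulr_ge0 P0 _))// expR_ge0.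
apply: (@le_trans _ _ (\sum_(0 <= n < N) E / Gamma (a + 1)
   * ((2 * w) ^+ n.*2 / (n.*2)`!%:R))).
  apply: ler_sum => n _; rewrite /heat_term powR_inv1 ?(ltW T0)// -/u -/v -/P -/E.
  have Gn0 : 0 < n`!%:R * Gamma (n%:R + a + 1).
    by rewrite mulr_gt0 ?ltr0n ?fact_gt0//; apply: Gamma_gt0; rewrite -addrA ltr_wpDl//; lra.
  have Gd0 : 0 < Gamma (a + 1) * (n.*2)`!%:R by rewrite mulr_gt0// ltr0n fact_gt0.
  have -> : (2 * w) ^+ n.*2 = 4 ^+ n * (u * v) ^+ n.
    by rewrite uvw -exprMn -mul2n exprM; congr (_ ^+ _); ring.
  have -> : E / Gamma (a + 1) * (4 ^+ n * (u * v) ^+ n / n.*2`!%:R) =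
      E * (u * v) ^+ n * (4 ^+ n / (Gamma (a + 1) * n.*2`!%:R)).
    by rewrite invfM; ring.
  apply: ler_wpM2l; first by rewrite mulr_ge0// uvw exprn_ge0// exprn_ge0.
  rewrite ler_pdivlMr// ler_pdivrMl//.
  by apply: le_trans (Gamma_double_fact n a2) _; rewrite mulrC mulrA mulrAC (mulrC (Gamma _)) mulrAC.
rewrite -mulr_sumr.
apply: (@le_trans _ _ (E / Gamma (a + 1) * expR (2 * w))).
  apply: ler_wpM2l; first by rewrite divr_ge0// ltW.
  by apply: series_even_exp_le; rewrite mulr_ge0.
have -> : 2 * 4 `^ (- (a + 1)) / Gamma (a + 1) * t `^ (- (a + 1)) = P / Gamma (a + 1).
  by rewrite /P powRM// ?(ltW t0)//; ring.
rewrite mulrAC; apply: ler_wpM2r; first by rewrite invr_ge0 ltW.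
have -> : E * expR (2 * w) = P * expR (2 * w - (u + v)).
  by rewrite /E -[LHS]mulrA -[LHS]mulrA -!expRD; congr (_ * expR _); ring.
by rewrite ler_piMr// expR_le1 subr_le0.
Qed.

(** The power [(x y) ^ a] in the Bessel series cancels the prefactor, and
    [Gamma_ge] gives the convergence of the series by comparison with an
    exponential series. *)
Lemma heat_kernelE a t x y : -1 < a -> 0 < t -> 0 < x -> 0 < y ->
  (heat_kernel a t x y)%:E = heat_series a t x y.
Proof.
move=> a1 t0 x0 y0.
have T0 : 0 < 4 * t by rewrite mulr_gt0.
have xy0 : 0 < x * y by rewrite mulr_gt0.
set z := x * y / (2 * t).
have zE : z / 2 = x * y / (4 * t) by rewrite /z; field; rewrite gt_eqF.
set r := z / 2 in zE.
have r0 : 0 < r by rewrite zE divr_gt0.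
set w := fun n : nat => r `^ (2 * n%:R + a) / (n`!%:R * Gamma (n%:R + a + 1)).
have G1 (n : nat) : 0 < n%:R + a + 1 by rewrite -addrA ltr_wpDl// -ltrBlDr sub0r.
have w0 n : 0 <= w n by rewrite divr_ge0 ?powR_ge0// mulr_ge0// Gamma_ge0.
have rpow n : r `^ (2 * n%:R + a) = r `^ a * (r ^+ 2) ^+ n.
  rewrite addrC powRD ?(gt_eqF r0) ?implybT//; congr (_ * _).
  by rewrite -exprM -powR_mulrn ?(ltW r0)// natrM.
have cw : cvgn (series w).
  apply: (@series_le_cvg _ _ (r `^ a / (expR (- 2) / 2) *: exp_coeff (r ^+ 2))) => //.
  - move=> n; rewrite /= /GRing.scale/= /exp_coeff/=.
    by apply: mulr_ge0; apply: divr_ge0;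
      rewrite ?powR_ge0 ?divr_ge0 ?expR_ge0 ?exprn_ge0 ?(ltW r0) ?ler0n.
  - move=> n; rewrite /w rpow /GRing.scale/= /exp_coeff /=.
    rewrite [leLHS](_ : _ = r `^ a * ((r ^+ 2) ^+ n / n`!%:R) / Gamma (n%:R + a + 1)); last first.
      by rewrite invfM; ring.
    rewrite [leRHS]mulrAC ler_wpM2l//; first by rewrite mulr_ge0 ?powR_ge0// divr_ge0// exprn_ge0// sqr_ge0.
    by rewrite lef_pV2 ?posrE ?Gamma_gt0// ?Gamma_ge// divr_gt0// expR_gt0.
  - by apply: is_cvg_seriesZ; exact: is_cvg_series_exp_coeff.
rewrite /heat_kernel /besselI -/z -/r -/w EFinM -nneseries_EFin//.
rewrite -nneseriesZl; last by move=> n _; rewrite lee_fin.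
apply: eq_eseriesr => n _; rewrite -EFinM; congr EFin.
rewrite /heat_term powR_inv1 ?(ltW T0)// /w rpow zE.
have -> : (x * y / (4 * t)) ^+ 2 = x ^+ 2 / (4 * t) * (y ^+ 2 / (4 * t)).
  by field; rewrite gt_eqF.
have -> : - ((x ^+ 2 + y ^+ 2) / (4 * t)) = - (x ^+ 2 / (4 * t)) + - (y ^+ 2 / (4 * t)).
  by ring.
have -> : (x * y / (4 * t)) `^ a = (x * y) `^ a * (4 * t) `^ (- a).
  rewrite powRM ?(ltW xy0) ?invr_ge0 ?(ltW T0)//; congr (_ * _).
  by rewrite -(powR_inv1 (ltW T0)) -powRrM mulN1r.
have -> : (4 * t) `^ (- (a + 1)) = (4 * t) `^ (- a) / (4 * t).
  by rewrite opprD powRD ?(gt_eqF T0) ?implybT// powR_inv1 ?(ltW T0).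
rewrite expRD (powRN (x * y)) [(2 * t)^-1](_ : _ = 2 / (4 * t)); last first.
  by field; rewrite gt_eqF.
set N := n`!%:R * _; set Q := (_ ^+ n).
rewrite [LHS](_ : _ = 2 * (4 * t) `^ (- a) / (4 * t) * expR (- (x ^+ 2 / (4 * t)))
   * expR (- (y ^+ 2 / (4 * t))) * Q / N * ((x * y) `^ a / (x * y) `^ a)); last by ring.
by rewrite divff ?mulr1 ?gt_eqF ?powR_gt0//; ring.
Qed.

End heat_kernel.

(** * The potential kernel *)
Section iterated_integrals.
Context d1 d2 (T1 : measurableType d1) (T2 : measurableType d2) (R : realType).
Variables (m1 : {sigma_finite_measure set T1 -> \bar R})
          (m2 : {sigma_finite_measure set T2 -> \bar R}).
Local Open Scope ereal_scope.

Lemma tonelli (f : T1 -> T2 -> \bar R) :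
  measurable_fun setT (fun z => f z.1 z.2) -> (forall x y, 0 <= f x y) ->
  \int[m1]_x \int[m2]_y f x y = \int[m2]_y \int[m1]_x f x y.
Proof.
by move=> mf f0; exact: (@fubini_tonelli _ _ _ _ _ m1 m2 (fun z => f z.1 z.2)).
Qed.

Lemma measurable_integral2 (f : T1 -> T2 -> \bar R) :
  measurable_fun setT (fun z => f z.1 z.2) -> (forall x y, 0 <= f x y) ->
  measurable_fun setT (fun x => \int[m2]_y f x y).
Proof.
by move=> mf f0; exact: (@measurable_fun_fubini_tonelli_F _ _ _ _ _ m2 (fun z => f z.1 z.2)).
Qed.

End iterated_integrals.

Section potential_kernel.
Context {R : realType}.
Implicit Types (a s t x y b c r u : R).
Local Notation leb := (@lebesgue_measure R).
Local Notation pos := (`]0%R, +oo[%classic : set R).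
Local Notation RR := (measurableTypeR R).
Local Notation tm s := (mu_ (s / 2 - 1)).

Lemma eq_integral_pos a (g u : RR -> \bar R) :
  (forall x, 0 <= g x)%E -> (forall x, 0 <= u x)%E ->
  (forall x, 0 < x -> (g x = u x)%E) ->
  (\int[mu_ a]_x g x = \int[mu_ a]_x u x)%E.
Proof.
by move=> g0 u0 gu; apply/eqP; rewrite eq_le !le_integral_pos// => x /gu ->.
Qed.

Lemma integral_tm s (f : RR -> \bar R) : measurable_fun setT f ->
  (forall x, 0 <= f x)%E ->
  (\int[tm s]_t f t = \int[leb]_(t in pos) (f t * (t `^ (s - 1))%:E))%E.
Proof.
move=> mf f0; rewrite integral_muE; [|exact: mf|exact: f0].
have -> : 2 * (s / 2 - 1) + 1 = s - 1 by field.
by [].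
Qed.

(** The potential kernel extended to the whole plane, where it is symmetric and
    jointly measurable.  Here and below [tm s], that is [mu_ (s / 2 - 1)], is the
    measure [t ^ (s - 1) dt] on the half-line, so that time and space integrals
    obey the same lemmas. *)
Definition pkernel a s x y : \bar R :=
  ((Gamma s)^-1%:E * \int[tm s]_t ((expR (- t))%:E * heat_series a t x y))%E.

Lemma invGamma_ge0 s : (0 <= (Gamma s)^-1%:E :> \bar R)%E.
Proof. by rewrite lee_fin invr_ge0 Gamma_ge0. Qed.

Lemma pkernel_ge0 a s x y : (0 <= pkernel a s x y)%E.
Proof.
rewrite mule_ge0 ?invGamma_ge0// integral_ge0// => t _.
by rewrite mule_ge0 ?heat_series_ge0// lee_fin expR_ge0.
Qed.

Lemma pkernelC a s x y : pkernel a s x y = pkernel a s y x.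
Proof. by apply: (congr1 (fun X => _ * X)%E); apply: eq_integral => t _; rewrite (heat_seriesC a t x y). Qed.

Let mexpN d (T : measurableType d) (f : T -> R) : measurable_fun setT f ->
  measurable_fun setT (fun z => (expR (- f z))%:E).
Proof.
move=> mf; apply/measurable_EFinP; apply: (measurableT_comp (@measurable_expR R)).
exact: measurable_funN.
Qed.

Lemma measurable_pkernel a s : measurable_fun (setT : set (RR * RR)%type)
  (fun z => pkernel a s z.1 z.2).
Proof.
apply: measurable_funeM.
apply: (@measurable_integral2 _ _ (RR * RR)%type RR _ (tm s)
  (fun z t => ((expR (- t))%:E * heat_series a t z.1 z.2)%E)) => /=.
  apply: emeasurable_funM; first by apply: mexpN; exact: measurable_snd.
  apply: measurable_heat_series; first exact: measurable_snd.
  - by apply: measurableT_comp; [exact: measurable_fst|exact: measurable_fst].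
  - by apply: measurableT_comp; [exact: measurable_snd|exact: measurable_fst].
by move=> z t; rewrite mule_ge0 ?heat_series_ge0// lee_fin expR_ge0.
Qed.

Lemma potential_kernelE a s x y : -1 < a -> 0 < x -> 0 < y ->
  potential_kernel a s x y = pkernel a s x y.
Proof.
move=> a1 x0 y0; congr (_ * _)%E; rewrite integral_tm//; last 2 first.
- apply: emeasurable_funM; first by apply: (@mexpN _ RR (fun t => t)); exact: measurable_id.
  by apply: measurable_heat_series.
- by move=> t; rewrite mule_ge0 ?heat_series_ge0// lee_fin expR_ge0.
apply: eq_integral => t /[!inE]/=; rewrite in_itv/= andbT => t0.
by rewrite -heat_kernelE// -!EFinM.
Qed.

Lemma potentialE a s (f : RR -> R) x : -1 < a -> 0 < x ->
  measurable_fun setT f -> (forall y, 0 <= f y) ->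
  potential a s f x = (\int[mu_ a]_y (pkernel a s x y * (f y)%:E))%E.
Proof.
move=> a1 x0 mf f0; rewrite /potential integral_mkcond.
set g := (X in (\int[_]_x X x = _)%E).
have gE y : 0 < y -> g y = (pkernel a s x y * (f y)%:E)%E.
  move=> y0; rewrite /g patchE mem_set ?potential_kernelE//=.
  by rewrite in_itv/= y0.
have g0 y : (0 <= g y)%E.
  have [y0|y0] := ltP 0 y; first by rewrite gE// mule_ge0 ?pkernel_ge0// lee_fin.
  by rewrite /g patchE memNset//= in_itv/= andbT; apply/negP; rewrite -leNgt.
apply: (@eq_integral_pos a g) => [|y|y y0]; [exact: g0| |exact: gE].
by rewrite mule_ge0 ?pkernel_ge0// lee_fin.
Qed.

(** By Tonelli, integrals against the kernel reduce to the heat kernel at fixed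
    times. *)
Lemma integral_pkernel a s (f : RR -> \bar R) x :
  measurable_fun setT f -> (forall y, 0 <= f y)%E ->
  (\int[mu_ a]_y (pkernel a s x y * f y) = (Gamma s)^-1%:E *
    \int[tm s]_t ((expR (- t))%:E * \int[mu_ a]_y (heat_series a t x y * f y)))%E.
Proof.
move=> mf f0.
have mh t : measurable_fun setT (fun y : RR => heat_series a t x y).
  by apply: measurable_heat_series.
have mt y : measurable_fun setT (fun t : RR => ((expR (- t))%:E * heat_series a t x y)%E).
  apply: emeasurable_funM; first by apply: (@mexpN _ RR (fun t => t)); exact: measurable_id.
  by apply: measurable_heat_series.
have e0 t y : (0 <= (expR (- t))%:E * heat_series a t x y)%E.
  by rewrite mule_ge0 ?heat_series_ge0// lee_fin expR_ge0.
have mj : measurable_fun (setT : set (RR * RR))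
    (fun z => ((expR (- z.2))%:E * heat_series a z.2 x z.1 * f z.1)%E).
  apply: emeasurable_funM; last by apply: measurableT_comp => //; exact: measurable_fst.
  apply: emeasurable_funM; first by apply: mexpN; exact: measurable_snd.
  by apply: measurable_heat_series.
pose I y := (\int[tm s]_t ((expR (- t))%:E * heat_series a t x y * f y))%E.
have mI : measurable_fun (setT : set RR) I.
  apply: (@measurable_integral2 _ _ RR RR _ (tm s)
    (fun y t => (expR (- t))%:E * heat_series a t x y * f y)%E) => //.
  by move=> y t; rewrite mule_ge0.
have I0 (y : RR) : setT y -> (0 <= I y)%E.
  by move=> _; apply: integral_ge0 => t _; rewrite mule_ge0.
transitivity (\int[mu_ a]_y ((Gamma s)^-1%:E * I y))%E.
  apply: eq_integral => y _; rewrite /pkernel -muleA; congr (_ * _)%E.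
  rewrite /I ge0_integralZr//.
rewrite (ge0_integralZl (mu_ a) measurableT mI I0 (invGamma_ge0 s)) /I.
apply: (congr1 (fun X => _ * X)%E).
pose J y t := ((expR (- t))%:E * heat_series a t x y * f y)%E.
have J0 y t : (0 <= J y t)%E by rewrite mule_ge0.
rewrite (@tonelli _ _ RR RR R (mu_ a) (tm s) J mj J0).
apply: eq_integral => t _.
have fh0 (y : RR) : setT y -> (0 <= heat_series a t x y * f y)%E.
  by move=> _; rewrite mule_ge0// heat_series_ge0.
have e1 : (0 <= (expR (- t))%:E :> \bar R)%E by rewrite lee_fin expR_ge0.
rewrite -(ge0_integralZl (mu_ a) measurableT (emeasurable_funM (mh t) mf) fh0 e1).
by apply: eq_integral => y _; rewrite /J muleA.
Qed.

Lemma pkernel_gauss a s b x : -1 < a -> 0 <= b ->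
  (\int[mu_ a]_y (pkernel a s x y * (expR (- (b * y ^+ 2)))%:E) = (Gamma s)^-1%:E *
    \int[tm s]_t (expR (- t) * ((1 + 4 * b * t) `^ (- (a + 1))
     * expR (- (b * x ^+ 2 / (1 + 4 * b * t)))))%:E)%E.
Proof.
move=> a1 b0; rewrite integral_pkernel; last 2 first.
- apply: (@mexpN _ RR (fun y => b * y ^+ 2)); apply: measurable_funM => //; exact: measurable_funX.
- by move=> y; rewrite lee_fin expR_ge0.
congr (_ * _)%E; apply: eq_integral_pos => [t|t|t t0].
- rewrite mule_ge0 ?lee_fin ?expR_ge0// integral_ge0// => y _.
  by rewrite mule_ge0 ?heat_series_ge0// lee_fin expR_ge0.
- by rewrite lee_fin !mulr_ge0 ?expR_ge0// powR_ge0.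
rewrite EFinM -heat_series_gauss//; last first.
  by rewrite ltr_wpDr// !mulr_ge0// ltW.
by congr (_ * _)%E; apply: eq_integral => y _; rewrite muleC.
Qed.

Lemma pkernel_total a s x : -1 < a -> 0 < s ->
  (\int[mu_ a]_y pkernel a s x y = 1)%E.
Proof.
move=> a1 s0; have := @pkernel_gauss a s 0 x a1 (lexx _).
under eq_integral do rewrite mul0r oppr0 expR0 mule1.
move=> ->; under eq_integral do
  rewrite mulr0 mul0r addr0 powR1 !mul0r oppr0 expR0 !mulr1.
rewrite integral_tm; last 2 first.
- by apply: (@mexpN _ RR (fun t => t)); exact: measurable_id.
- by move=> t; rewrite lee_fin expR_ge0.
under eq_integral do rewrite -EFinM mulrC.
by rewrite integral_Gamma// -EFinM mulVf// gt_eqF// Gamma_gt0.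
Qed.

End potential_kernel.

(** * Duality and bilinear estimates *)
Section duality.
Context d (T : measurableType d) (R : realType).
Variable m : {sigma_finite_measure set T -> \bar R}.
Implicit Types (f g : T -> R) (p q r s : R).

Lemma measurable_powR_comp f p : measurable_fun setT f ->
  measurable_fun setT (fun x => ((f x) `^ p)%:E).
Proof.
move=> mf; apply/measurable_EFinP; exact: (measurableT_comp (measurable_powR p)).
Qed.

(** The truncations [w n], of height [n] and supported in a set of finite measure,
    increase to [u] and have finite integrals.  This is what makes it legitimate
    to test with a multiple of [w n ^ (q - 1)] and to divide by the norm of
    [w n]. *)
Lemma dual_Lp_bound q r C (u : T -> \bar R) : 1 < q -> q^-1 + r^-1 = 1 -> 0 <= C ->
  measurable_fun setT u -> (forall x, 0 <= u x)%E ->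
  (forall g, measurable_fun setT g -> (forall x, 0 <= g x) ->
     (\int[m]_x ((g x) `^ r)%:E <= 1)%E ->
     (\int[m]_x ((g x)%:E * u x) <= C%:E)%E) ->
  (\int[m]_x (u x `^ q) <= (C `^ q)%:E)%E.
Proof.
move=> q1 qr C0 mu u0 H.
have q0 : 0 < q := lt_trans ltr01 q1.
have r1 : r^-1 = 1 - q^-1 by rewrite -qr addrC addKr.
have r0 : 0 < r by rewrite -invr_gt0 r1 subr_gt0 invf_lt1.
have [F [FT ndF mF]] := (sigma_finiteP setT m).1 (sigma_finiteT m).
pose w (n : nat) x : R := fine (mine (u x) n%:R%:E) * \1_(F n) x.
have mw n : measurable_fun setT (w n).
  apply: measurable_funM.
    apply: (measurableT_comp (@fine_measurable R setT measurableT)).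
    exact: measurable_mine.
  by apply: measurable_indic; exact: (mF n).1.
have min_fin n x : mine (u x) n%:R%:E \is a fin_num.
  have h0 : (0 <= mine (u x) n%:R%:E)%E by rewrite le_min u0 lee_fin/=.
  rewrite ge0_fin_numE//; by rewrite (@le_lt_trans _ _ n%:R%:E) ?ge_min ?lexx ?orbT ?ltry.
have min_ge0 n x : 0 <= fine (mine (u x) n%:R%:E).
  by rewrite fine_ge0// le_min u0 lee_fin/=.
have w0 n x : 0 <= w n x by rewrite mulr_ge0.
have wu n x : ((w n x)%:E <= u x)%E.
  rewrite /w indicE; case: (_ \in _); rewrite ?mulr1 ?mulr0//.
  by rewrite fineK// ge_min lexx.
have wn n x : w n x <= n%:R * \1_(F n) x.
  by rewrite ler_wpM2r// -lee_fin fineK// ge_min lexx orbT.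
have wnd x : {homo (fun n => (w n x)%:E) : n k / (n <= k)%N >-> (n <= k)%E}.
  move=> n k nk; rewrite lee_fin /w ler_pM//.
    rewrite fine_le// le_min ge_min lexx/= ge_min; apply/orP; right.
    by rewrite lee_fin ler_nat.
  rewrite !indicE ler_nat; have /subsetPset Fnk := ndF _ _ nk.
  by case: (boolP (x \in F n)) => // /[!inE] /Fnk Fkx; rewrite mem_set.
have inF x : exists n0, F n0 x.
  by have : [set: T] x by []; rewrite FT => -[n0 _ Fx]; exists n0.
have wcv x : (fun n => ((w n x) `^ q)%:E) @ \oo --> (u x `^ q)%E.
  have [n0 Fn0] := inF x.
  have Fin n : (n0 <= n)%N -> w n x = fine (mine (u x) n%:R%:E).
    move=> n0n; rewrite /w indicE mem_set ?mulr1//.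
    by have /subsetPset := ndF _ _ n0n; exact.
  move: (u0 x) Fin; case: (u x) => [v v0 Fin|_ Fin|//].
    apply: cvg_near_cst; near=> n.
    rewrite Fin; last by near: n; exact: nbhs_infty_ge.
    rewrite poweR_EFin; congr (EFin (_ `^ _)).
    rewrite min_l//= lee_fin.
    have vn : v <= (Num.truncn v).+1%:R by rewrite ltW// truncnS_gt.
    by apply: (le_trans vn); rewrite ler_nat; near: n; exact: nbhs_infty_ge.
  rewrite poweRyr ?gt_eqF//; apply/cvgeyPge => A; near=> n.
  rewrite Fin; last by near: n; exact: nbhs_infty_ge.
  rewrite min_r ?leey//= lee_fin.
  apply: (@le_trans _ _ n%:R).
    apply: (@le_trans _ _ (Num.truncn A).+1%:R); first by rewrite ltW// truncnS_gt.
    by rewrite ler_nat; near: n; exact: nbhs_infty_ge.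
  apply: le1r_powR; rewrite ?(ltW q1)// ler1n; near: n; exact: nbhs_infty_gt.
have bound n : (\int[m]_x ((w n x) `^ q)%:E <= (C `^ q)%:E)%E.
  set A := (\int[m]_x _)%E.
  have A0 : (0 <= A)%E by apply: integral_ge0 => x _; rewrite lee_fin powR_ge0.
  have Afin : A \is a fin_num.
    rewrite ge0_fin_numE//.
    apply: (@le_lt_trans _ _ (\int[m]_x ((n%:R `^ q)%:E * (\1_(F n) x)%:E))%E).
      apply: ge0_le_integral => //.
      - by move=> x _; rewrite lee_fin powR_ge0.
      - exact: measurable_powR_comp.
      - apply: measurable_funeM; apply/measurable_EFinP; apply: measurable_indic.
        exact: (mF n).1.
      - move=> x _; rewrite -EFinM lee_fin.
        apply: (@le_trans _ _ ((n%:R * \1_(F n) x) `^ q)).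
          by apply: ge0_ler_powR => //; rewrite ?nnegrE ?(ltW q0)// mulr_ge0.
        rewrite indicE; case: (_ \in _); rewrite ?mulr1 ?mulr0// powR0//.
        by rewrite gt_eqF.
    rewrite ge0_integralZl ?lee_fin ?powR_ge0//; last first.
      by apply/measurable_EFinP; apply: measurable_indic; exact: (mF n).1.
    rewrite integral_indic//; last exact: (mF n).1.
    rewrite setIT lte_mul_pinfty// ?lee_fin ?powR_ge0//; exact: (mF n).2.
  rewrite -(fineK Afin) lee_fin; set a := fine A.
  have a0 : 0 <= a by rewrite fine_ge0.
  have [->|an0] := eqVneq a 0; first by rewrite powR_ge0.
  have a_gt0 : 0 < a by rewrite lt_neqAle eq_sym an0.
  (* This normalizes [g] in [L^r], because [(q - 1) r = q]. *)
  pose c := a `^ (- r^-1).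
  have c0 : 0 < c by rewrite powR_gt0.
  pose g x := c * (w n x) `^ (q - 1).
  have mg : measurable_fun setT g.
    by apply: measurable_funM => //; apply: (measurableT_comp (measurable_powR _)).
  have g0 x : 0 <= g x by rewrite mulr_ge0 ?powR_ge0// ltW.
  have qr1 : (q - 1) * r = q.
    apply: (@mulIf _ r^-1); first by rewrite invr_eq0 gt_eqF.
    rewrite -mulrA divff ?gt_eqF// mulr1 r1 mulrBr mulr1 divff ?gt_eqF//.
  have gr : (\int[m]_x ((g x) `^ r)%:E <= 1)%E.
    have gE x : (g x) `^ r = a^-1 * (w n x) `^ q.
      rewrite /g powRM ?powR_ge0 ?(ltW c0)// -[in X in _ * X]powRrM qr1 /c -powRrM.
      by rewrite mulNr mulVf ?gt_eqF// powR_inv1.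
    under eq_integral do rewrite gE EFinM.
    rewrite ge0_integralZl//; last 3 first.
    - exact: measurable_powR_comp.
    - by move=> x _; rewrite lee_fin powR_ge0.
    - by rewrite lee_fin invr_ge0.
    by rewrite -/A -(fineK Afin) -EFinM mulVf.
  have := H g mg g0 gr; rewrite -lee_fin => gu.
  have ca : (c%:E * A <= C%:E)%E.
    apply: le_trans gu.
    rewrite /A -ge0_integralZl//; last 3 first.
    - exact: measurable_powR_comp.
    - by move=> x _; rewrite lee_fin powR_ge0.
    - by rewrite lee_fin ltW.
    apply: ge0_le_integral => //.
    - by move=> x _; rewrite -EFinM lee_fin mulr_ge0 ?powR_ge0// ltW.
    - by apply: measurable_funeM; exact: measurable_powR_comp.
    - by apply: emeasurable_funM => //; exact/measurable_EFinP.
    - move=> x _.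
      rewrite (_ : (c%:E * (w n x `^ q)%:E = (g x)%:E * (w n x)%:E)%E); last first.
        by rewrite -!EFinM /g -mulrA (mulrC _ (w n x)) mulr_powRB1.
      by apply: lee_wpmul2l => //; rewrite lee_fin.
  have aq : a `^ (q^-1) <= C.
    move: ca; rewrite -(fineK Afin) -/a -EFinM lee_fin; apply: le_trans.
    rewrite /c -[X in _ * X](powRr1 a0) -powRD ?an0 ?implybT//.
    by rewrite le_eqVlt r1 opprB subrK eqxx.
  rewrite ?lee_fin -[leLHS](powRr1 a0) -(mulVf (_ : q != 0)) ?gt_eqF// powRrM.
  by apply: ge0_ler_powR => //; rewrite ?nnegrE ?(ltW q0) ?powR_ge0.
have mwq n : measurable_fun setT (fun x => ((w n x) `^ q)%:E).
  exact: measurable_powR_comp.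
have wq0 n x : setT x -> (0 <= ((w n x) `^ q)%:E)%E by rewrite lee_fin powR_ge0.
have wqnd x : setT x ->
    {homo (fun n => ((w n x) `^ q)%:E) : n k / (n <= k)%N >-> (n <= k)%E}.
  move=> _ n k nk; rewrite lee_fin ge0_ler_powR ?nnegrE ?(ltW q0)//.
  by rewrite -lee_fin wnd.
have cv := cvg_monotone_convergence measurableT mwq wq0 wqnd.
rewrite (_ : (\int[m]_x (u x `^ q))%E =
    (\int[m]_x limn (fun n => ((w n x) `^ q)%:E))%E); last first.
  by apply: eq_integral => x _; apply/esym/cvg_lim => //; exact: wcv.
rewrite -(cvg_lim _ (cv m))//; apply: lime_le; last exact: nearW.
by apply/cvg_ex; eexists; exact: cv.
Unshelve. all: by end_near. Qed.

End duality.

Section bilinear.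
Context d (T : measurableType d) (R : realType).
Variable m : {sigma_finite_measure set T -> \bar R}.
Implicit Types (f g : T -> R) (p q r s : R).

Definition lowcut s (v : R) : R := if v <= s then v else 0.

Lemma lowcut_ge0 s v : 0 <= v -> 0 <= lowcut s v.
Proof. by rewrite /lowcut; case: ifP. Qed.

Lemma measurable_lowcut d' (T' : measurableType d') (f g : T' -> R) :
  measurable_fun setT f -> measurable_fun setT g ->
  measurable_fun setT (fun x => lowcut (f x) (g x)).
Proof.
move=> mf mg; apply: measurable_fun_ifT => //.
exact: measurable_fun_ler.
Qed.

(** At each point [(x, y)], either [g x <= f y ^ (p / r)] or
    [f y <= g x ^ (r / p)], so that the kernel only ever acts on a truncation of
    one function at a height given by the other.  The relations on [e1] and [e2]
    are those for which the bounds for truncations integrate to the [p]-th power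
    of [f] and to the [r]-th power of [g].  This argument takes the place of an
    interpolation of weak-type bounds. *)
Lemma bilinear_bound (K : T -> T -> \bar R) p r C e1 e2 f g :
  measurable_fun setT (fun z => K z.1 z.2) -> (forall x y, 0 <= K x y)%E ->
  0 < p -> 0 < r -> 0 <= C ->
  1 + p / r * e1 = p -> 1 + r / p * e2 = r ->
  measurable_fun setT f -> (forall x, 0 <= f x) ->
  measurable_fun setT g -> (forall x, 0 <= g x) ->
  (\int[m]_x ((f x) `^ p)%:E <= 1)%E -> (\int[m]_x ((g x) `^ r)%:E <= 1)%E ->
  (forall y s, 0 < s -> (\int[m]_x (K x y * (lowcut s (g x))%:E) <= (C * s `^ e1)%:E)%E) ->
  (forall x s, 0 < s -> (\int[m]_y (K x y * (lowcut s (f y))%:E) <= (C * s `^ e2)%:E)%E) ->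
  (\int[m]_x ((g x)%:E * \int[m]_y (K x y * (f y)%:E)) <= (2 * C)%:E)%E.
Proof.
move=> mK K0 p0 r0 C0 E1 E2 mf f0 mg g0 fp gr H1 H2.
have mK1 x : measurable_fun setT (K x).
  exact: (measurableT_comp mK (measurable_pair1 x)).
have mf2 : measurable_fun setT (fun z : T * T => f z.2) by exact: measurableT_comp.
have mg1 : measurable_fun setT (fun z : T * T => g z.1) by exact: measurableT_comp.
have mpow (h : T * T -> R) e : measurable_fun setT h ->
    measurable_fun setT (fun z => h z `^ e).
  by move=> mh; exact: (measurableT_comp (measurable_powR e)).
pose A x y := ((f y)%:E * (K x y * (lowcut (f y `^ (p / r)) (g x))%:E))%E.
pose B x y := ((g x)%:E * (K x y * (lowcut (g x `^ (r / p)) (f y))%:E))%E.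
have mA : measurable_fun setT (fun z => A z.1 z.2).
  apply: emeasurable_funM; first exact/measurable_EFinP.
  apply: emeasurable_funM => //; apply/measurable_EFinP.
  by apply: measurable_lowcut => //; exact: mpow.
have mB : measurable_fun setT (fun z => B z.1 z.2).
  apply: emeasurable_funM; first exact/measurable_EFinP.
  apply: emeasurable_funM => //; apply/measurable_EFinP.
  by apply: measurable_lowcut => //; exact: mpow.
have A0 x y : (0 <= A x y)%E by rewrite !mule_ge0// lee_fin// lowcut_ge0.
have B0 x y : (0 <= B x y)%E by rewrite !mule_ge0// lee_fin// lowcut_ge0.
have key x y : ((g x)%:E * (K x y * (f y)%:E) <= A x y + B x y)%E.
  have [gf|fg] := leP (g x) (f y `^ (p / r)).
    apply: (@le_trans _ _ (A x y)); last by rewrite leeDl.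
    by rewrite /A /lowcut gf muleCA [X in (_ <= X)%E]muleC -muleA (muleC (g x)%:E).
  apply: (@le_trans _ _ (B x y)); last by rewrite leeDr.
  suff fg' : f y <= g x `^ (r / p) by rewrite /B /lowcut fg'.
  rewrite -[f y]powRr1// -(_ : p / r * (r / p) = 1); last first.
    by field; rewrite !gt_eqF.
  rewrite powRrM; apply: ge0_ler_powR; rewrite ?nnegrE ?powR_ge0//.
    by rewrite divr_ge0// ltW.
  exact: ltW.
have mAx x : measurable_fun setT (A x).
  exact: (measurableT_comp mA (measurable_pair1 x)).
have mBx x : measurable_fun setT (B x).
  exact: (measurableT_comp mB (measurable_pair1 x)).
have mIA := measurable_integral2 m mA A0.
have mIB := measurable_integral2 m mB B0.
have mKc1 y s : measurable_fun setT (fun x => (K x y * (lowcut s (g x))%:E)%E).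
  apply: emeasurable_funM.
    exact: (measurableT_comp mK (measurable_pair2 y)).
  by apply/measurable_EFinP; apply: measurable_lowcut.
have mKc2 x s : measurable_fun setT (fun y => (K x y * (lowcut s (f y))%:E)%E).
  apply: emeasurable_funM => //.
  by apply/measurable_EFinP; apply: measurable_lowcut.
apply: (@le_trans _ _ (\int[m]_x ((\int[m]_y A x y) + (\int[m]_y B x y)))%E).
  apply: ge0_le_integral => //.
  - move=> x _; rewrite mule_ge0 ?lee_fin// integral_ge0// => y _.
    by rewrite mule_ge0// lee_fin.
  - apply: emeasurable_funM; first exact/measurable_EFinP.
    apply: (measurable_integral2 m (f := fun x y => (K x y * (f y)%:E)%E)).
      by apply: emeasurable_funM => //; exact/measurable_EFinP.
    by move=> x y; rewrite mule_ge0// lee_fin.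
  - exact: emeasurable_funD.
  - move=> x _; rewrite -ge0_integralZl//.
    + rewrite -ge0_integralD//; apply: ge0_le_integral => //.
      * by move=> y _; rewrite !mule_ge0// lee_fin.
      * apply: measurable_funeM; apply: emeasurable_funM => //.
        exact/measurable_EFinP.
      * exact: emeasurable_funD.
    + by apply: emeasurable_funM => //; exact/measurable_EFinP.
    + by move=> y _; rewrite mule_ge0// lee_fin.
    + by rewrite lee_fin.
rewrite ge0_integralD//; last 2 first.
- by move=> x _; exact: integral_ge0.
- by move=> x _; exact: integral_ge0.
rewrite mulrDl mul1r EFinD.
have powE v a b e : 0 < a -> 0 <= v -> 1 + a / b * e = a ->
    v * (C * (v `^ (a / b)) `^ e) = C * v `^ a.
  move=> a0 v0 abe; rewrite -powRrM mulrCA; congr (_ * _).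
  have [->|v_neq0] := eqVneq v 0; first by rewrite mul0r powR0// gt_eqF.
  by rewrite -{1}(powRr1 v0) -powRD ?v_neq0 ?implybT// abe.
have mfp := measurable_powR_comp p mf.
have mgr := measurable_powR_comp r mg.
have fp0 x : setT x -> (0 <= ((f x) `^ p)%:E)%E by rewrite lee_fin powR_ge0.
have gr0 x : setT x -> (0 <= ((g x) `^ r)%:E)%E by rewrite lee_fin powR_ge0.
have CE : (0 <= C%:E)%E by rewrite lee_fin.
apply: leeD.
- rewrite (tonelli m m mA A0).
  apply: (@le_trans _ _ (\int[m]_y (C%:E * ((f y) `^ p)%:E))%E).
    apply: ge0_le_integral => //.
    + by move=> y _; exact: integral_ge0.
    + apply: (@measurable_integral2 _ _ T T R m (fun y x => A x y)); last by [].
      exact: (measurableT_comp mA (@measurable_swap _ _ T T)).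
    + by apply: measurable_funeM; exact: measurable_powR_comp.
    move=> y _; rewrite /A ge0_integralZl//; last 2 first.
    + by move=> x _; rewrite mule_ge0// lee_fin lowcut_ge0.
    + by rewrite lee_fin.
    have [fy0|fy0] := eqVneq (f y) 0.
      by rewrite fy0 mul0e mule_ge0// lee_fin powR_ge0.
    have fy_gt0 : 0 < f y by rewrite lt_neqAle eq_sym fy0 f0.
    rewrite -EFinM -(powE _ _ r e1)// EFinM; apply: lee_wpmul2l; first by rewrite lee_fin.
    by apply: H1; rewrite powR_gt0.
  rewrite (ge0_integralZl m measurableT mfp fp0 CE).
  by rewrite -[leRHS]mule1; apply: lee_wpmul2l; rewrite ?lee_fin.
- apply: (@le_trans _ _ (\int[m]_x (C%:E * ((g x) `^ r)%:E))%E).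
    apply: ge0_le_integral => //.
    + by move=> y _; exact: integral_ge0.
    + by apply: measurable_funeM; exact: measurable_powR_comp.
    move=> x _; rewrite /B ge0_integralZl//; last 2 first.
    + by move=> y _; rewrite mule_ge0// lee_fin lowcut_ge0.
    + by rewrite lee_fin.
    have [gx0|gx0] := eqVneq (g x) 0.
      by rewrite gx0 mul0e mule_ge0// lee_fin powR_ge0.
    have gx_gt0 : 0 < g x by rewrite lt_neqAle eq_sym gx0 g0.
    rewrite -EFinM -(powE _ _ p e2)// EFinM; apply: lee_wpmul2l; first by rewrite lee_fin.
    by apply: H2; rewrite powR_gt0.
  rewrite (ge0_integralZl m measurableT mgr gr0 CE).
  by rewrite -[leRHS]mule1; apply: lee_wpmul2l; rewrite ?lee_fin.
Qed.

(** With [l = B ^ (1 / p)], the inequality [v <= l + l ^ (1 - p) v ^ p] is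
    integrated: the constant [l] meets the mass of [k], and [v ^ p] its
    supremum. *)
Lemma sup_average (k : T -> \bar R) B p f : measurable_fun setT k ->
  (forall x, 0 <= k x)%E -> (\int[m]_x k x <= 1)%E -> 0 < B ->
  (forall x, k x <= B%:E)%E -> 1 <= p ->
  measurable_fun setT f -> (forall x, 0 <= f x) ->
  (\int[m]_x ((f x) `^ p)%:E <= 1)%E ->
  (\int[m]_x (k x * (f x)%:E) <= (2 * B `^ p^-1)%:E)%E.
Proof.
move=> mk k0 k1 B0 kB p1 mf f0 fp.
have p0 : 0 < p := lt_le_trans ltr01 p1.
set l := B `^ p^-1.
have l0 : 0 < l by rewrite powR_gt0.
have mfp := measurable_powR_comp p mf.
have fl v : 0 <= v -> v <= l + l `^ (1 - p) * v `^ p.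
  move=> v0; have [vl|lv] := leP v l; first by rewrite ler_wpDr// mulr_ge0// powR_ge0.
  have v_gt0 := lt_trans l0 lv.
  rewrite ler_wpDl ?(ltW l0)//.
  have this : v = v `^ (1 - p) * v `^ p.
    by rewrite -powRD ?(gt_eqF v_gt0) ?implybT// subrK powRr1.
  rewrite {1}this ler_wpM2r ?powR_ge0// -opprB !powRN lef_pV2 ?posrE ?powR_gt0//.
  by apply: ge0_ler_powR; rewrite ?nnegrE ?subr_ge0 ?(ltW l0) ?(ltW v_gt0) ?(ltW lv).
apply: (@le_trans _ _ (\int[m]_x (l%:E * k x + (l `^ (1 - p) * B)%:E * ((f x) `^ p)%:E))%E).
  apply: ge0_le_integral => //.
  - by move=> x _; rewrite mule_ge0// lee_fin.
  - by apply: emeasurable_funM => //; exact/measurable_EFinP.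
  - by apply: emeasurable_funD; [exact: measurable_funeM|exact: measurable_funeM].
  move=> x _; apply: (@le_trans _ _ (k x * (l + l `^ (1 - p) * (f x) `^ p)%:E)%E).
    by apply: lee_wpmul2l => //; rewrite lee_fin fl.
  rewrite EFinD ge0_muleDr ?lee_fin ?(ltW l0) ?mulr_ge0 ?powR_ge0//.
  rewrite (muleC (k x) l%:E) leeD2l// (EFinM (_ `^ _) B) EFinM muleA (muleC (k x)).
  by rewrite -!muleA; apply: lee_wpmul2l; rewrite ?lee_fin ?powR_ge0//;
    apply: lee_wpmul2r; rewrite ?lee_fin ?powR_ge0.
have lB0 : 0 <= l `^ (1 - p) * B by rewrite mulr_ge0 ?powR_ge0// ltW.
rewrite ge0_integralD//; last 4 first.
- by move=> x _; rewrite mule_ge0// lee_fin ltW.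
- exact: measurable_funeM.
- by move=> x _; rewrite mule_ge0 ?lee_fin// powR_ge0.
- exact: measurable_funeM.
rewrite ge0_integralZl//; last by rewrite lee_fin ltW.
rewrite ge0_integralZl//; last by move=> x _; rewrite lee_fin powR_ge0.
have -> : 2 * l = l + l `^ (1 - p) * B.
  rewrite (_ : B = l `^ p); last by rewrite -powRrM mulVf ?gt_eqF// powRr1// ltW.
  by rewrite -powRD ?(gt_eqF l0) ?implybT// subrK powRr1 ?(ltW l0)//; ring.
rewrite EFinD leeD//.
  by rewrite -[leRHS]mule1; apply: lee_wpmul2l => //; rewrite lee_fin ltW.
by rewrite -[leRHS]mule1; apply: lee_wpmul2l.
Qed.

End bilinear.

(** * Kernels without damping *)
Section riesz_kernels.
Context {R : realType}.
Implicit Types (a s t x y b c e r u : R).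
Local Notation leb := (@lebesgue_measure R).
Local Notation pos := (`]0%R, +oo[%classic : set R).
Local Notation RR := (measurableTypeR R).
Local Notation tm s := (mu_ (s / 2 - 1)).

Let mpow e : measurable_fun (setT : set RR) (fun t : RR => (t `^ e)%:E).
Proof. by apply/measurable_EFinP; exact: measurable_powR. Qed.

(** The time integral is split at [s ^ (- b^-1)], where the bounds [s] and
    [t ^ (- b)] agree. *)
Lemma integral_min_powR e b D s (F : RR -> \bar R) : 0 < e -> e < b -> 0 <= D -> 0 < s ->
  measurable_fun setT F -> (forall t, 0 <= F t)%E ->
  (forall t, 0 < t -> (F t <= s%:E)%E) ->
  (forall t, 0 < t -> (F t <= (D * t `^ (- b))%:E)%E) ->
  (\int[tm e]_t F t <= ((e^-1 + D / (b - e)) * s `^ (1 - e / b))%:E)%E.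
Proof.
move=> e0 eb D0 s0 mF F0 Fs FD.
have b0 := lt_trans e0 eb.
set c := s `^ (- b^-1).
have c0 : 0 < c by rewrite powR_gt0.
rewrite integral_tm; [|exact: mF|exact: F0].
have m2 (A : set R) : measurable_fun A (fun t : R => (F t * (t `^ (e - 1))%:E)%E).
  by apply: measurable_funTS; apply: emeasurable_funM => //; exact: mpow.
have n2 t : (0 <= F t * (t `^ (e - 1))%:E)%E by rewrite mule_ge0// lee_fin powR_ge0.
have posE : pos = `]0, c] `|` `]c, +oo[.
  by rewrite -itv_bndbnd_setU// bnd_simp// ltW.
rewrite posE ge0_integral_setU; last 5 first.
- by [].
- by [].
- exact: m2.
- by move=> t _; exact: n2.
- rewrite disj_set2E; apply/eqP; rewrite -subset0 => t [] /=.
  by rewrite !in_itv/= andbT => /andP[_ tc]; rewrite ltNge tc.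
rewrite mulrDl EFinD; apply: leeD.
- apply: (@le_trans _ _ (\int[leb]_(t in `]0%R, c]) (s%:E * (t `^ (e - 1))%:E))%E).
    apply: ge0_le_integral; [exact: measurable_itv|by move=> t _; exact: n2|exact: m2| |].
    + by apply: measurable_funeM; apply: measurable_funTS; exact: mpow.
    + move=> t /=; rewrite in_itv/= => /andP[t0 _].
      by apply: lee_wpmul2r; rewrite ?lee_fin ?powR_ge0// Fs.
  rewrite ge0_integralZl ?lee_fin ?(ltW s0)//; last 2 first.
  + by apply: measurable_funTS; exact: mpow.
  + by move=> t _; rewrite lee_fin powR_ge0.
  apply: (@le_trans _ _ (s%:E * (c `^ e / e)%:E)%E).
    by apply: lee_wpmul2l; [rewrite lee_fin ltW|exact: integral_powR_near0].
  rewrite -EFinM lee_fin le_eqVlt; apply/orP; left; apply/eqP.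
  rewrite mulrA mulrC; congr (_ * _).
  rewrite /c -powRrM -{1}(powRr1 (ltW s0)) -powRD ?(gt_eqF s0) ?implybT//.
  by congr (_ `^ _); ring.
- apply: (@le_trans _ _ (\int[leb]_(t in `]c, +oo[) (D%:E * (t `^ (e - b - 1))%:E))%E).
    apply: ge0_le_integral; [exact: measurable_itv|by move=> t _; exact: n2|exact: m2| |].
    + by apply: measurable_funeM; apply: measurable_funTS; exact: mpow.
    + move=> t /=; rewrite in_itv/= andbT => ct.
      have t0 := lt_trans c0 ct.
      rewrite (_ : e - b - 1 = - b + (e - 1)); last by ring.
      rewrite [in leRHS]powRD ?(gt_eqF t0) ?implybT//.
      rewrite [in leRHS]EFinM [leRHS]muleA -(EFinM D).
      by apply: lee_wpmul2r; rewrite ?lee_fin ?powR_ge0// FD.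
  rewrite ge0_integralZl ?lee_fin//; last 2 first.
  + by apply: measurable_funTS; exact: mpow.
  + by move=> t _; rewrite lee_fin powR_ge0.
  have eb0 : e - b < 0 by rewrite subr_lt0.
  apply: (@le_trans _ _ (D%:E * (c `^ (e - b) / - (e - b))%:E)%E).
    by apply: lee_wpmul2l; [rewrite lee_fin|exact: integral_powR_neary].
  rewrite -EFinM lee_fin le_eqVlt; apply/orP; left; apply/eqP.
  rewrite opprB -mulrA; congr (_ * _); rewrite mulrC; congr (_ * _).
  rewrite /c -powRrM; congr (_ `^ _); field.
  by rewrite gt_eqF.
Qed.

(** The analogue of the Riesz kernel of order [e]: the potential kernel without
    the damping factor [exp (- t)] and the normalization.  It is homogeneous,
    which makes it fit for the limiting case of the exponents. *)
Definition riesz_kernel a e x y : \bar R := (\int[tm e]_t heat_series a t x y)%E.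

Lemma riesz_kernel_ge0 a e x y : (0 <= riesz_kernel a e x y)%E.
Proof. by apply: integral_ge0 => t _; exact: heat_series_ge0. Qed.

Let mhs a : measurable_fun (setT : set ((RR * RR) * RR)%type)
  (fun z => heat_series a z.2 z.1.1 z.1.2).
Proof.
apply: measurable_heat_series; first exact: measurable_snd.
- by apply: measurableT_comp; [exact: measurable_fst|exact: measurable_fst].
- by apply: measurableT_comp; [exact: measurable_snd|exact: measurable_fst].
Qed.

Lemma measurable_riesz_kernel a e : measurable_fun (setT : set (RR * RR)%type)
  (fun z => riesz_kernel a e z.1 z.2).
Proof.
apply: (@measurable_integral2 _ _ (RR * RR)%type RR _ (tm e)
  (fun z t => heat_series a t z.1 z.2)); first exact: mhs.
by move=> z t; exact: heat_series_ge0.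
Qed.

(** Thanks to the damping the order can be lowered: [t ^ (s - e) exp (- t)] is
    bounded. *)
Lemma pkernel_le_riesz a s e x y : 0 < e -> e <= s ->
  (pkernel a s x y <= ((Gamma s)^-1 * (if s == e then 1 else (s - e) `^ (s - e)))%:E
     * riesz_kernel a e x y)%E.
Proof.
move=> e0 es; rewrite EFinM -muleA; apply: lee_wpmul2l; first exact: invGamma_ge0.
set M := (if _ then _ else _).
have M0 : 0 <= M by rewrite /M; case: ifP => // _; rewrite powR_ge0.
have mh : measurable_fun (setT : set RR) (fun t : RR => heat_series a t x y).
  by apply: measurable_heat_series.
have mE : measurable_fun (setT : set RR) (fun t : RR => (expR (- t))%:E).
  by apply/measurable_EFinP; apply: measurableT_comp; [exact: measurable_expR|exact: measurable_funN].
have h0 t := heat_series_ge0 a t x y.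
have eh0 t : (0 <= (expR (- t))%:E * heat_series a t x y)%E.
  by rewrite mule_ge0// lee_fin expR_ge0.
rewrite /riesz_kernel integral_tm; [|exact: emeasurable_funM|exact: eh0].
rewrite integral_tm; [|exact: mh|exact: h0].
have mhp : measurable_fun (pos : set RR) (fun t : RR => (heat_series a t x y * (t `^ (e - 1))%:E)%E).
  by apply: measurable_funTS; apply: emeasurable_funM => //; exact: mpow.
have hp0 (t : RR) : pos t -> (0 <= heat_series a t x y * (t `^ (e - 1))%:E)%E.
  by move=> _; rewrite mule_ge0// lee_fin powR_ge0.
have ME : (0 <= M%:E)%E by rewrite lee_fin.
rewrite -(ge0_integralZl leb (measurable_itv _) mhp hp0 ME).
apply: ge0_le_integral; first exact: measurable_itv.
- by move=> t _; rewrite mule_ge0// lee_fin powR_ge0.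
- by apply: measurable_funTS; apply: emeasurable_funM; [exact: emeasurable_funM|exact: mpow].
- exact: measurable_funeM.
move=> t /=; rewrite in_itv/= andbT => t0.
rewrite muleAC [leRHS]muleCA [leLHS]muleC; apply: lee_wpmul2l => //.
rewrite -!EFinM lee_fin (_ : s - 1 = (s - e) + (e - 1)); last by ring.
rewrite powRD ?(gt_eqF t0) ?implybT// mulrA.
apply: ler_wpM2r; first exact: powR_ge0.
rewrite /M; case: eqVneq => [->|nse].
  by rewrite subrr powRr0 mulr1 expR_le1 oppr_le0 ltW.
by rewrite mulrC; apply: powR_expRN_le; rewrite ?(ltW t0)// subr_gt0 lt_neqAle eq_sym nse.
Qed.

End riesz_kernels.

(** * Potentials of nonnegative functions *)
Section potentials.
Context {R : realType}.
Implicit Types (a s t x y b c e r u : R).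
Local Notation RR := (measurableTypeR R).

(** On the half-line and for [f >= 0] this is [potential a s f]. *)
Definition pot a s (f : RR -> R) x : \bar R :=
  (\int[mu_ a]_y (pkernel a s x y * (f y)%:E))%E.

Lemma pot_ge0 a s (f : RR -> R) x : (forall y, 0 <= f y) -> (0 <= pot a s f x)%E.
Proof. by move=> f0; apply: integral_ge0 => y _; rewrite mule_ge0 ?pkernel_ge0// lee_fin. Qed.

Lemma measurable_pkernel1 a s x : measurable_fun (setT : set RR) (pkernel a s x).
Proof. exact: (measurableT_comp (measurable_pkernel a s) (@pair1_measurable _ _ RR RR x)). Qed.

Lemma measurable_pkernel_mul a s (f : RR -> R) : measurable_fun setT f ->
  measurable_fun (setT : set (RR * RR)%type) (fun z => (pkernel a s z.1 z.2 * (f z.2)%:E)%E).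
Proof.
move=> mf; apply: emeasurable_funM; first exact: measurable_pkernel.
apply/measurable_EFinP; apply: measurableT_comp => //; exact: measurable_snd.
Qed.

Lemma measurable_pot a s (f : RR -> R) : measurable_fun setT f -> (forall y, 0 <= f y) ->
  measurable_fun (setT : set RR) (pot a s f).
Proof.
move=> mf f0.
apply: (@measurable_integral2 _ _ RR RR _ (mu_ a) (fun x y => (pkernel a s x y * (f y)%:E)%E)).
  exact: measurable_pkernel_mul.
by move=> x y; rewrite mule_ge0 ?pkernel_ge0// lee_fin.
Qed.

(** Symmetry of the kernel makes the potential self-adjoint. *)
Lemma pot_adjoint a s (f g : RR -> R) :
  measurable_fun setT f -> (forall y, 0 <= f y) ->
  measurable_fun setT g -> (forall y, 0 <= g y) ->
  (\int[mu_ a]_x ((g x)%:E * pot a s f x) = \int[mu_ a]_y ((f y)%:E * pot a s g y))%E.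
Proof.
move=> mf f0 mg g0.
pose A x y := ((g x)%:E * (pkernel a s x y * (f y)%:E))%E.
have A0 x y : (0 <= A x y)%E.
  apply: mule_ge0; first by rewrite lee_fin.
  by apply: mule_ge0; [exact: pkernel_ge0|rewrite lee_fin].
have mA : measurable_fun (setT : set (RR * RR)%type) (fun z => A z.1 z.2).
  apply: emeasurable_funM; last exact: measurable_pkernel_mul.
  by apply/measurable_EFinP; apply: measurableT_comp => //; exact: measurable_fst.
transitivity (\int[mu_ a]_x \int[mu_ a]_y A x y)%E.
  apply: eq_integral => x _; rewrite /A /pot.
  have m1 : measurable_fun (setT : set RR) (fun y => (pkernel a s x y * (f y)%:E)%E).
    by apply: emeasurable_funM; [exact: measurable_pkernel1|exact/measurable_EFinP].
  have n1 (y : RR) : setT y -> (0 <= pkernel a s x y * (f y)%:E)%E.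
    by move=> _; rewrite mule_ge0 ?pkernel_ge0// lee_fin.
  by rewrite (ge0_integralZl (mu_ a) measurableT m1 n1)// lee_fin.
rewrite (@tonelli _ _ RR RR R (mu_ a) (mu_ a) A mA A0).
apply: eq_integral => y _; rewrite /pot.
have m1 : measurable_fun (setT : set RR) (fun x => (pkernel a s y x * (g x)%:E)%E).
  by apply: emeasurable_funM; [exact: measurable_pkernel1|exact/measurable_EFinP].
have n1 (x : RR) : setT x -> (0 <= pkernel a s y x * (g x)%:E)%E.
  by move=> _; rewrite mule_ge0 ?pkernel_ge0// lee_fin.
have f0' : (0 <= (f y)%:E)%E by rewrite lee_fin.
rewrite -(ge0_integralZl (mu_ a) measurableT m1 n1 f0').
by apply: eq_integral => x _; rewrite /A (pkernelC a s x y) [LHS]muleA [LHS]muleC (muleC (g x)%:E).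
Qed.

(** Boundedness tested on nonnegative functions of norm at most one only;
    [strong_bound_potential] passes from there to all functions. *)
Definition strong_bound a s (p q : \bar R) : Prop :=
  exists2 C : R, 0 <= C & forall f : RR -> R, measurable_fun setT f ->
    (forall y, 0 <= f y) -> ('N[mu_ a]_p[EFin \o f] <= 1)%E ->
    ('N[mu_ a]_q[pot a s f] <= C%:E)%E.

Lemma Lnorm_le1 a p (f : RR -> R) : 0 < p -> (forall y, 0 <= f y) ->
  ('N[mu_ a]_p%:E[EFin \o f] <= 1)%E -> (\int[mu_ a]_x ((f x) `^ p)%:E <= 1)%E.
Proof.
move=> p0 f0 fp.
have := poweR_Lnorm (mu_ a) (EFin \o f) (lt0r_neq0 p0).
under eq_integral do rewrite /= ger0_norm//.
move=> <-; rewrite -(poweR1r p).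
by apply: gt0_ler_poweR; rewrite ?(ltW p0)// in_itv/= ?lee01 ?leey ?Lnorm_ge0.
Qed.

Lemma Lnorm_le_real a q C (u : RR -> \bar R) : 0 < q -> 0 <= C ->
  (forall x, 0 <= u x)%E -> (\int[mu_ a]_x (u x `^ q) <= (C `^ q)%:E)%E ->
  ('N[mu_ a]_q%:E[u] <= C%:E)%E.
Proof.
move=> q0 C0 u0 uC.
rewrite unlock; under eq_integral do rewrite gee0_abs//.
apply: (@le_trans _ _ ((C `^ q)%:E `^ q^-1)%E).
  apply: gt0_ler_poweR; rewrite ?invr_ge0 ?(ltW q0)// in_itv/= ?leey ?andbT ?lee_fin ?powR_ge0//.
  by apply: integral_ge0 => x _; exact: poweR_ge0.
by rewrite poweR_EFin -powRrM mulfV ?gt_eqF// powRr1.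
Qed.

Lemma ae_pos a (P : RR -> Prop) : (forall x, 0 < x -> P x) -> {ae mu_ a, forall x, P x}.
Proof.
move=> H; exists `]-oo, 0]%classic; split => //; first exact: mu_le0.
by move=> x /= nP; rewrite in_itv/= leNgt; apply/negP => /H.
Qed.

Lemma Lnormy_le a C (u : RR -> \bar R) : 0 <= C ->
  (forall x, 0 <= u x)%E -> (forall x, 0 < x -> (u x <= C%:E)%E) ->
  ('N[mu_ a]_+oo%E[u] <= C%:E)%E.
Proof.
move=> C0 u0 uC; rewrite unlock; case: ifPn => _; last by rewrite lee_fin.
by apply/ess_supP; apply: ae_pos => x x0 /=; rewrite gee0_abs// uC.
Qed.

Lemma mu_itv a b c : -1 < a -> 0 < b -> b < c -> mu_ a `[b, c]%classic =
  ((c `^ (2 * (a + 1)) - b `^ (2 * (a + 1))) / (2 * (a + 1)))%:E.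
Proof.
move=> a1 b0 bc; rewrite /= /mu_ setIidl; last first.
  by move=> x /=; rewrite !in_itv/= andbT => /andP[+ _]; exact: lt_le_trans.
rewrite -integral_powR_itv//; last by rewrite gt_eqF//; lra.
by apply: eq_integral => x _; congr (_ `^ _)%:E; ring.
Qed.

Lemma mu_setT_gt0 a : -1 < a -> (0 < mu_ a setT)%E.
Proof.
move=> a1; apply: (@lt_le_trans _ _ (mu_ a `[1%R, 2%R]%classic)).
  rewrite mu_itv ?ltr1n// lte_fin divr_gt0 ?mulr_gt0//; last by lra.
  by rewrite subr_gt0; apply: gt0_ltr_powR; rewrite ?nnegrE ?ltr1n//; lra.
by apply: le_measure; rewrite ?inE.
Qed.

End potentials.

(** * Estimates for the heat semigroup *)
Section heat_estimates.
Context {R : realType}.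
Implicit Types (a s t x y b c e r u : R).
Local Notation leb := (@lebesgue_measure R).
Local Notation pos := (`]0%R, +oo[%classic : set R).
Local Notation RR := (measurableTypeR R).
Local Notation tm s := (mu_ (s / 2 - 1)).

Lemma measurable_heat_mul a t x (f : RR -> R) : measurable_fun setT f ->
  measurable_fun (setT : set RR) (fun y => (heat_series a t x y * (f y)%:E)%E).
Proof.
move=> mf; apply: emeasurable_funM; last exact/measurable_EFinP.
by apply: measurable_heat_series.
Qed.

Lemma measurable_heat_mul2 a x (f : RR -> R) : measurable_fun setT f ->
  measurable_fun (setT : set (RR * RR)%type)
    (fun z => (heat_series a z.1 x z.2 * (f z.2)%:E)%E).
Proof.
move=> mf; apply: emeasurable_funM; last first.
  by apply/measurable_EFinP; apply: measurableT_comp => //; exact: measurable_snd.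
by apply: measurable_heat_series.
Qed.

Lemma heat_mul_ge0 a t x y (f : RR -> R) : (forall y, 0 <= f y) ->
  (0 <= heat_series a t x y * (f y)%:E)%E.
Proof. by move=> f0; apply: mule_ge0; [exact: heat_series_ge0|rewrite lee_fin]. Qed.

(** The constant of [heat_series_le]. *)
Definition heat_sup a : R := 2 * 4 `^ (- (a + 1)) / Gamma (a + 1).

Lemma heat_sup_gt0 a : -1 < a -> 0 < heat_sup a.
Proof.
move=> a1; rewrite divr_gt0 ?mulr_gt0 ?powR_gt0//.
by apply: Gamma_gt0; lra.
Qed.

(** By [sup_average], with the mass and the sup bound of the heat kernel: the
    heat operator at time [t] maps [L^p] to [L^oo] with norm
    [O (t ^ (- (a + 1) / p))]. *)
Lemma heat_avg a t x p (f : RR -> R) : - (1 / 2) <= a -> 0 < t -> 1 <= p ->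
  measurable_fun setT f -> (forall y, 0 <= f y) ->
  (\int[mu_ a]_y ((f y) `^ p)%:E <= 1)%E ->
  (\int[mu_ a]_y (heat_series a t x y * (f y)%:E) <=
    (2 * heat_sup a `^ p^-1 * t `^ (- ((a + 1) / p)))%:E)%E.
Proof.
move=> a2 t0 p1 mf f0 fp.
have a1 : -1 < a by lra.
have B0 : 0 < heat_sup a * t `^ (- (a + 1)).
  by rewrite mulr_gt0 ?heat_sup_gt0// powR_gt0.
have mh : measurable_fun (setT : set RR) (heat_series a t x).
  by apply: measurable_heat_series.
have := @sup_average _ RR R (mu_ a) (heat_series a t x) _ p f mh
  (fun y => heat_series_ge0 a t x y) _ B0
  (fun y => heat_series_le x y a2 t0) p1 mf f0 fp.
rewrite heat_series_total// => /(_ (lexx _)) /le_trans; apply.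
rewrite powRM ?powR_ge0 ?(ltW (heat_sup_gt0 _))// -powRrM mulNr mulrA.
by rewrite lexx.
Qed.

(** The decay of the heat operator is integrated in time; the integral converges
    at zero because [(a + 1) / p < s]. *)
Lemma pot_le_sup a s p (f : RR -> R) x : - (1 / 2) <= a -> 0 < s -> 1 <= p ->
  (a + 1) / p < s ->
  measurable_fun setT f -> (forall y, 0 <= f y) ->
  (\int[mu_ a]_y ((f y) `^ p)%:E <= 1)%E ->
  (pot a s f x <= (2 * heat_sup a `^ p^-1 * (Gamma (s - (a + 1) / p) / Gamma s))%:E)%E.
Proof.
move=> a2 s0 p1 hps mf f0 fp.
set b := (a + 1) / p in hps *; set D := 2 * _.
have D0 : 0 <= D by rewrite mulr_ge0 ?powR_ge0.
have mfE : measurable_fun (setT : set RR) (fun y : RR => (f y)%:E) by exact/measurable_EFinP.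
have fE0 (y : RR) : (0 <= (f y)%:E)%E by rewrite lee_fin.
rewrite /pot (@integral_pkernel R a s (fun y => (f y)%:E) x mfE fE0).
have -> : D * (Gamma (s - b) / Gamma s) = (Gamma s)^-1 * (D * Gamma (s - b)) by ring.
rewrite EFinM; apply: lee_wpmul2l; first exact: invGamma_ge0.
have I0 (t : RR) : (0 <= \int[mu_ a]_y (heat_series a t x y * (f y)%:E))%E.
  by apply: integral_ge0 => y _; exact: heat_mul_ge0.
pose u (t : RR) : \bar R := (D%:E * (expR (- t) * t `^ (- b))%:E)%E.
have u0 (t : RR) : (0 <= u t)%E.
  by apply: mule_ge0; rewrite lee_fin// mulr_ge0 ?expR_ge0// powR_ge0.
have mk : measurable_fun (setT : set RR) (fun t : RR => (expR (- t) * t `^ (- b))%:E).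
  apply/measurable_EFinP; apply: measurable_funM; last exact: measurable_powR.
  by apply: measurableT_comp; [exact: measurable_expR|exact: measurable_funN].
have mu : measurable_fun (setT : set RR) u by exact: measurable_funeM.
apply: (@le_trans _ _ (\int[tm s]_t u t)%E).
  apply: le_integral_pos => [t|//|t t0].
    by apply: mule_ge0 => //; rewrite lee_fin expR_ge0.
  rewrite /u [X in (_ <= _ * X)%E]EFinM [leRHS]muleCA; apply: lee_wpmul2l; first by rewrite lee_fin expR_ge0.
  by rewrite -EFinM; exact: heat_avg.
rewrite integral_tm; [|exact: mu|exact: u0].
rewrite EFinM -integral_Gamma ?subr_gt0//.
have mg : measurable_fun (pos : set RR)
    (fun t : RR => (t `^ (s - b - 1) * expR (- t))%:E).
  apply/measurable_EFinP; apply: measurable_funTS; apply: measurable_funM.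
    exact: measurable_powR.
  by apply: measurableT_comp; [exact: measurable_expR|exact: measurable_funN].
have g0 (t : RR) : pos t -> (0 <= (t `^ (s - b - 1) * expR (- t))%:E)%E.
  by move=> _; rewrite lee_fin mulr_ge0 ?powR_ge0// expR_ge0.
have DE : (0 <= D%:E)%E by rewrite lee_fin.
rewrite -(ge0_integralZl leb (measurable_itv _) mg g0 DE).
rewrite le_eqVlt; apply/orP; left; apply/eqP; apply: eq_integral => t.
rewrite inE/= in_itv/= andbT => t0; rewrite /u -muleA; apply: (congr1 (fun X => D%:E * X)%E); rewrite -EFinM; congr EFin.
rewrite (_ : s - b - 1 = - b + (s - 1)); last by ring.
by rewrite [in RHS]powRD ?(gt_eqF t0) ?implybT//; ring.
Qed.

(** A truncation at height [c] has heat averages at most [c], by the total mass,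
    as well as the decay of [heat_avg]; [integral_min_powR] combines the two. *)
Lemma riesz_truncated a e r (g : RR -> R) y c : - (1 / 2) <= a -> 0 < e -> 1 <= r ->
  e < (a + 1) / r -> measurable_fun setT g -> (forall x, 0 <= g x) ->
  (\int[mu_ a]_x ((g x) `^ r)%:E <= 1)%E -> 0 < c ->
  (\int[mu_ a]_x (riesz_kernel a e y x * (lowcut c (g x))%:E) <=
   ((e^-1 + 2 * heat_sup a `^ r^-1 / ((a + 1) / r - e)) * c `^ (1 - e / ((a + 1) / r)))%:E)%E.
Proof.
move=> a2 e0 r1 er mg g0 gr c0.
have a1 : -1 < a by lra.
pose k x := lowcut c (g x).
have k0 x : 0 <= k x by exact: lowcut_ge0.
have kc x : k x <= c by rewrite /k /lowcut; case: ifP => // _; exact: ltW.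
have kg x : k x <= g x by rewrite /k /lowcut; case: ifP.
have mk : measurable_fun (setT : set RR) k by exact: measurable_lowcut.
pose F t := (\int[mu_ a]_x (heat_series a t y x * (k x)%:E))%E.
have A0 (t x : RR) := heat_mul_ge0 a t y x k0.
have mA := measurable_heat_mul2 a y mk.
have -> : (\int[mu_ a]_x (riesz_kernel a e y x * (lowcut c (g x))%:E) = \int[tm e]_t F t)%E.
  rewrite /F (@tonelli _ _ RR RR R (tm e) (mu_ a)
    (fun t x => heat_series a t y x * (k x)%:E)%E mA A0).
  apply: eq_integral => x _; rewrite /riesz_kernel.
  have mh : measurable_fun (setT : set RR) (fun t => heat_series a t y x).
    by apply: measurable_heat_series.
  have h0 (t : RR) : setT t -> (0 <= heat_series a t y x)%E.
    by move=> _; exact: heat_series_ge0.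
  have kE : (0 <= (k x)%:E)%E by rewrite lee_fin.
  by rewrite (ge0_integralZr (tm e) measurableT mh h0 kE).
have D0 : 0 <= 2 * heat_sup a `^ r^-1 by rewrite mulr_ge0 ?powR_ge0.
apply: integral_min_powR => //.
- exact: (measurable_integral2 (mu_ a) mA A0).
- by move=> t; apply: integral_ge0 => x _; exact: A0.
- move=> t t0; rewrite -[leRHS]mule1 -(heat_series_total y a1 t0).
  have mh : measurable_fun (setT : set RR) (heat_series a t y).
    by apply: measurable_heat_series.
  have h0 (x : RR) : setT x -> (0 <= heat_series a t y x)%E.
    by move=> _; exact: heat_series_ge0.
  have cE : (0 <= c%:E)%E by rewrite lee_fin ltW.
  rewrite -(ge0_integralZl (mu_ a) measurableT mh h0 cE).
  apply: ge0_le_integral => //.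
  + exact: measurable_heat_mul.
  + exact: measurable_funeM.
  + move=> x _; rewrite muleC; apply: lee_wpmul2r; first exact: heat_series_ge0.
    by rewrite lee_fin.
- move=> t t0; apply: heat_avg; [exact: a2|exact: t0|exact: r1|exact: mk|exact: k0|].
  apply: le_trans gr; apply: ge0_le_integral => //.
  + by move=> x _; rewrite lee_fin powR_ge0.
  + exact: measurable_powR_comp.
  + exact: measurable_powR_comp.
  + move=> x _; rewrite lee_fin; apply: ge0_ler_powR; rewrite ?nnegrE ?(le_trans ler01 r1)//.
Qed.

End heat_estimates.

(** * Sufficiency *)
Section sufficiency.
Context {R : realType}.
Implicit Types (a s t x y b c e r u p q : R).
Local Notation RR := (measurableTypeR R).

Lemma ae_mono a (P Q : RR -> Prop) : (forall x, P x -> Q x) ->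
  {ae mu_ a, forall x, P x} -> {ae mu_ a, forall x, Q x}.
Proof.
by move=> PQ [N [mN N0 sN]]; exists N; split => // x /= nQ; apply: sN => /= /PQ.
Qed.

Lemma ae_all a (P : RR -> Prop) : (forall x, P x) -> {ae mu_ a, forall x, P x}.
Proof. by move=> HP; apply: ae_pos => x _. Qed.

Lemma pot_le_total a s (k : RR -> R) c x : -1 < a -> 0 < s -> 0 <= c ->
  measurable_fun setT k -> (forall y, 0 <= k y) -> {ae mu_ a, forall y, k y <= c} ->
  (pot a s k x <= c%:E)%E.
Proof.
move=> a1 s0 c0 mk k0 kc.
have mp := @measurable_pkernel1 R a s x.
have p0 (y : RR) : setT y -> (0 <= pkernel a s x y)%E by move=> _; exact: pkernel_ge0.
have cE : (0 <= c%:E)%E by rewrite lee_fin.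
rewrite -[leRHS]mule1 -(pkernel_total x a1 s0).
rewrite -(ge0_integralZl (mu_ a) measurableT mp p0 cE).
apply: ae_ge0_le_integral => //.
- by move=> y _; rewrite mule_ge0 ?pkernel_ge0// lee_fin.
- by apply: emeasurable_funM => //; exact/measurable_EFinP.
- by move=> y _; rewrite mule_ge0 ?pkernel_ge0.
- exact: measurable_funeM.
- apply: ae_mono kc => y ky _; rewrite muleC; apply: lee_wpmul2r; first exact: pkernel_ge0.
  by rewrite lee_fin.
Qed.

Lemma LnormyE a (f : RR -> \bar R) : -1 < a ->
  ('N[mu_ a]_+oo[f] = ess_sup (mu_ a) (abse \o f))%E.
Proof. by move=> a1; rewrite unlock mu_setT_gt0. Qed.

Lemma strong_bound_yy a s : -1 < a -> 0 < s -> strong_bound a s +oo +oo.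
Proof.
move=> a1 s0; exists 1 => // f mf f0; rewrite [X in (X <= _)%E -> _](LnormyE _ a1).
move=> /ess_supP f1; apply: Lnormy_le => // x; first exact: pot_ge0.
move=> x0; apply: pot_le_total => //.
by apply: ae_mono f1 => y /=; rewrite ger0_norm// lee_fin.
Qed.

Lemma strong_bound_py a s p : - (1 / 2) <= a -> 0 < s -> 1 <= p -> (a + 1) / p < s ->
  strong_bound a s p%:E +oo.
Proof.
move=> a2 s0 p1 ps; have p0 := lt_le_trans ltr01 p1.
exists (2 * heat_sup a `^ p^-1 * (Gamma (s - (a + 1) / p) / Gamma s)).
  by rewrite mulr_ge0 ?divr_ge0 ?Gamma_ge0// mulr_ge0 ?powR_ge0.
move=> f mf f0 /(Lnorm_le1 p0 f0) fp; apply: Lnormy_le.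
- by rewrite mulr_ge0 ?divr_ge0 ?Gamma_ge0// mulr_ge0 ?powR_ge0.
- by move=> x; exact: pot_ge0.
- by move=> x _; exact: pot_le_sup.
Qed.

Lemma pot_adjoint_le a s c (f g : RR -> R) : 0 <= c ->
  measurable_fun setT f -> (forall y, 0 <= f y) ->
  measurable_fun setT g -> (forall y, 0 <= g y) ->
  (\int[mu_ a]_y (f y)%:E <= 1)%E ->
  (forall y, (pot a s g y <= c%:E)%E) ->
  (\int[mu_ a]_x ((g x)%:E * pot a s f x) <= c%:E)%E.
Proof.
move=> c0 mf f0 mg g0 f1 gc; rewrite pot_adjoint//.
have mfE : measurable_fun (setT : set RR) (fun y : RR => (f y)%:E) by exact/measurable_EFinP.
have fE0 (y : RR) : setT y -> (0 <= (f y)%:E)%E by rewrite lee_fin.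
have cE : (0 <= c%:E)%E by rewrite lee_fin.
apply: (@le_trans _ _ (\int[mu_ a]_y (c%:E * (f y)%:E))%E).
  apply: ge0_le_integral => //.
  - by move=> y _; rewrite mule_ge0 ?pot_ge0// lee_fin.
  - by apply: emeasurable_funM => //; exact: measurable_pot.
  - exact: measurable_funeM.
  - by move=> y _; rewrite muleC; apply: lee_wpmul2r; rewrite ?lee_fin.
rewrite (ge0_integralZl (mu_ a) measurableT mfE fE0 cE).
by rewrite -[leRHS]mule1; exact: lee_wpmul2l.
Qed.

Lemma Lnorm1_le1 a (f : RR -> R) : (forall y, 0 <= f y) ->
  ('N[mu_ a]_1[EFin \o f] <= 1)%E -> (\int[mu_ a]_x (f x)%:E <= 1)%E.
Proof.
by move=> f0; rewrite Lnorm1; under eq_integral do rewrite /= ger0_norm//.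
Qed.

Lemma strong_bound_11 a s : -1 < a -> 0 < s -> strong_bound a s 1 1.
Proof.
move=> a1 s0; exists 1 => // f mf f0 /(Lnorm1_le1 f0) f1.
rewrite Lnorm1; under eq_integral do rewrite gee0_abs ?pot_ge0//.
under eq_integral do rewrite -[pot _ _ _ _]mul1e.
apply: (@pot_adjoint_le a s 1 f (cst 1)) => // y.
by apply: pot_le_total => //; exact: ae_all.
Qed.

(** Dual to [strong_bound_py]. *)
Lemma strong_bound_1q a s q r : - (1 / 2) <= a -> 0 < s -> 1 < q ->
  q^-1 + r^-1 = 1 -> (a + 1) / r < s -> strong_bound a s 1 q%:E.
Proof.
move=> a2 s0 q1 qr rs; have q0 := lt_trans ltr01 q1.
have r1 : 1 <= r.
  rewrite -[leRHS]invrK -[leLHS]invr1 lef_pV2 ?posrE// ?invr_gt0; last first.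
    by rewrite -invr_gt0; move: (invf_lt1 q0); rewrite q1; lra.
  by rewrite -qr lerDr invr_ge0 ltW.
set c := 2 * heat_sup a `^ r^-1 * (Gamma (s - (a + 1) / r) / Gamma s).
have c0 : 0 <= c.
  by rewrite /c mulr_ge0 ?divr_ge0 ?Gamma_ge0// mulr_ge0 ?powR_ge0.
exists c => // f mf f0 /(Lnorm1_le1 f0) f1.
apply: Lnorm_le_real => //; first by move=> x; exact: pot_ge0.
apply: (dual_Lp_bound q1 qr c0).
- exact: measurable_pot.
- by move=> x; exact: pot_ge0.
- move=> g mg g0 gr; apply: pot_adjoint_le => // y; exact: pot_le_sup.
Qed.

Lemma strong_bound_bilinear a s p q r e1 e2 C : -1 < a -> 0 < s -> 1 < p -> 1 < q ->
  q^-1 + r^-1 = 1 -> 0 <= C -> 1 + p / r * e1 = p -> 1 + r / p * e2 = r ->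
  (forall (g : RR -> R) y c, measurable_fun setT g -> (forall x, 0 <= g x) -> 0 < c ->
    (\int[mu_ a]_x ((g x) `^ r)%:E <= 1)%E ->
    (\int[mu_ a]_x (pkernel a s y x * (lowcut c (g x))%:E) <= (C * c `^ e1)%:E)%E) ->
  (forall (g : RR -> R) y c, measurable_fun setT g -> (forall x, 0 <= g x) -> 0 < c ->
    (\int[mu_ a]_x ((g x) `^ p)%:E <= 1)%E ->
    (\int[mu_ a]_x (pkernel a s y x * (lowcut c (g x))%:E) <= (C * c `^ e2)%:E)%E) ->
  strong_bound a s p%:E q%:E.
Proof.
move=> a1 s0 p1 q1 qr C0 E1 E2 H1 H2; have q0 := lt_trans ltr01 q1.
have p0 := lt_trans ltr01 p1.
have r0 : 0 < r.
  by rewrite -invr_gt0; move: (invf_lt1 q0); rewrite q1; lra.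
have C20 : 0 <= 2 * C by rewrite mulr_ge0.
exists (2 * C) => // f mf f0 /(Lnorm_le1 p0 f0) fp.
apply: Lnorm_le_real => //; first by move=> x; exact: pot_ge0.
apply: (dual_Lp_bound q1 qr C20).
- exact: measurable_pot.
- by move=> x; exact: pot_ge0.
move=> g mg g0 gr.
apply: (@bilinear_bound _ RR R (mu_ a) (pkernel a s) p r C e1 e2 f g _ _ p0 r0 C0 E1 E2 mf f0 mg g0 fp gr).
- exact: measurable_pkernel.
- by move=> x y; exact: pkernel_ge0.
- move=> y c c0; under eq_integral do rewrite pkernelC.
  exact: H1.
- by move=> x c c0; exact: H2.
Qed.

Lemma lowcut_le c v : 0 < c -> lowcut c v <= c.
Proof. by move=> c0; rewrite /lowcut; case: ifP => // _; exact: ltW. Qed.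

(** The bilinear estimate with the trivial bounds for truncations: the kernel has
    total mass one in each variable. *)
Lemma strong_bound_pp a s p : -1 < a -> 0 < s -> 1 < p -> strong_bound a s p%:E p%:E.
Proof.
move=> a1 s0 p1; have p0 := lt_trans ltr01 p1.
pose r := p / (p - 1).
have p10 : p - 1 != 0 by rewrite subr_eq0 gt_eqF.
have pn0 : p != 0 by rewrite gt_eqF.
have qr : p^-1 + r^-1 = 1 by rewrite /r; field; rewrite ?pn0 ?p10.
have triv (g : RR -> R) y c : measurable_fun setT g -> (forall x, 0 <= g x) -> 0 < c ->
    (\int[mu_ a]_x (pkernel a s y x * (lowcut c (g x))%:E) <= (1 * c `^ 1)%:E)%E.
  move=> mg g0 c0; rewrite mul1r powRr1 ?(ltW c0)//.
  apply: (@pot_le_total a s (fun x => lowcut c (g x))) => //; first exact: ltW.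
  - exact: measurable_lowcut.
  - by move=> x; exact: lowcut_ge0.
  - by apply: ae_all => x; exact: lowcut_le.
apply: (@strong_bound_bilinear a s p p r 1 1 1) => //.
- by rewrite /r; field; rewrite ?pn0 ?p10.
- by rewrite /r; field; rewrite ?pn0 ?p10.
- by move=> g y c mg g0 c0 _; exact: triv.
- by move=> g y c mg g0 c0 _; exact: triv.
Qed.

(** The order is first lowered to [e = (1 / p - 1 / q) (a + 1)]; the powers of
    the height in [riesz_truncated] are then exactly the ones that
    [strong_bound_bilinear] requires. *)
Lemma strong_bound_pq a s p q : - (1 / 2) <= a -> 0 < s -> 1 < p -> p < q ->
  p^-1 - q^-1 <= s / (a + 1) -> strong_bound a s p%:E q%:E.
Proof.
move=> a2 s0 p1 pq pqs; have p0 := lt_trans ltr01 p1.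
have a1 : -1 < a by lra.
have h0 : 0 < a + 1 by lra.
have q1 := lt_trans p1 pq; have q0 := lt_trans p0 pq.
pose r := q / (q - 1).
have q10 : q - 1 != 0 by rewrite subr_eq0 gt_eqF.
have q1_gt0 : 0 < q - 1 by rewrite subr_gt0.
have pn0 : p != 0 by rewrite gt_eqF.
have qn0 : q != 0 by rewrite gt_eqF.
have hn0 : a + 1 != 0 by rewrite gt_eqF.
have qr : q^-1 + r^-1 = 1 by rewrite /r; field; rewrite ?qn0 ?q10.
have r0 : 0 < r by rewrite divr_gt0.
have r1 : 1 <= r by rewrite ler_pdivlMr// mul1r gerBl.
set th := p^-1 - q^-1.
have th0 : 0 < th by rewrite subr_gt0 ltf_pV2.
set e := th * (a + 1).
have e0 : 0 < e by rewrite mulr_gt0.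
have es : e <= s by rewrite /e -ler_pdivlMr.
have rV : r^-1 = 1 - q^-1 by rewrite -qr addrC addKr.
have pV1 : p^-1 < 1 by rewrite invf_lt1.
have er : e < (a + 1) / r.
  by rewrite /e mulrC ltr_pM2l// rV /th; lra.
have ep : e < (a + 1) / p.
  by rewrite /e mulrC ltr_pM2l// /th gtrBl invr_gt0.
set M := (Gamma s)^-1 * (if s == e then 1 else (s - e) `^ (s - e)).
have M0 : 0 <= M.
  by rewrite /M mulr_ge0 ?invr_ge0 ?Gamma_ge0//; case: ifP => // _; exact: powR_ge0.
pose D k := e^-1 + 2 * heat_sup a `^ k^-1 / ((a + 1) / k - e).
have D0 k : e < (a + 1) / k -> 0 <= D k.
  move=> ek; rewrite addr_ge0 ?invr_ge0 ?(ltW e0)// divr_ge0 ?mulr_ge0 ?powR_ge0//.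
  by rewrite subr_ge0 ltW.
have main k (g : RR -> R) y c : 1 <= k -> e < (a + 1) / k ->
    measurable_fun setT g -> (forall x, 0 <= g x) -> 0 < c ->
    (\int[mu_ a]_x ((g x) `^ k)%:E <= 1)%E ->
    (\int[mu_ a]_x (pkernel a s y x * (lowcut c (g x))%:E) <=
      (M * D k * c `^ (1 - th * k))%:E)%E.
  move=> k1 ek mg g0 c0 gk.
  have k0 := lt_le_trans ltr01 k1.
  have mc : measurable_fun (setT : set RR) (fun x => (lowcut c (g x))%:E).
    by apply/measurable_EFinP; exact: measurable_lowcut.
  have mr : measurable_fun (setT : set RR) (fun x => (riesz_kernel a e y x * (lowcut c (g x))%:E)%E).
    apply: emeasurable_funM => //.
    exact: (measurableT_comp (measurable_riesz_kernel a e) (@pair1_measurable _ _ RR RR y)).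
  have c0' x : 0 <= lowcut c (g x) by exact: lowcut_ge0.
  have r0' (x : RR) : setT x -> (0 <= riesz_kernel a e y x * (lowcut c (g x))%:E)%E.
    by move=> _; apply: mule_ge0; [exact: riesz_kernel_ge0|rewrite lee_fin].
  have ME : (0 <= M%:E)%E by rewrite lee_fin.
  apply: (@le_trans _ _ (\int[mu_ a]_x (M%:E * (riesz_kernel a e y x * (lowcut c (g x))%:E)))%E).
    apply: ge0_le_integral => //.
    - by move=> x _; apply: mule_ge0; [exact: pkernel_ge0|rewrite lee_fin].
    - apply: emeasurable_funM => //; exact: measurable_pkernel1.
    - exact: measurable_funeM.
    - move=> x _; rewrite muleA; apply: lee_wpmul2r; first by rewrite lee_fin.
      exact: pkernel_le_riesz.
  rewrite (ge0_integralZl (mu_ a) measurableT mr r0' ME).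
  rewrite -[X in (_ <= X%:E)%E]mulrA (EFinM M).
  apply: lee_wpmul2l => //.
  have := riesz_truncated y a2 e0 k1 ek mg g0 gk c0.
  have -> : e / ((a + 1) / k) = th * k.
    by rewrite /e; field; rewrite hn0 gt_eqF.
  exact: le_trans.
have C0 : 0 <= M * (D p + D r) by rewrite mulr_ge0// addr_ge0 ?D0.
apply: (@strong_bound_bilinear a s p q r (1 - th * r) (1 - th * p) (M * (D p + D r))) => //.
- by rewrite /th /r; field; rewrite ?pn0 ?q10 ?qn0 ?p10.
- by rewrite /th /r; field; rewrite ?pn0 ?q10 ?qn0 ?p10.
- move=> g y c mg g0 c0 gr; apply: le_trans (main _ _ y _ r1 er mg g0 c0 gr) _.
  rewrite lee_fin ler_wpM2r ?powR_ge0// ler_wpM2l// lerDr.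
  exact: D0.
- move=> g y c mg g0 c0 gp; apply: le_trans (main _ _ y _ (ltW p1) ep mg g0 c0 gp) _.
  rewrite lee_fin ler_wpM2r ?powR_ge0// ler_wpM2l// lerDl.
  exact: D0.
Qed.

End sufficiency.

(** * From nonnegative to signed functions *)
Section signed_functions.
Context {R : realType}.
Implicit Types (a s t x y b c e r u : R) (p q : \bar R).
Local Notation pos := (`]0%R, +oo[%classic : set R).
Local Notation RR := (measurableTypeR R).

Lemma Lnorm_le_pos a q (g u : RR -> \bar R) : (1 <= q)%E ->
  (forall x, 0 <= u x)%E -> (forall x, 0 < x -> (`|g x| <= u x)%E) ->
  ('N[mu_ a]_q[g] <= 'N[mu_ a]_q[u])%E.
Proof.
move=> q1 u0 gu; rewrite unlock; case: q q1 => [q q1|_|//].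
  have q0 : 0 < q by move: q1; rewrite lee_fin; exact: lt_le_trans.
  apply: gt0_ler_poweR; rewrite ?invr_ge0 ?(ltW q0)// ?in_itv/= ?leey ?andbT.
  - by apply: integral_ge0 => x _; exact: poweR_ge0.
  - by apply: integral_ge0 => x _; exact: poweR_ge0.
  apply: le_integral_pos => [x|x|x x0]; [exact: poweR_ge0|exact: poweR_ge0|].
  rewrite (gee0_abs (u0 x)); apply: gt0_ler_poweR; rewrite ?(ltW q0)// ?in_itv/= ?leey ?andbT.
  - exact: abse_ge0.
  - exact: u0.
  - exact: gu.
case: ifPn => // _; apply: le_ess_sup; apply: ae_pos => x x0 /=.
by rewrite (gee0_abs (u0 x)) gu.
Qed.

Lemma Lnorm_scale a q c (u : RR -> \bar R) : (1 <= q)%E -> 0 < c ->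
  measurable_fun setT u -> (forall x, 0 <= u x)%E ->
  ('N[mu_ a]_q[(fun x => c%:E * u x)] = c%:E * 'N[mu_ a]_q[u])%E.
Proof.
move=> q1 c0 mu u0; rewrite unlock; case: q q1 => [q q1|_|//].
  have q0 : 0 < q by move: q1; rewrite lee_fin; exact: lt_le_trans.
  have mq : measurable_fun (setT : set RR) (fun x => (`|u x| `^ q)%E).
    apply: (measurableT_comp (measurable_poweR q)); exact: measurableT_comp.
  have q0' (x : RR) : setT x -> (0 <= `|u x| `^ q)%E by move=> _; exact: poweR_ge0.
  have cq0 : (0 <= (c `^ q)%:E)%E by rewrite lee_fin powR_ge0.
  under eq_integral.
    move=> x _; rewrite abseM poweRM ?abse_ge0// abse_EFin (gtr0_norm c0) poweR_EFin.
    over.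
  rewrite (ge0_integralZl (mu_ a) measurableT mq q0' cq0) poweRM//; last first.
    by apply: integral_ge0 => x _; exact: poweR_ge0.
  by rewrite poweR_EFin -powRrM mulfV ?gt_eqF// powRr1// ltW.
case: ifPn => _; last by rewrite mule0.
rewrite -ess_sup_pZl//; congr ess_sup; apply/funext => x /=.
by rewrite abseM abse_EFin (gtr0_norm c0).
Qed.

Lemma Lnorm_fin_ae a q (u : RR -> \bar R) : (1 <= q)%E ->
  measurable_fun setT u -> (forall x, 0 <= u x)%E ->
  ('N[mu_ a]_q[u] < +oo)%E -> -1 < a -> {ae mu_ a, forall x, (u x < +oo)%E}.
Proof.
move=> q1 mu u0 + a1; case: q q1 => [q q1|_|//].
  have q0 : 0 < q by move: q1; rewrite lee_fin; exact: lt_le_trans.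
  move=> Nq.
  have : (mu_ a).-integrable setT (fun x => `|u x| `^ q)%E.
    apply/integrableP; split.
      by apply: (measurableT_comp (measurable_poweR q)); exact: measurableT_comp.
    under eq_integral do rewrite gee0_abs ?poweR_ge0//.
    by rewrite -poweR_Lnorm ?gt_eqF//; exact: poweR_lty.
  move=> /(integrable_ae measurableT); apply: ae_mono => x /(_ I).
  rewrite ge0_fin_numE ?poweR_ge0//.
  by move=> /(lty_poweRy (lt0r_neq0 q0)); rewrite gee0_abs.
rewrite (LnormyE _ a1) => Nq.
have := ess_sup_ge (mu_ a) (abse \o u); apply: ae_mono => x /=.
by rewrite gee0_abs// => /le_lt_trans; apply.
Qed.

Lemma measurable_integrand a s x (f : RR -> R) : -1 < a -> 0 < x ->
  measurable_fun setT f ->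
  measurable_fun (pos : set RR) (fun y => (potential_kernel a s x y * (f y)%:E)%E).
Proof.
move=> a1 x0 mf.
have m1 : measurable_fun (pos : set RR) (fun y => (pkernel a s x y * (f y)%:E)%E).
  apply: measurable_funTS; apply: emeasurable_funM; first exact: measurable_pkernel1.
  exact/measurable_EFinP.
apply: eq_measurable_fun m1 => y.
by rewrite inE/= in_itv/= andbT => y0; rewrite potential_kernelE.
Qed.

Lemma integral_abs_integrand a s x (f : RR -> R) : -1 < a -> 0 < x ->
  measurable_fun setT f ->
  (\int[mu_ a]_(y in pos) `|potential_kernel a s x y * (f y)%:E| =
    pot a s (fun y => `|f y|%R) x)%E.
Proof.
move=> a1 x0 mf.
have mF : measurable_fun (setT : set RR) (fun y => `|f y|) by exact: measurableT_comp.
rewrite -[RHS](@potentialE R a s (fun y => `|f y|) x a1 x0 mF) //.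
apply: eq_integral => y; rewrite inE/= in_itv/= andbT => y0.
by rewrite abseM potential_kernelE// (gee0_abs (pkernel_ge0 _ _ _ _)).
Qed.

(** Apply the bound to [|f| / c] for every [c > 0] at least the norm of [f], and
    let [c] tend to that norm, which may be zero.  A finite norm of the potential
    of [|f|] gives the integrability almost everywhere. *)
Lemma strong_bound_potential a s p q : -1 < a -> (1 <= p)%E -> (1 <= q)%E ->
  strong_bound a s p q -> potential_bounded a s p q.
Proof.
move=> a1 p1 q1 [C C0 SB]; exists C => f fL.
have mf : measurable_fun setT f by exact: (set_mem (sub_Lfun_mfun fL)).
have ffin : ('N[mu_ a]_p[EFin \o f] < +oo)%E by exact: (set_mem (sub_Lfun_finLfun fL)).
pose F (y : RR) := `|f y|.
have mF : measurable_fun (setT : set RR) F by exact: measurableT_comp.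
have F0 (y : RR) : 0 <= F y by exact: normr_ge0.
set A := ('N[mu_ a]_p[EFin \o f])%E in ffin *.
have AF : ('N[mu_ a]_p[EFin \o F] = A)%E by rewrite /A -[RHS]Lnorm_abse.
have A0 : (0 <= A)%E by exact: Lnorm_ge0.
have scale c : 0 < c -> (A <= c%:E)%E -> ('N[mu_ a]_q[pot a s F] <= (C * c)%:E)%E.
  move=> c0 Ac.
  pose g (y : RR) := c^-1 * F y.
  have mg : measurable_fun (setT : set RR) g by exact: measurable_funM.
  have g0 (y : RR) : 0 <= g y by rewrite mulr_ge0// invr_ge0 ltW.
  have ci0 : 0 < c^-1 by rewrite invr_gt0.
  have mFE : measurable_fun (setT : set RR) (EFin \o F) by exact/measurable_EFinP.
  have gN : ('N[mu_ a]_p[EFin \o g] <= 1)%E.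
    rewrite (_ : EFin \o g = (fun y => (c^-1)%:E * (EFin \o F) y)%E)//.
    rewrite Lnorm_scale// AF.
    by rewrite lee_pdivrMl// mule1.
  have := SB g mg g0 gN.
  have -> : pot a s g = (fun x => (c^-1)%:E * pot a s F x)%E.
    apply/funext => x; rewrite /pot.
    have m1 : measurable_fun (setT : set RR) (fun y => (pkernel a s x y * (F y)%:E)%E).
      by apply: emeasurable_funM; [exact: measurable_pkernel1|exact/measurable_EFinP].
    have n1 (y : RR) : setT y -> (0 <= pkernel a s x y * (F y)%:E)%E.
      by move=> _; rewrite mule_ge0 ?pkernel_ge0// lee_fin.
    have ciE : (0 <= (c^-1)%:E)%E by rewrite lee_fin ltW.
    rewrite -(ge0_integralZl (mu_ a) measurableT m1 n1 ciE).
    by apply: eq_integral => y _; rewrite /g EFinM muleCA.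
  rewrite Lnorm_scale//; [|exact: measurable_pot|by move=> x; exact: pot_ge0].
  by rewrite lee_pdivrMl// -EFinM mulrC.
have NA : ('N[mu_ a]_q[pot a s F] <= C%:E * A)%E.
  have Afin : A \is a fin_num by rewrite ge0_fin_numE.
  have a0 : 0 <= fine A by rewrite fine_ge0.
  rewrite -(fineK Afin) -EFinM; apply/lee_addgt0Pr => e e0.
  have C1 : 0 < C + 1 by rewrite ltr_wpDl.
  apply: (le_trans (scale (fine A + e / (C + 1)) _ _)).
  - by rewrite ltr_wpDl// divr_gt0.
  - by rewrite EFinD (fineK Afin) leeDl// lee_fin divr_ge0// ltW.
  - rewrite -EFinD lee_fin mulrDr lerD2l mulrA ler_pdivrMr// mulrC ler_pM2l//.
    by rewrite lerDl.
split.
  have fin : ('N[mu_ a]_q[pot a s F] < +oo)%E.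
    apply: le_lt_trans NA _; rewrite lte_mul_pinfty// lee_fin//.
  have := Lnorm_fin_ae q1 (measurable_pot a s mF F0)
    (fun x => pot_ge0 a s x F0) fin a1.
  move=> [N [mN N0 sN]]; exists (N `|` `]-oo, 0]%classic); split.
  - exact: measurableU.
  - by apply: null_set_setU => //; exact: mu_le0.
  move=> x /= nx; have [x0|x0] := ltP 0 x; last by right; rewrite /= in_itv.
  left; apply: sN => /= ux; apply: nx; apply/integrableP; split.
    exact: measurable_integrand.
  by rewrite integral_abs_integrand.
apply: le_trans NA; apply: Lnorm_le_pos => //; first by move=> x; exact: pot_ge0.
move=> x x0; rewrite /potential -integral_abs_integrand//.
by apply: le_abse_integral => //; exact: measurable_integrand.
Qed.

End signed_functions.

(** * Gaussians as test functions *)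
Section gaussian_tests.
Context {R : realType}.
Implicit Types (a s t x y b c e r u v : R) (p q : \bar R).
Local Notation RR := (measurableTypeR R).
Local Notation tm s := (mu_ (s / 2 - 1)).

Lemma powR_bounded e K c : 1 <= c -> (forall B, c <= B -> B `^ e <= K) -> e <= 0.
Proof.
move=> c1 H; rewrite leNgt; apply/negP => e0.
have c0 : 0 < c := lt_le_trans ltr01 c1.
pose L := Num.max (c `^ e) (K + 1).
have L0 : 0 < L by rewrite lt_max powR_gt0.
have LE : (L `^ e^-1) `^ e = L by rewrite -powRrM mulVf ?gt_eqF// powRr1// ltW.
have /H : c <= L `^ e^-1.
  rewrite -[leLHS](powRr1 (ltW c0)) -(mulfV (lt0r_neq0 e0)) powRrM.
  by apply: ge0_ler_powR; rewrite ?nnegrE ?powR_ge0 ?invr_ge0 ?(ltW e0) ?(ltW L0)// le_max lexx.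
rewrite LE; apply/negP; rewrite -ltNge.
by apply: (@lt_le_trans _ _ (K + 1)); rewrite ?ltrDl// le_max lexx orbT.
Qed.

Lemma bounded_pot a s p q : -1 < a -> (1 <= q)%E -> potential_bounded a s p q ->
  exists2 C : R, 0 < C & forall f : RR -> R, measurable_fun setT f -> (forall y, 0 <= f y) ->
    ('N[mu_ a]_p[EFin \o f] < +oo)%E ->
    ('N[mu_ a]_q[pot a s f] <= C%:E * 'N[mu_ a]_p[EFin \o f])%E.
Proof.
move=> a1 q1 [C PB]; exists (Num.max C 1); first by rewrite lt_max ltr01 orbT.
move=> f mf f0 ff.
have /PB[_ H] : f \in Lfun (mu_ a) p by apply/andP; split; rewrite inE.
apply: (@le_trans _ _ (C%:E * 'N[mu_ a]_p[EFin \o f])%E); last first.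
  by apply: lee_wpmul2r; rewrite ?Lnorm_ge0// lee_fin le_max lexx.
rewrite -(Lnorm_abse (mu_ a) (potential a s f)) in H; apply: le_trans H.
apply: Lnorm_le_pos; [exact: q1|by move=> x /=; exact: abse_ge0|].
by move=> x x0 /=; rewrite (potentialE _ a1 x0 mf f0).
Qed.

(** The exponent [1 / q] as a real number, with [1 / oo = 0]. *)
Definition rinv q : R := fine (q^-1)%E.

Lemma rinv_real (r : R) : r != 0 -> rinv r%:E = r^-1.
Proof. by move=> r0; rewrite /rinv inver (negbTE r0). Qed.

Lemma rinv_y : rinv +oo = 0. Proof. by rewrite /rinv invey. Qed.

Lemma inv_rinv q : (1 <= q)%E -> (q^-1 = (rinv q)%:E)%E.
Proof.
case: q => [r r1|_|//]; last by rewrite rinv_y invey.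
have r0 : r != 0 by rewrite gt_eqF// (lt_le_trans ltr01 r1).
by rewrite rinv_real// inver (negbTE r0).
Qed.

Lemma rinv_ge0 q : (1 <= q)%E -> 0 <= rinv q.
Proof.
case: q => [r r1|_|//]; last by rewrite rinv_y.
have r0 : 0 < r by exact: lt_le_trans ltr01 r1.
by rewrite rinv_real ?gt_eqF// invr_ge0 ltW.
Qed.

Lemma Lnorm_realE a r (u : RR -> \bar R) :
  ('N[mu_ a]_r%:E[u] = (\int[mu_ a]_x (`|u x| `^ r)) `^ r^-1)%E.
Proof. by rewrite unlock. Qed.

Lemma Lnorm_indic_ge a q (E : set RR) c M : -1 < a -> (1 <= q)%E -> 0 < c -> measurable E ->
  mu_ a E = M%:E -> 0 < M -> forall u : RR -> \bar R, (forall x, 0 <= u x)%E ->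
  (forall x, E x -> (c%:E <= u x)%E) ->
  ((c * M `^ (rinv q))%:E <= 'N[mu_ a]_q[u])%E.
Proof.
move=> a1 q1 c0 mE ME M0 u u0 cu.
apply: (@le_trans _ _ ('N[mu_ a]_q[(fun x => c%:E * (\1_E x)%:E)])%E); last first.
  apply: (Lnorm_le_pos a q1 u0) => x _; rewrite indicE.
  case: (boolP (x \in E)) => [/[!inE] Ex|_]; last by rewrite mule0 abse0.
  by rewrite mule1 gee0_abs ?lee_fin ?(ltW c0)// cu.
rewrite Lnorm_scale//; last first.
  by apply/measurable_EFinP; exact: measurable_indic.
rewrite EFinM; apply: lee_wpmul2l; first by rewrite lee_fin ltW.
case: q q1 => [r r1|_|//].
  have r0 : 0 < r by exact: lt_le_trans ltr01 r1.
  rewrite rinv_real ?gt_eqF// Lnorm_realE.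
  rewrite [X in (_ <= X `^ _)%E](_ : _ = M%:E) ?poweR_EFin//.
  transitivity (\int[mu_ a]_x (\1_E x)%:E)%E; last by rewrite integral_indic// setIT.
  apply: eq_integral => x _.
  rewrite abse_EFin ger0_norm// poweR_EFin; congr EFin; rewrite indicE.
  by case: (_ \in _); rewrite ?powR1// powR0 ?gt_eqF.
rewrite rinv_y powRr0 (LnormyE _ a1).
rewrite leNgt; apply/negP => lt1.
have := ess_sup_ge (mu_ a) (abse \o (fun x => (\1_E x)%:E)).
move=> [N [mN N0 sN]].
have : (mu_ a E <= mu_ a N)%E.
  apply: le_measure; rewrite ?inE// => x Ex; apply: sN => /=.
  by rewrite indicE mem_set// normr1; apply/negP; rewrite -ltNge.
by rewrite N0 ME lee_fin leNgt M0.
Qed.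

Definition gauss b (y : R) : R := expR (- (b * y ^+ 2)).

Lemma gauss_ge0 b y : 0 <= gauss b y. Proof. exact: expR_ge0. Qed.

Lemma measurable_gauss b : measurable_fun (setT : set RR) (gauss b).
Proof.
apply: measurableT_comp; [exact: measurable_expR|apply: measurable_funN].
by apply: measurable_funM => //; exact: measurable_funX.
Qed.

Lemma gauss_integral a b : -1 < a -> 0 < b ->
  (\int[mu_ a]_y (gauss b y)%:E = (b `^ (- (a + 1)) * Gamma (a + 1) / 2)%:E)%E.
Proof.
move=> a1 b0; have := mu_gauss_moment 0 a1 b0; rewrite add0r => <-.
by apply: eq_integral => y _; rewrite expr0 mul1r.
Qed.

Lemma gauss_norm_le a p : -1 < a -> (1 <= p)%E -> exists2 K : R, 0 < K &
  forall b, 0 < b ->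
    ('N[mu_ a]_p[EFin \o gauss b] <= (K * b `^ (- ((a + 1) * rinv p)))%:E)%E.
Proof.
move=> a1; have h0 : 0 < a + 1 by lra.
case: p => [p p1|_|//]; last first.
  exists 1 => // b b0; rewrite rinv_y mulr0 oppr0 powRr0 mulr1.
  apply: Lnormy_le => // [x|x x0]; first by rewrite lee_fin gauss_ge0.
  by rewrite lee_fin expR_le1 oppr_le0 mulr_ge0 ?sqr_ge0// ltW.
have p0 : 0 < p by exact: lt_le_trans ltr01 p1.
have G0 : 0 < Gamma (a + 1) by exact: Gamma_gt0.
exists ((p `^ (- (a + 1)) * Gamma (a + 1) / 2) `^ p^-1).
  by rewrite powR_gt0// divr_gt0// mulr_gt0// powR_gt0.
move=> b b0; rewrite rinv_real ?gt_eqF//.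
rewrite Lnorm_realE [X in (X `^ _ <= _)%E](_ : _ = \int[mu_ a]_y (gauss (p * b) y)%:E)%E;
    last first.
  apply: eq_integral => y _; rewrite /comp abse_EFin ger0_norm ?gauss_ge0// poweR_EFin /gauss -expRM.
  by congr (expR _)%:E; ring.
rewrite gauss_integral ?mulr_gt0// poweR_EFin lee_fin le_eqVlt; apply/orP; left; apply/eqP.
rewrite (@powRM _ p b) ?(ltW p0) ?(ltW b0)//.
have -> : p `^ (- (a + 1)) * b `^ (- (a + 1)) * Gamma (a + 1) / 2 =
    (p `^ (- (a + 1)) * Gamma (a + 1) / 2) * b `^ (- (a + 1)) by ring.
rewrite powRM ?powR_ge0//; last by rewrite divr_ge0// mulr_ge0 ?powR_ge0// ltW.
by rewrite -powRrM mulNr.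
Qed.

(** Only the times between [u] and [v] are kept, on which each factor of the
    integrand of [pkernel_gauss] is replaced by its smallest value. *)
Lemma pot_gauss_ge a s b u v x : -1 < a -> 0 < s -> 0 < b -> 0 < u -> u < v ->
  ((((v `^ s - u `^ s) / s) / Gamma s * expR (- v) * (1 + 4 * b * v) `^ (- (a + 1))
     * expR (- (b * x ^+ 2 / (1 + 4 * b * u))))%:E <= pot a s (gauss b) x)%E.
Proof.
move=> a1 s0 b0 u0 uv; have v0 := lt_trans u0 uv.
have G0 := Gamma_gt0 s0.
rewrite /pot pkernel_gauss ?(ltW b0)//.
set k := expR (- v) * ((1 + 4 * b * v) `^ (- (a + 1))
     * expR (- (b * x ^+ 2 / (1 + 4 * b * u)))).
have k0 : 0 <= k by rewrite !mulr_ge0 ?expR_ge0// powR_ge0.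
set I : set RR := `[u, v]%classic.
have muI : (tm s) I = ((v `^ s - u `^ s) / s)%:E.
  rewrite /I mu_itv//; last by lra.
  by have -> : 2 * (s / 2 - 1 + 1) = s by field.
rewrite [X in (X <= _)%E](_ : _ = ((Gamma s)^-1%:E * (k%:E * (tm s) I))%E); last first.
  by rewrite muI -!EFinM /k; congr EFin; ring.
apply: lee_wpmul2l; first exact: invGamma_ge0.
have mI : measurable_fun (setT : set RR) (fun t : RR => (\1_I t : R)%:E).
  by apply/measurable_EFinP; apply: measurable_indic; exact: measurable_itv.
have I0 (t : RR) : setT t -> (0 <= (\1_I t)%:E :> \bar R)%E by rewrite lee_fin.
have kE : (0 <= k%:E)%E by rewrite lee_fin.
have -> : (tm s) I = (\int[tm s]_t (\1_I t)%:E)%E.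
  by rewrite integral_indic ?setIT//; exact: measurable_itv.
rewrite -(ge0_integralZl (tm s) measurableT mI I0 kE).
apply: le_integral_pos => [t|t|t t0].
- by rewrite mule_ge0// lee_fin.
- by rewrite lee_fin !mulr_ge0 ?expR_ge0// powR_ge0.
rewrite -EFinM lee_fin indicE.
case: (boolP (t \in I)) => [/[!inE]|_]; last first.
  by rewrite mulr0 !mulr_ge0 ?expR_ge0// powR_ge0.
rewrite /I /= in_itv/= => /andP[ut tv]; rewrite mulr1 /k.
have pos1 w : 0 < w -> 0 < 1 + 4 * b * w by move=> w0; rewrite addr_gt0// !mulr_gt0.
apply: ler_pM; rewrite ?expR_ge0// ?mulr_ge0 ?powR_ge0 ?expR_ge0//.
  by rewrite ler_expR lerN2.
apply: ler_pM; rewrite ?expR_ge0 ?powR_ge0//.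
  rewrite !powRN lef_pV2 ?posrE ?powR_gt0 ?pos1//.
  apply: ge0_ler_powR; rewrite ?nnegrE ?(ltW (pos1 _ _))//; first by lra.
  by rewrite lerD2l ler_pM2l// !mulr_gt0.
rewrite ler_expR lerN2; apply: ler_wpM2l; first by rewrite mulr_ge0 ?sqr_ge0 ?(ltW b0).
by rewrite lef_pV2 ?posrE ?pos1// lerD2l ler_pM2l// !mulr_gt0.
Qed.

End gaussian_tests.

(** * Necessity of the two inequalities *)
Section scaling.
Context {R : realType}.
Implicit Types (a s t x y b c e r u v : R) (p q : \bar R).
Local Notation RR := (measurableTypeR R).

(** The potential of the Gaussian of width [z = b ^ (- 1 / 2)] is at least of
    order [tau ^ s] at distances between [z / 2] and [z], by the times up to
    [tau]: the condition [b tau <= 1] says that these do not exceed [z ^ 2], so that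
    the Gaussian has not yet spread. *)
Lemma gauss_scaling a s p q : -1 < a -> 0 < s -> (1 <= p)%E -> (1 <= q)%E ->
  potential_bounded a s p q -> exists L : R, forall b tau,
    0 < b -> 0 < tau -> tau <= 1 -> b * tau <= 1 ->
    tau `^ s * b `^ (- ((a + 1) * rinv q)) <= L * b `^ (- ((a + 1) * rinv p)).
Proof.
move=> a1 s0 p1 q1 PB.
have h0 : 0 < a + 1 by lra.
set h := a + 1 in h0 *.
have [C C0 HC] := bounded_pot a1 q1 PB.
have [K K0 HK] := gauss_norm_le a1 p1.
have G0 := Gamma_gt0 s0.
have lt1 e : 0 < e -> 2^-1 `^ e < 1 :> R.
  move=> e0; have := @gt0_ltr_powR R e e0 2^-1 1; rewrite powR1; apply.
  - by rewrite nnegrE invr_ge0.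
  - by rewrite nnegrE.
  - by rewrite invf_lt1// ltr1n.
(* For times between [tau / 2] and [tau], [1 + 4 b t] lies between [1] and [5]. *)
pose c1 := ((1 - 2^-1 `^ s) / s) / Gamma s * expR (- 1) * 5 `^ (- h) * expR (- 1).
have c10 : 0 < c1.
  by rewrite !mulr_gt0 ?expR_gt0 ?powR_gt0 ?invr_gt0// subr_gt0 lt1.
pose m0 := (1 - 2^-1 `^ (2 * h)) / (2 * h).
have m00 : 0 < m0 by rewrite divr_gt0 ?mulr_gt0// subr_gt0 lt1// mulr_gt0.
exists (C * K / (c1 * m0 `^ rinv q)) => b tau b0 t0 t1 bt.
pose z := b `^ (- 2^-1).
have z0 : 0 < z by rewrite powR_gt0.
have zz : b * z ^+ 2 = 1.
  rewrite /z -powR_mulrn ?powR_ge0// -powRrM mulNr mulVf ?pnatr_eq0//.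
  by rewrite powR_inv1 ?(ltW b0)// mulfV ?gt_eqF.
have z2h : z `^ (2 * h) = b `^ (- h).
  by rewrite /z -powRrM; congr (_ `^ _); field.
pose E : set RR := `[z / 2, z]%classic.
have zh : z / 2 < z by rewrite ltr_pdivrMr// mulr_natr mulr2n ltrDl.
have muE : mu_ a E = (m0 * b `^ (- h))%:E.
  rewrite /E mu_itv ?divr_gt0//; congr EFin.
  by rewrite powRM ?(ltW z0)// -/h z2h /m0; field; rewrite gt_eqF.
have pot_ge x : E x -> ((c1 * tau `^ s)%:E <= pot a s (gauss b) x)%E.
  rewrite /E /= in_itv/= => /andP[x1 x2].
  have x0 : 0 < x by apply: lt_le_trans x1; rewrite divr_gt0.
  have th0 : 0 < tau / 2 by rewrite divr_gt0.
  have tht : tau / 2 < tau by rewrite ltr_pdivrMr// mulr_natr mulr2n ltrDl.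
  apply: le_trans (pot_gauss_ge x a1 s0 b0 th0 tht); rewrite lee_fin.
  rewrite [in leRHS]powRM ?(ltW t0)//.
  have -> : c1 * tau `^ s = (tau `^ s - tau `^ s * 2^-1 `^ s) / s / Gamma s *
      (expR (- 1) * 5 `^ (- h) * expR (- 1)).
    by rewrite /c1; ring.
  rewrite -[leRHS]mulrA -[leRHS]mulrA; apply: ler_wpM2l.
    rewrite -[in X in X - _](mulr1 (tau `^ s)) -mulrBr !mulr_ge0 ?powR_ge0 ?invr_ge0 ?(ltW s0) ?(ltW G0)//.
    by rewrite subr_ge0 ltW// lt1.
  have bpos w : 0 < w -> 0 < 1 + 4 * b * w by move=> w0; rewrite addr_gt0// !mulr_gt0.
  rewrite -mulrA; apply: ler_pM; rewrite ?expR_ge0 ?mulr_ge0 ?expR_ge0 ?powR_ge0//.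
    by rewrite ler_expR lerN2.
  apply: ler_pM; rewrite ?expR_ge0 ?powR_ge0//.
    rewrite !powRN lef_pV2 ?posrE ?powR_gt0 ?bpos//.
    apply: ge0_ler_powR; rewrite ?nnegrE ?(ltW h0) ?(ltW (bpos _ t0))//.
    by rewrite -mulrA; lra.
  rewrite ler_expR lerN2 ler_pdivrMr ?bpos// mul1r.
  apply: (@le_trans _ _ 1); last by rewrite lerDl !mulr_ge0// ltW.
  rewrite -zz ler_pM2l//; apply: lerXn2r; rewrite ?nnegrE ?(ltW x0) ?(ltW z0)//.
have Kb0 : 0 < K * b `^ (- (h * rinv p)) by rewrite mulr_gt0// powR_gt0.
have fin : ('N[mu_ a]_p[EFin \o gauss b] < +oo)%E.
  exact: le_lt_trans (HK b b0) (ltry _).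
have up := HC _ (measurable_gauss b) (gauss_ge0 b) fin.
have lo := @Lnorm_indic_ge R a q E (c1 * tau `^ s) (m0 * b `^ (- h)) a1 q1
  (mulr_gt0 c10 (powR_gt0 _ t0)) (measurable_itv _) muE
  (mulr_gt0 m00 (powR_gt0 _ b0)) _ (fun x => pot_ge0 a s x (gauss_ge0 b)) pot_ge.
have := le_trans lo (le_trans up (lee_wpmul2l (_ : 0 <= C%:E)%E (HK b b0))).
rewrite lee_fin => /(_ (ltW C0)); rewrite -EFinM lee_fin.
rewrite powRM ?powR_ge0 ?(ltW m00)// -powRrM mulNr => H.
have D0 : 0 < c1 * m0 `^ rinv q by rewrite mulr_gt0// powR_gt0.
rewrite [leRHS](_ : _ = (c1 * m0 `^ rinv q)^-1 * (C * (K * b `^ (- (h * rinv p))))); last by ring.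
by rewrite ler_pdivlMl//; apply: le_trans H; rewrite le_eqVlt; apply/orP; left; apply/eqP; ring.
Qed.

(** In [gauss_scaling], [tau = 1] with [b -> 0] gives the first inequality, and
    [tau = 1 / b] with [b -> oo] the second one. *)
Lemma bounded_scaling a s p q : -1 < a -> 0 < s -> (1 <= p)%E -> (1 <= q)%E ->
  potential_bounded a s p q ->
  rinv q <= rinv p /\ rinv p - s / (a + 1) <= rinv q.
Proof.
move=> a1 s0 p1 q1 PB; have [L HL] := gauss_scaling a1 s0 p1 q1 PB.
have h0 : 0 < a + 1 by lra.
split.
- rewrite -subr_le0 -(pmulr_rle0 _ h0).
  apply: (@powR_bounded _ _ L 1) => // B B1.
  have B0 : 0 < B := lt_le_trans ltr01 B1.
  have := HL B^-1 1; rewrite invr_gt0 mulr1 invf_le1// => /(_ B0 ltr01 (lexx _) B1).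
  rewrite powR1 mul1r -(powR_inv1 (ltW B0)) -!powRrM !mulN1r !opprK.
  rewrite mulrBr powRD ?(gt_eqF B0) ?implybT// powRN ler_pdivrMr ?powR_gt0//.
- have h_neq0 : a + 1 != 0 by rewrite gt_eqF.
  rewrite -subr_le0 -(pmulr_rle0 _ h0).
  apply: (@powR_bounded _ _ L 1) => // B B1.
  have B0 : 0 < B := lt_le_trans ltr01 B1.
  have := HL B B^-1; rewrite invr_gt0 mulfV ?gt_eqF// invf_le1// => /(_ B0 B0 B1 (lexx _)).
  rewrite -(powR_inv1 (ltW B0)) -powRrM mulN1r -powRD ?(gt_eqF B0) ?implybT//.
  rewrite (powRN _ ((a + 1) * rinv p)) ler_pdivlMr ?powR_gt0//.
  rewrite -powRD ?(gt_eqF B0) ?implybT//; apply: le_trans.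
  by rewrite le_eqVlt; apply/orP; left; apply/eqP; congr (_ `^ _); field.
Qed.

End scaling.

(** * Logarithmic divergence at the corners *)
Section endpoint.
Context {R : realType}.
Implicit Types (a s t x y b c e r u v K p q : R).
Local Notation leb := (@lebesgue_measure R).
Local Notation pos := (`]0%R, +oo[%classic : set R).
Local Notation RR := (measurableTypeR R).
Local Notation tm s := (mu_ (s / 2 - 1)).

Lemma integral_inv_itv b c : 0 < b -> b < c ->
  (\int[leb]_(x in `[b, c]) (x `^ (- 1))%:E = (ln c - ln b)%:E)%E.
Proof.
move=> b0 bc; rewrite EFinB; apply: (@continuous_FTC2 R (fun x => x `^ (- 1)) (@ln R)) => //.
- apply: within_continuous_powR => x /=; rewrite in_itv/= => /andP[+ _].
  exact: lt_le_trans.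
- split.
  + move=> x; rewrite in_itv/= => /andP[bx _].
    by apply: ex_derive; apply: is_derive1_ln; exact: lt_trans bx.
  + by apply: cvg_at_right_filter; exact: continuous_ln.
  + by apply: cvg_at_left_filter; apply: continuous_ln; exact: lt_trans bc.
- move=> x; rewrite in_itv/= => /andP[bx _]; have x0 := lt_trans b0 bx.
  rewrite derive1E powR_inv1 ?(ltW x0)//.
  by have [_ ->] := is_derive1_ln x0.
Qed.

Lemma ln_unbounded K : ~ (forall b, 1 < b -> ln b <= K).
Proof.
move=> H; pose L := Num.max K 0 + 1.
have L0 : 0 < L by rewrite ltr_wpDl// le_max lexx orbT.
have := H (expR L); rewrite expR_gt1 L0 expRK => /(_ isT).
by rewrite leNgt /L ltr_pwDr// le_max lexx.
Qed.

(** The times [t] of order [x ^ 2] already make the potential of the normalized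
    Gaussian at least of order [x ^ (2 (s - h))] for [x] between [b ^ (- 1 / 2)]
    and [1].  Its [q]-th power is [x ^ (- 2 h)], whose integral against
    [x ^ (2 h - 1) dx] over this range is [ln b / 2]. *)
Lemma endpoint_unbounded a s K : -1 < a -> 0 < s -> s < a + 1 -> 0 <= K ->
  (forall b, 1 <= b -> (\int[mu_ a]_x (pot a s (gauss b) x `^ ((a + 1) / (a + 1 - s))) <=
    ((K * b `^ (- (a + 1))) `^ ((a + 1) / (a + 1 - s)))%:E)%E) -> False.
Proof.
move=> a1 s0 sh K0 HK.
have h0 : 0 < a + 1 by lra.
set h := a + 1 in h0 sh HK *.
have hs0 : 0 < h - s by rewrite subr_gt0.
set q := h / (h - s) in HK *.
have q0 : 0 < q by rewrite divr_gt0.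
have G0 := Gamma_gt0 s0.
have s21 : 0 < 2 `^ s - 1 :> R.
  rewrite subr_gt0; have := @gt0_ltr_powR R s s0 1 2; rewrite powR1; apply.
  - by rewrite nnegrE.
  - by rewrite nnegrE.
  - by rewrite ltr1n.
(* For times between [x ^ 2] and [2 x ^ 2], and as [b x ^ 2 >= 1], the factor
   [1 + 4 b t] is at most [9 b x ^ 2]. *)
pose c := (2 `^ s - 1) / s / Gamma s * expR (- 2) * 9 `^ (- h) * expR (- 1).
have c0 : 0 < c by rewrite !mulr_gt0 ?expR_gt0 ?powR_gt0 ?invr_gt0.
apply: (@ln_unbounded (2 * K `^ q / c `^ q)) => b b1.
have b0 : 0 < b := lt_trans ltr01 b1.
pose z := b `^ (- 2^-1).
have z0 : 0 < z by rewrite powR_gt0.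
have zz : b * z ^+ 2 = 1.
  rewrite /z -powR_mulrn ?powR_ge0// -powRrM mulNr mulVf ?pnatr_eq0//.
  by rewrite powR_inv1 ?(ltW b0)// mulfV ?gt_eqF.
have z1 : z < 1.
  have : z ^+ 2 < 1 by rewrite -(ltr_pM2l b0) zz mulr1.
  by rewrite expr_lt1// ltW.
pose E : set RR := `[z, 1]%classic.
have pot_ge x : E x -> ((c * b `^ (- h) * x `^ (2 * (s - h)))%:E <= pot a s (gauss b) x)%E.
  rewrite /E /= in_itv/= => /andP[zx x1].
  have x0 : 0 < x := lt_le_trans z0 zx.
  have xx0 : 0 < x ^+ 2 by rewrite exprn_gt0.
  have x2 : x ^+ 2 < 2 * x ^+ 2 by rewrite mulr2n mulrDl mul1r ltrDl.
  apply: le_trans (pot_gauss_ge x a1 s0 b0 xx0 x2); rewrite lee_fin.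
  have bx1 : 1 <= b * x ^+ 2.
    rewrite -zz ler_pM2l//; apply: lerXn2r; rewrite ?nnegrE ?(ltW x0) ?(ltW z0)//.
  have xs : (x ^+ 2) `^ s = x `^ (2 * s).
    by rewrite -powR_mulrn ?(ltW x0)// -powRrM.
  rewrite [in leRHS](@powRM _ 2)// ?(ltW xx0)// xs.
  have E1 : x `^ (2 * (s - h)) = x `^ (2 * s) * x `^ (- (2 * h)).
    by rewrite -powRD ?(gt_eqF x0) ?implybT//; congr (_ `^ _); ring.
  have E2 : (9 * (b * x ^+ 2)) `^ (- h) = 9 `^ (- h) * (b `^ (- h) * x `^ (- (2 * h))).
    have E0 : (x ^+ 2) `^ (- h) = x `^ (- (2 * h)).
      by rewrite -powR_mulrn ?(ltW x0)// -powRrM mulrN.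
    have bx0 : 0 <= b * x ^+ 2 := le_trans ler01 bx1.
    by rewrite (powRM _ _ bx0)// (powRM _ (ltW b0) (ltW xx0)) E0.
  have -> : c * b `^ (- h) * x `^ (2 * (s - h)) =
      (2 `^ s * x `^ (2 * s) - x `^ (2 * s)) / s / Gamma s *
      (expR (- 2) * ((9 * (b * x ^+ 2)) `^ (- h) * expR (- 1))).
    by rewrite E1 E2 /c; ring.
  rewrite -[leRHS]mulrA -[leRHS]mulrA; apply: ler_wpM2l.
    rewrite -[in X in _ - X](mul1r (x `^ _)) -mulrBl.
    by rewrite !mulr_ge0 ?powR_ge0 ?invr_ge0 ?(ltW s0) ?(ltW G0) ?(ltW s21).
  have bpos w : 0 < w -> 0 < 1 + 4 * b * w by move=> w0; rewrite addr_gt0// !mulr_gt0.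
  have x21 : x ^+ 2 <= 1 by rewrite expr_le1// ltW.
  have xx20 : 0 < 2 * x ^+ 2 by rewrite mulr_gt0.
  apply: ler_pM; rewrite ?expR_ge0 ?mulr_ge0 ?expR_ge0 ?powR_ge0//.
    by rewrite ler_expR lerN2; lra.
  apply: ler_pM; rewrite ?expR_ge0 ?powR_ge0//.
    rewrite !powRN lef_pV2 ?posrE ?powR_gt0 ?bpos ?mulr_gt0//.
    apply: ge0_ler_powR; rewrite ?nnegrE ?(ltW h0) ?(ltW (bpos _ xx20)) ?mulr_ge0 ?(ltW b0) ?(ltW xx0) ?(ltW x0)//.
    have e8 : 4 * b * (2 * x ^+ 2) = 8 * (b * x ^+ 2) by ring.
    by rewrite e8; lra.
  rewrite ler_expR lerN2 ler_pdivrMr ?bpos// mul1r.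
  have e4 : 4 * b * x ^+ 2 = 4 * (b * x ^+ 2) by ring.
  by rewrite e4; lra.
have qhs : 2 * (s - h) * q = - (2 * h).
  by rewrite /q; field; rewrite gt_eqF.
have powle : ((c `^ q * b `^ (- (h * q)))%:E * (2^-1 * ln b)%:E <=
    \int[mu_ a]_x (pot a s (gauss b) x `^ q))%E.
  pose D := c `^ q * b `^ (- (h * q)).
  have D0 : 0 <= D by rewrite mulr_ge0 ?powR_ge0.
  pose g (x : RR) : \bar R := (D * x `^ (- (2 * h)) * \1_E x)%:E.
  have mg : measurable_fun (setT : set RR) g.
    apply/measurable_EFinP; apply: measurable_funM.
      by apply: measurable_funM => //; exact: measurable_powR.
    by apply: measurable_indic; exact: measurable_itv.
  have g0 (x : RR) : (0 <= g x)%E by rewrite lee_fin mulr_ge0// mulr_ge0 ?powR_ge0.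
  apply: (@le_trans _ _ (\int[mu_ a]_x g x)%E); last first.
    apply: le_integral_pos => [//|x|x x0]; first exact: poweR_ge0.
    rewrite /g indicE; case: (boolP (x \in E)) => [/[!inE] Ex|_]; last first.
      by rewrite mulr0 poweR_ge0.
    rewrite mulr1.
    have -> : (D * x `^ (- (2 * h)))%:E =
        ((c * b `^ (- h) * x `^ (2 * (s - h)))%:E `^ q)%E.
      have cb0 : 0 <= c * b `^ (- h) := mulr_ge0 (ltW c0) (powR_ge0 _ _).
      rewrite poweR_EFin (powRM _ cb0 (powR_ge0 _ _)).
      by rewrite (powRM _ (ltW c0) (powR_ge0 _ _)) -!powRrM qhs mulNr.
    apply: gt0_ler_poweR; rewrite ?(ltW q0)// ?in_itv/= ?leey ?andbT.
    - by rewrite lee_fin (mulr_ge0 (mulr_ge0 (ltW c0) _)) ?powR_ge0.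
    - by apply: pot_ge0; exact: gauss_ge0.
    - exact: pot_ge.
  rewrite integral_muE; [|exact: mg|exact: g0].
  have Ep : E `<=` pos.
    by move=> x; rewrite /E /= !in_itv/= andbT => /andP[+ _]; exact: lt_le_trans.
  have mp : measurable_fun (E : set RR) (fun x : RR => (x `^ (-1))%:E).
    by apply/measurable_EFinP; apply: measurable_funTS; exact: measurable_powR.
  have p0 (x : RR) : E x -> (0 <= (x `^ (-1))%:E :> \bar R)%E by rewrite lee_fin powR_ge0.
  have DE : (0 <= D%:E)%E by rewrite lee_fin.
  have -> : 2^-1 * ln b = ln 1 - ln z by rewrite ln1 /z ln_powR; ring.
  rewrite -integral_inv_itv// -(ge0_integralZl leb (measurable_itv _) mp p0 DE).
  apply: (@le_trans _ _ (\int[leb]_(x in E) (g x * (x `^ (2 * a + 1))%:E))%E).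
    rewrite le_eqVlt; apply/orP; left; apply/eqP; apply: eq_integral => x xE.
    have Ex : E x by rewrite inE in xE.
    have x0 : 0 < x by have := Ep _ Ex; rewrite /= in_itv/= andbT.
    rewrite /g indicE xE mulr1 -!EFinM; congr EFin; rewrite -[RHS]mulrA -powRD ?(gt_eqF x0) ?implybT//.
    by congr (_ * _ `^ _); rewrite /h; ring.
  apply: ge0_subset_integral; [exact: measurable_itv|exact: measurable_itv| | |exact: Ep].
    apply: measurable_funTS; apply: emeasurable_funM; first exact: mg.
    by apply/measurable_EFinP; exact: measurable_powR.
  by move=> x _; rewrite mule_ge0// lee_fin powR_ge0.
have := le_trans powle (HK b (ltW b1)); rewrite -EFinM lee_fin.
rewrite powRM ?powR_ge0// -powRrM mulNr.
rewrite [leLHS](_ : _ = (c `^ q * (2^-1 * ln b)) * b `^ (- (h * q))); last by ring.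
rewrite ler_pM2r ?powR_gt0// => H.
rewrite ler_pdivlMr ?powR_gt0//.
rewrite [leLHS](_ : _ = 2 * (c `^ q * (2^-1 * ln b))); last by field.
by rewrite ler_pM2l.
Qed.

(** When [s = a + 1], the potential of the normalized Gaussian near the origin is
    at least of order [ln b], the integral of [dt / t] over the times between
    [1 / b] and [1]. *)
Lemma endpoint_unbounded_sup a K : -1 < a ->
  (forall b, 1 <= b -> ('N[mu_ a]_+oo[pot a (a + 1) (gauss b)] <=
    (K * b `^ (- (a + 1)))%:E)%E) -> False.
Proof.
move=> a1 HK; have h0 : 0 < a + 1 by lra.
set h := a + 1 in h0 HK *.
have G0 := Gamma_gt0 h0.
(* For [t >= 1 / b] the factor [1 + 4 b t] is at most [5 b t]. *)
pose c := (Gamma h)^-1 * expR (- 1) * 5 `^ (- h) * expR (- 1).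
have c0 : 0 < c by rewrite !mulr_gt0 ?expR_gt0 ?powR_gt0 ?invr_gt0.
apply: (@ln_unbounded (K / c)) => b b1.
have b0 : 0 < b := lt_trans ltr01 b1.
have lnb0 : 0 < ln b by exact: ln_gt0.
pose z := b `^ (- 2^-1).
have z0 : 0 < z by rewrite powR_gt0.
have zz : b * z ^+ 2 = 1.
  rewrite /z -powR_mulrn ?powR_ge0// -powRrM mulNr mulVf ?pnatr_eq0//.
  by rewrite powR_inv1 ?(ltW b0)// mulfV ?gt_eqF.
have zh : z / 2 < z by rewrite ltr_pdivrMr// mulr_natr mulr2n ltrDl.
pose E : set RR := `[z / 2, z]%classic.
have z2 : 0 < z / 2 by rewrite divr_gt0.
have muE : mu_ a E = ((z `^ (2 * h) - (z / 2) `^ (2 * h)) / (2 * h))%:E.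
  by rewrite /E mu_itv.
have M0 : 0 < (z `^ (2 * h) - (z / 2) `^ (2 * h)) / (2 * h).
  rewrite divr_gt0 ?mulr_gt0// subr_gt0.
  by apply: gt0_ltr_powR; rewrite ?mulr_gt0// nnegrE ltW.
have pot_ge x : E x -> ((c * b `^ (- h) * ln b)%:E <= pot a h (gauss b) x)%E.
  rewrite /E /= in_itv/= => /andP[x1 x2].
  have x0 : 0 < x := lt_le_trans z2 x1.
  have bx1 : b * x ^+ 2 <= 1.
    rewrite -zz ler_pM2l//; apply: lerXn2r; rewrite ?nnegrE ?(ltW x0) ?(ltW z0)//.
  have bx0 : 0 <= b * x ^+ 2 by rewrite mulr_ge0 ?sqr_ge0// ltW.
  rewrite /pot pkernel_gauss ?(ltW b0)// -/h.
  set F := (fun t : RR => (expR (- t) * ((1 + 4 * b * t) `^ (- h) *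
     expR (- (b * x ^+ 2 / (1 + 4 * b * t)))))%:E).
  have F0 (t : RR) : (0 <= F t)%E by rewrite lee_fin !mulr_ge0 ?expR_ge0 ?powR_ge0.
  have bpos w : 0 < w -> 0 < 1 + 4 * b * w by move=> w0; rewrite addr_gt0// !mulr_gt0.
  pose D := expR (- 1) * 5 `^ (- h) * expR (- 1) * b `^ (- h).
  have D0 : 0 <= D by rewrite !mulr_ge0 ?expR_ge0 ?powR_ge0.
  have DE : (0 <= D%:E)%E by rewrite lee_fin.
  have -> : (c * b `^ (- h) * ln b)%:E = ((Gamma h)^-1%:E * (D%:E * (ln b)%:E))%E.
    by rewrite -!EFinM /c /D; congr EFin; ring.
  apply: lee_wpmul2l; first exact: invGamma_ge0.
  have bi0 : 0 < b^-1 by rewrite invr_gt0.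
  have bi1 : b^-1 < 1 by rewrite invf_lt1.
  pose I : set RR := `[b^-1, 1]%classic.
  have Ip : I `<=` pos.
    by move=> t; rewrite /I /= !in_itv/= andbT => /andP[+ _]; exact: lt_le_trans.
  have -> : ln b = ln 1 - ln b^-1 by rewrite ln1 lnV ?posrE// opprK add0r.
  have mp : measurable_fun (I : set RR) (fun x : RR => (x `^ (-1))%:E).
    by apply/measurable_EFinP; apply: measurable_funTS; exact: measurable_powR.
  have p0 (y : RR) : I y -> (0 <= (y `^ (-1))%:E :> \bar R)%E by rewrite lee_fin powR_ge0.
  rewrite -integral_inv_itv// -(ge0_integralZl leb (measurable_itv _) mp p0 DE).
  pose k (t : RR) : \bar R := (D * t `^ (- h) * \1_I t)%:E.
  have mk : measurable_fun (setT : set RR) k.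
    apply/measurable_EFinP; apply: measurable_funM.
      by apply: measurable_funM => //; exact: measurable_powR.
    by apply: measurable_indic; exact: measurable_itv.
  have k0 (t : RR) : (0 <= k t)%E by rewrite lee_fin mulr_ge0// mulr_ge0 ?powR_ge0.
  apply: (@le_trans _ _ (\int[tm h]_t k t)%E); last first.
    apply: le_integral_pos => // t t0; rewrite lee_fin indicE.
    case: (boolP (t \in I)) => [/[!inE]|_]; last first.
      by rewrite mulr0 !mulr_ge0 ?expR_ge0 ?powR_ge0.
    rewrite /I /= in_itv/= => /andP[bt t1]; rewrite mulr1.
    have bt1 : 1 <= b * t by rewrite -ler_pdivrMl// mulr1.
    have E2 : (5 * (b * t)) `^ (- h) = 5 `^ (- h) * (b `^ (- h) * t `^ (- h)).
      by rewrite !powRM ?mulr_ge0 ?(ltW b0) ?(ltW t0).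
    have -> : D * t `^ (- h) = expR (- 1) * ((5 * (b * t)) `^ (- h) * expR (- 1)).
      by rewrite E2 /D; ring.
    apply: ler_pM; rewrite ?expR_ge0 ?mulr_ge0 ?expR_ge0 ?powR_ge0//.
      by rewrite ler_expR lerN2.
    apply: ler_pM; rewrite ?expR_ge0 ?powR_ge0//.
      rewrite !powRN lef_pV2 ?posrE ?powR_gt0 ?bpos ?mulr_gt0//.
      apply: ge0_ler_powR; rewrite ?nnegrE ?(ltW h0) ?(ltW (bpos _ t0)) ?mulr_ge0 ?(ltW b0) ?(ltW t0)//.
      by move: bt1; rewrite -mulrA; lra.
    rewrite ler_expR lerN2 ler_pdivrMr ?bpos// mul1r.
    by apply: (le_trans bx1); rewrite lerDl !mulr_ge0// ltW.
  rewrite integral_tm; [|exact: mk|exact: k0].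
  apply: (@le_trans _ _ (\int[leb]_(t in I) (k t * (t `^ (h - 1))%:E))%E).
    rewrite le_eqVlt; apply/orP; left; apply/eqP; apply: eq_integral => t tI.
    have It : I t by rewrite inE in tI.
    have t0 : 0 < t by have := Ip _ It; rewrite /= in_itv/= andbT.
    rewrite /k indicE tI mulr1 -!EFinM; congr EFin; rewrite -[RHS]mulrA -powRD ?(gt_eqF t0) ?implybT//.
    by congr (_ * _ `^ _); ring.
  apply: ge0_subset_integral; [exact: measurable_itv|exact: measurable_itv| | |exact: Ip].
    apply: measurable_funTS; apply: emeasurable_funM; first exact: mk.
    by apply/measurable_EFinP; exact: measurable_powR.
  by move=> t _; rewrite mule_ge0// lee_fin powR_ge0.
have cbl0 : 0 < c * b `^ (- h) * ln b := mulr_gt0 (mulr_gt0 c0 (powR_gt0 _ b0)) lnb0.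
have := @Lnorm_indic_ge R a +oo E _ _ a1 (leey _) cbl0 (measurable_itv _) muE
  M0 _ (fun x => pot_ge0 a h x (gauss_ge0 b)) pot_ge.
rewrite rinv_y powRr0 mulr1 => /le_trans /(_ (HK b (ltW b1))); rewrite lee_fin.
rewrite mulrAC ler_pM2r ?powR_gt0// => H.
by rewrite ler_pdivlMr// mulrC.
Qed.

End endpoint.

(** * Locality and decay of the measure *)
Section locality.
Context {R : realType}.
Implicit Types (a s t x y b c e r u v K N : R) (p q : \bar R).
Local Notation leb := (@lebesgue_measure R).
Local Notation RR := (measurableTypeR R).
Local Notation tm s := (mu_ (s / 2 - 1)).

(** If [|y - x| >= 22], then [y ^ 2 - x ^ 2] is at least [22 x] in absolute value,
    so that one of the two exponentials [exp (+- (y ^ 2 - x ^ 2) / x)] compensates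
    for [exp (- 22)]. *)
Lemma two_sided_cutoff x y : 44 <= x -> 0 < y ->
  1 <= \1_(`[x - 22, x + 22]%classic : set R) y +
     expR (- 22) * (expR (- x) * expR (- (- x^-1 * y ^+ 2)) + expR x * expR (- (x^-1 * y ^+ 2))).
Proof.
move=> x44 y0; have x0 : 0 < x by lra.
have xn0 : x != 0 by rewrite gt_eqF.
rewrite indicE; case: (boolP (y \in _)) => [_|].
  by rewrite lerDl mulr_ge0 ?expR_ge0// addr_ge0// mulr_ge0 ?expR_ge0.
rewrite notin_setE /= in_itv/= => yn; rewrite add0r mulrDr -!expRD.
have [y1|y1] := ltP y (x - 22).
  apply: (@le_trans _ _ (expR (- 22 + (x + - (x^-1 * y ^+ 2))))); last by rewrite lerDr expR_ge0.
  rewrite -[leLHS]expR0 ler_expR.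
  have : y ^+ 2 <= x * (x - 22).
    rewrite expr2; apply: ler_pM; lra.
  rewrite -ler_pdivrMl// => H; lra.
have y2 : x + 22 < y.
  by rewrite ltNge; apply/negP => y2; apply: yn; rewrite y1 y2.
apply: (@le_trans _ _ (expR (- 22 + (- x + - (- x^-1 * y ^+ 2))))); last by rewrite lerDl expR_ge0.
rewrite -[leLHS]expR0 ler_expR mulNr opprK.
have : x * (x + 22) <= y ^+ 2.
  rewrite expr2; apply: ler_pM; lra.
rewrite -ler_pdivlMl// => H; lra.
Qed.

(** A Chernoff bound for [y ^ 2]: its exponential moments, with parameters
    [1 / x] and [- 1 / x], are given by the Gaussian identity. *)
Lemma heat_local a t x : -1 < a -> a <= 0 -> 1 <= t -> t <= 2 -> 64 <= x ->
  ((2^-1)%:E <= \int[mu_ a]_y (heat_series a t x y *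
      (\1_(`[x - 22, x + 22]%classic : set R) y)%:E))%E.
Proof.
move=> a1 a0 t1 t2 x64.
have x0 : 0 < x by lra.
have t0 : 0 < t by lra.
have xn0 : x != 0 by rewrite gt_eqF.
set I : RR -> R := fun y => \1_(`[x - 22, x + 22]%classic : set R) y.
have mI : measurable_fun (setT : set RR) I by apply: measurable_indic; exact: measurable_itv.
have I0 (y : RR) : 0 <= I y by rewrite /I.
have mh : measurable_fun (setT : set RR) (heat_series a t x).
  by apply: measurable_heat_series.
have h0 y := heat_series_ge0 a t x y.
have mg b : measurable_fun (setT : set RR) (fun y => (expR (- (b * y ^+ 2)))%:E).
  by apply/measurable_EFinP; exact: measurable_gauss.
pose c1 := expR (- 22) * expR (- x).
pose c2 := expR (- 22) * expR x.
have c10 : (0 <= c1%:E)%E by rewrite lee_fin mulr_ge0 ?expR_ge0.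
have c20 : (0 <= c2%:E)%E by rewrite lee_fin mulr_ge0 ?expR_ge0.
pose G b y := ((expR (- (b * y ^+ 2)))%:E * heat_series a t x y)%E.
have mG b : measurable_fun (setT : set RR) (G b) by apply: emeasurable_funM; [exact: mg|exact: mh].
have G0 b (y : RR) : setT y -> (0 <= G b y)%E.
  by move=> _; rewrite mule_ge0// lee_fin expR_ge0.
(* As [d <= 1/8], the exponents left after the Gaussian identity are at most
   [- 22 + 16]. *)
set d := 4 * t / x.
have d0 : 0 <= d by rewrite divr_ge0 ?mulr_ge0// ltW.
have d8 : d <= 8^-1.
  by rewrite /d ler_pdivrMr//; lra.
have D1 : 1 + 4 * - x^-1 * t = 1 - d by rewrite /d; ring.
have D2 : 1 + 4 * x^-1 * t = 1 + d by rewrite /d; ring.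
have D1p : 0 < 1 - d by lra.
have D2p : 0 < 1 + d by lra.
have xd : x * d = 4 * t by rewrite /d; field.
have key : (1 <= \int[mu_ a]_y (heat_series a t x y * (I y)%:E) +
    (c1%:E * \int[mu_ a]_y G (- x^-1)%R y + c2%:E * \int[mu_ a]_y G (x^-1)%R y))%E.
  rewrite -(heat_series_total x a1 t0).
  rewrite -(ge0_integralZl (mu_ a) measurableT (mG _) (G0 _) c10).
  rewrite -(ge0_integralZl (mu_ a) measurableT (mG _) (G0 _) c20).
  have m1 : measurable_fun (setT : set RR) (fun y => (c1%:E * G (- x^-1)%R y)%E) by exact: measurable_funeM.
  have m2 : measurable_fun (setT : set RR) (fun y => (c2%:E * G (x^-1)%R y)%E) by exact: measurable_funeM.
  have p1 (y : RR) : setT y -> (0 <= c1%:E * G (- x^-1)%R y)%E by move=> ?; rewrite mule_ge0// G0.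
  have p2 (y : RR) : setT y -> (0 <= c2%:E * G (x^-1)%R y)%E by move=> ?; rewrite mule_ge0// G0.
  rewrite -(ge0_integralD (mu_ a) measurableT p1 m1 p2 m2).
  have m3 : measurable_fun (setT : set RR) (fun y => (heat_series a t x y * (I y)%:E)%E).
    exact: measurable_heat_mul.
  have p3 (y : RR) : setT y -> (0 <= heat_series a t x y * (I y)%:E)%E.
    by move=> _; exact: heat_mul_ge0.
  have p12 (y : RR) : setT y -> (0 <= c1%:E * G (- x^-1)%R y + c2%:E * G (x^-1)%R y)%E.
    by move=> ?; rewrite adde_ge0// ?p1 ?p2.
  rewrite -(ge0_integralD (mu_ a) measurableT p3 m3 p12 (emeasurable_funD m1 m2)).
  apply: le_integral_pos => [y|y|y y0]; [exact: h0|by rewrite adde_ge0 ?p3 ?p12|].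
  have x44 : 44 <= x by lra.
  have := two_sided_cutoff x44 y0; rewrite -lee_fin => cut1.
  rewrite -[leLHS]mule1; apply: (le_trans (lee_wpmul2l (h0 y) cut1)).
  have e0 u : (0 <= (expR u)%:E :> \bar R)%E by rewrite lee_fin expR_ge0.
  have i0 : (0 <= (I y)%:E)%E by rewrite lee_fin.
  rewrite mulrDr !mulrA -/c1 -/c2 EFinD ge0_muleDr//; last first.
    by rewrite lee_fin addr_ge0// mulr_ge0 ?expR_ge0.
  apply: leeD; first by [].
  rewrite EFinD ge0_muleDr ?lee_fin ?mulr_ge0 ?expR_ge0//.
  rewrite le_eqVlt; apply/orP; left; apply/eqP; congr (_ + _)%E.
    by rewrite /G (EFinM c1) muleCA (muleC (heat_series _ _ _ _)) expr2 mulrA.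
  by rewrite /G (EFinM c2) muleCA (muleC (heat_series _ _ _ _)) expr2 mulrA.
have B1 : (c1%:E * \int[mu_ a]_y G (- x^-1)%R y <= (2 * expR (- 6))%:E)%E.
  rewrite /G heat_series_gauss ?D1// -EFinM lee_fin /c1.
  rewrite mulrCA; apply: ler_pM; rewrite ?powR_ge0 ?mulr_ge0 ?expR_ge0//.
    rewrite powRN -[leRHS]invrK lef_pV2 ?posrE ?invr_gt0 ?powR_gt0//.
    apply: (@le_trans _ _ (1 - d)); first by lra.
    by apply: ger1_powR; [apply/andP; split; lra|lra].
  rewrite -!expRD ler_expR.
  have -> : - (- x^-1 * x ^+ 2 / (1 - d)) = x / (1 - d).
    by rewrite expr2; field; rewrite xn0 gt_eqF.
  have -> : x / (1 - d) = x + 4 * t / (1 - d).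
    by rewrite -xd; field; rewrite gt_eqF.
  suff : 4 * t / (1 - d) <= 16 by lra.
  by rewrite ler_pdivrMr//; lra.
have B2 : (c2%:E * \int[mu_ a]_y G (x^-1)%R y <= (expR (- 6))%:E)%E.
  rewrite /G heat_series_gauss ?D2// -EFinM lee_fin /c2.
  rewrite mulrCA -[leRHS]mul1r; apply: ler_pM; rewrite ?powR_ge0 ?mulr_ge0 ?expR_ge0//.
    rewrite powRN invf_le1 ?powR_gt0//.
    by rewrite -[leLHS](powRr0 (1 + d)); apply: ler_powR; lra.
  rewrite -!expRD ler_expR.
  have -> : - (x^-1 * x ^+ 2 / (1 + d)) = - (x / (1 + d)).
    by rewrite expr2; field; rewrite xn0 gt_eqF.
  have -> : x / (1 + d) = x - 4 * t / (1 + d).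
    by rewrite -xd; field; rewrite gt_eqF.
  suff : 4 * t / (1 + d) <= 16 by lra.
  by rewrite ler_pdivrMr//; lra.
have small : 2 * expR (- 6) + expR (- 6) <= 2^-1 :> R.
  rewrite expRN; have e6 := expR_ge1Dx (6 : R).
  have e60 : 0 < expR (6 : R) by exact: expR_gt0.
  have : (expR (6 : R))^-1 <= 6^-1 by rewrite lef_pV2 ?posrE//; lra.
  lra.
have {}key := le_trans key (leeD2l _ (leeD B1 B2)).
have {}key : (1 <= \int[mu_ a]_y (heat_series a t x y * (I y)%:E) + (2^-1)%:E)%E.
  apply: (le_trans key); apply: leeD2l; by rewrite -EFinD lee_fin.
move: key; rewrite -leeBlDr// -EFinB.
by have -> : 1 - 2^-1 = 2^-1 :> R by field.
Qed.

(** The times between [1] and [2] suffice; the interval is widened to serve all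
    [x] in [[N, N + 1]] at once. *)
Lemma pot_local a s N x : -1 < a -> a <= 0 -> 0 < s -> 64 <= N -> N <= x -> x <= N + 1 ->
  (((Gamma s)^-1 * (expR (- 2) / 2 * ((2 `^ s - 1) / s)))%:E <=
    pot a s (\1_(`[(N - 22)%R, (N + 23)%R]%classic : set R)) x)%E.
Proof.
move=> a1 a0 s0 N64 Nx xN.
pose f : RR -> R := \1_(`[N - 22, N + 23]%classic : set R).
have mf : measurable_fun (setT : set RR) f by apply: measurable_indic; exact: measurable_itv.
have f0 (y : RR) : 0 <= f y by rewrite /f.
have mfE : measurable_fun (setT : set RR) (fun y => (f y)%:E) by exact/measurable_EFinP.
have fE0 (y : RR) : (0 <= (f y)%:E)%E by rewrite lee_fin.
rewrite /pot (@integral_pkernel R a s (fun y => (f y)%:E) x mfE fE0) EFinM.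
apply: lee_wpmul2l; first exact: invGamma_ge0.
set k := expR (- 2) / 2.
have k0 : 0 <= k by rewrite divr_ge0 ?expR_ge0.
set I : set RR := `[1, 2]%classic.
have muI : (tm s) I = ((2 `^ s - 1) / s)%:E.
  rewrite /I mu_itv//; [|by lra|by rewrite ltr1n].
  have -> : 2 * (s / 2 - 1 + 1) = s by field.
  by rewrite powR1.
have mI : measurable_fun (setT : set RR) (fun t : RR => (\1_I t : R)%:E).
  by apply/measurable_EFinP; apply: measurable_indic; exact: measurable_itv.
have I0 (t : RR) : setT t -> (0 <= (\1_I t)%:E :> \bar R)%E by rewrite lee_fin.
have kE : (0 <= k%:E)%E by rewrite lee_fin.
rewrite EFinM -muI.
have -> : (tm s) I = (\int[tm s]_t (\1_I t)%:E)%E.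
  by rewrite integral_indic ?setIT//; exact: measurable_itv.
rewrite -(ge0_integralZl (tm s) measurableT mI I0 kE).
have J0 (t : RR) : (0 <= \int[mu_ a]_y (heat_series a t x y * (f y)%:E))%E.
  by apply: integral_ge0 => y _; exact: heat_mul_ge0.
apply: le_integral_pos => [t|t|t t0].
- by rewrite mule_ge0// lee_fin.
- by rewrite mule_ge0// lee_fin expR_ge0.
rewrite indicE; case: (boolP (t \in I)) => [/[!inE]|_]; last first.
  by rewrite mule0 mule_ge0// lee_fin expR_ge0.
rewrite /I /= in_itv/= => /andP[t1 t2]; rewrite mule1 /k EFinM.
apply: lee_pmul; rewrite ?lee_fin ?expR_ge0// ?ler_expR ?lerN2//.
apply: (le_trans (heat_local a1 a0 t1 t2 (le_trans N64 Nx))).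
apply: ge0_le_integral => //.
- by move=> y _; rewrite mule_ge0 ?heat_series_ge0// lee_fin.
- by apply: measurable_heat_mul; apply: measurable_indic; exact: measurable_itv.
- exact: measurable_heat_mul.
move=> y _; apply: lee_wpmul2l; first exact: heat_series_ge0.
rewrite lee_fin /f !indicE ler_nat.
case: (boolP (y \in _)) => // /[!inE] /=; rewrite in_itv/= => /andP[y1 y2].
by rewrite mem_set//= in_itv/=; apply/andP; split; lra.
Qed.

(** For [a <= -1/2] the density is nonincreasing. *)
Lemma mu_itv_bounds a u v : -1 < a -> a <= - (1 / 2) -> 0 < u -> u < v ->
  exists M : R, [/\ mu_ a `[u, v]%classic = M%:E,
    (v - u) * v `^ (2 * a + 1) <= M & M <= (v - u) * u `^ (2 * a + 1)].
Proof.
move=> a1 a2 u0 uv; have v0 := lt_trans u0 uv.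
eexists; split; first exact: mu_itv.
- rewrite -lee_fin -mu_itv//= /mu_ setIidl; last first.
    by move=> x /=; rewrite !in_itv/= andbT => /andP[+ _]; exact: lt_le_trans.
  apply: (@le_trans _ _ (\int[leb]_(x in `[u, v]) (cst (v `^ (2 * a + 1))%:E x))%E).
    rewrite integral_cst//= lebesgue_measure_itv/= lte_fin uv.
    by rewrite -EFinB -EFinM lee_fin mulrC.
  apply: ge0_le_integral => //.
  + by move=> x _; rewrite lee_fin powR_ge0.
  + by apply/measurable_EFinP; apply: measurable_funTS; exact: measurable_powR.
  + move=> x /=; rewrite in_itv/= => /andP[ux xv]; rewrite lee_fin.
    have x0 := lt_le_trans u0 ux.
    rewrite -(opprK (2 * a + 1)) !(powRN _ (- _)) lef_pV2 ?posrE ?powR_gt0//.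
    by apply: ge0_ler_powR; rewrite ?nnegrE ?(ltW x0) ?(ltW v0)//; lra.
- rewrite -lee_fin -mu_itv//= /mu_ setIidl; last first.
    by move=> x /=; rewrite !in_itv/= andbT => /andP[+ _]; exact: lt_le_trans.
  apply: (@le_trans _ _ (\int[leb]_(x in `[u, v]) (cst (u `^ (2 * a + 1))%:E x))%E); last first.
    rewrite integral_cst//= lebesgue_measure_itv/= lte_fin uv.
    by rewrite -EFinB -EFinM lee_fin mulrC.
  apply: ge0_le_integral => //.
  + by move=> x _; rewrite lee_fin powR_ge0.
  + by apply/measurable_EFinP; apply: measurable_funTS; exact: measurable_powR.
  + move=> x /=; rewrite in_itv/= => /andP[ux xv]; rewrite lee_fin.
    have x0 := lt_le_trans u0 ux.
    rewrite -(opprK (2 * a + 1)) !(powRN _ (- _)) lef_pV2 ?posrE ?powR_gt0//.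
    by apply: ge0_ler_powR; rewrite ?nnegrE ?(ltW x0) ?(ltW u0)//; lra.
Qed.

Lemma Lnorm_indic_le a p (E : set RR) M : (1 <= p)%E -> measurable E ->
  mu_ a E = M%:E -> ('N[mu_ a]_p[EFin \o \1_E] <= (M `^ rinv p)%:E)%E.
Proof.
move=> p1 mE ME; case: p p1 => [r r1|_|//].
  have r0 : 0 < r by exact: lt_le_trans ltr01 r1.
  rewrite rinv_real ?gt_eqF// Lnorm_realE.
  rewrite [X in (X `^ _ <= _)%E](_ : _ = M%:E) ?poweR_EFin//.
  transitivity (\int[mu_ a]_x (\1_E x)%:E)%E; last by rewrite integral_indic// setIT.
  apply: eq_integral => x _.
  rewrite /comp abse_EFin ger0_norm// poweR_EFin; congr EFin; rewrite indicE.
  by case: (_ \in _); rewrite ?powR1// powR0 ?gt_eqF.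
rewrite rinv_y powRr0; apply: Lnormy_le => // [x|x x0]; rewrite lee_fin//; by rewrite indicE lern1 leq_b1.
Qed.

(** Up to constants, the inequality for the indicator of an interval around [N]
    reads [N ^ (e / q) <= N ^ (e / p)] with [e = 2 a + 1 < 0]. *)
Lemma bounded_local a s p q : -1 < a -> a < - (1 / 2) -> 0 < s ->
  (1 <= p)%E -> (1 <= q)%E -> potential_bounded a s p q -> rinv p <= rinv q.
Proof.
move=> a1 a2 s0 p1 q1 PB.
have [C C0 HC] := bounded_pot a1 q1 PB.
have a0 : a <= 0 by lra.
have a2' : a <= - (1 / 2) by exact: ltW.
have G0 := Gamma_gt0 s0.
set c0 := (Gamma s)^-1 * (expR (- 2) / 2 * ((2 `^ s - 1) / s)).
have c00 : 0 < c0.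
  rewrite !mulr_gt0 ?invr_gt0 ?expR_gt0// subr_gt0.
  have := @gt0_ltr_powR R s s0 1 2; rewrite powR1; apply.
  - by rewrite nnegrE.
  - by rewrite nnegrE.
  - by rewrite ltr1n.
set e := 2 * a + 1.
have e0 : e < 0 by rewrite /e; lra.
have ip0 := rinv_ge0 p1; have iq0 := rinv_ge0 q1.
suff : e * (rinv q - rinv p) <= 0 by rewrite nmulr_rle0// subr_ge0.
apply: (@powR_bounded _ _ (C * (45 `^ rinv p * (2^-1) `^ (e * rinv p)) /
   (c0 * 2 `^ (e * rinv q))) 64); first by rewrite ler1n.
move=> N N64.
have N0 : 0 < N by lra.
have [M1 [E1 M1l _]] : exists M : R, [/\ mu_ a `[N, N + 1]%classic = M%:E,
    (N + 1 - N) * (N + 1) `^ e <= M & M <= (N + 1 - N) * N `^ e].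
  by apply: mu_itv_bounds => //; rewrite ltrDl.
have [M2 [E2 M2l M2u]] : exists M : R, [/\ mu_ a `[N - 22, N + 23]%classic = M%:E,
    (N + 23 - (N - 22)) * (N + 23) `^ e <= M & M <= (N + 23 - (N - 22)) * (N - 22) `^ e].
  by apply: mu_itv_bounds => //; lra.
have dec u v : 0 < u -> u <= v -> v `^ e <= u `^ e.
  move=> u0 uv; have v0 := lt_le_trans u0 uv.
  rewrite -(opprK e) !(powRN _ (- _)) lef_pV2 ?posrE ?powR_gt0//.
  by apply: ge0_ler_powR; rewrite ?nnegrE ?(ltW u0) ?(ltW v0)//; lra.
have M1b : (2 * N) `^ e <= M1.
  apply: le_trans M1l; rewrite addrAC subrr add0r mul1r; apply: dec; lra.
have M2b : M2 <= 45 * (N / 2) `^ e.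
  apply: (le_trans M2u); rewrite (_ : N + 23 - (N - 22) = 45); last by ring.
  by rewrite ler_pM2l//; apply: dec; lra.
have M10 : 0 < M1 by apply: lt_le_trans M1b; rewrite powR_gt0// mulr_gt0.
have M20 : 0 <= M2.
  by apply: le_trans M2l; rewrite mulr_ge0 ?powR_ge0//; lra.
pose f : RR -> R := \1_(`[N - 22, N + 23]%classic : set R).
have mf : measurable_fun (setT : set RR) f by apply: measurable_indic; exact: measurable_itv.
have f0 (y : RR) : 0 <= f y by rewrite /f.
have fN := Lnorm_indic_le p1 (measurable_itv _) E2.
have up := HC f mf f0 (le_lt_trans fN (ltry _)).
have pot_ge x : (`[N, N + 1]%classic : set RR) x -> (c0%:E <= pot a s f x)%E.
  by rewrite /= in_itv/= => /andP[Nx xN]; exact: pot_local.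
have lo := Lnorm_indic_ge a1 q1 c00 (measurable_itv _) E1 M10
  (fun x => pot_ge0 a s x f0) pot_ge.
have := le_trans lo (le_trans up (lee_wpmul2l (_ : 0 <= C%:E)%E fN)).
rewrite lee_fin => /(_ (ltW C0)); rewrite -EFinM lee_fin => H.
have M1c : 2 `^ (e * rinv q) * N `^ (e * rinv q) <= M1 `^ rinv q.
  rewrite !powRrM -powRM ?powR_ge0// -powRM ?(ltW N0)//.
  by apply: ge0_ler_powR; rewrite ?nnegrE ?powR_ge0 ?(ltW M10).
have M2c : M2 `^ rinv p <= 45 `^ rinv p * ((2^-1) `^ (e * rinv p) * N `^ (e * rinv p)).
  rewrite !powRrM -powRM ?powR_ge0// -powRM ?mulr_ge0 ?powR_ge0//.
  rewrite -powRM ?invr_ge0 ?(ltW N0)//; apply: ge0_ler_powR; rewrite ?nnegrE ?mulr_ge0 ?powR_ge0//.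
  by rewrite (mulrC 2^-1).
have {}H : c0 * (2 `^ (e * rinv q) * N `^ (e * rinv q)) <=
    C * (45 `^ rinv p * ((2^-1) `^ (e * rinv p) * N `^ (e * rinv p))).
  apply: (le_trans _ (le_trans H _)); first by rewrite ler_pM2l.
  by rewrite ler_pM2l.
rewrite mulrBr powRD ?(gt_eqF N0) ?implybT// powRN ler_pdivrMr ?powR_gt0//.
have c20 : 0 < c0 * 2 `^ (e * rinv q) by rewrite pmulr_rgt0// powR_gt0.
rewrite mulrAC ler_pdivlMr//.
by rewrite mulrC -[leLHS]mulrA -[X in _ <= X]mulrA -[X in _ <= _ * X]mulrA.
Qed.

End locality.

(** * Unboundedness at the corners *)
Section endpoint_exclusion.
Context {R : realType}.
Implicit Types (a s t x y b c e r u v K N : R) (p q : \bar R).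
Local Notation RR := (measurableTypeR R).

(** In [L^1] the Gaussian [exp (- b y ^ 2)] has norm of order [b ^ (- (a + 1))], and
    its potentials would contradict [endpoint_unbounded] or
    [endpoint_unbounded_sup]. *)
Lemma not_bounded_from_L1 a s q : -1 < a -> 0 < s -> (1 <= q)%E ->
  rinv q = 1 - s / (a + 1) -> ~ potential_bounded a s 1 q.
Proof.
move=> a1 s0 q1 qs PB; have h0 : 0 < a + 1 by lra.
have [C C0 HC] := bounded_pot a1 q1 PB.
have [K K0 HK] := gauss_norm_le a1 (lexx 1%E).
have r1 : rinv (1%E : \bar R) = 1 by rewrite rinv_real ?invr1 ?oner_eq0.
have {HK}HK b : 0 < b -> ('N[mu_ a]_1[EFin \o gauss b] <= (K * b `^ (- (a + 1)))%:E)%E.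
  by move=> b0; have := HK b b0; rewrite r1 mulr1.
have CK b : 0 < b -> ('N[mu_ a]_q[pot a s (gauss b)] <= (C * K * b `^ (- (a + 1)))%:E)%E.
  move=> b0; apply: (le_trans (HC _ (measurable_gauss b) (gauss_ge0 b) _)).
    exact: le_lt_trans (HK b b0) (ltry _).
  rewrite -mulrA EFinM; apply: lee_wpmul2l; [by rewrite lee_fin ltW|exact: HK].
have CK0 : 0 <= C * K by rewrite mulr_ge0// ltW.
case: q q1 qs CK {PB HC} => [q|_|//]; last first.
  rewrite rinv_y => /eqP; rewrite eq_sym subr_eq0 eq_sym => /eqP sh CK.
  have {}sh : s = a + 1 by rewrite -(divfK (lt0r_neq0 h0) s) sh mul1r.
  apply: (@endpoint_unbounded_sup _ a (C * K) a1) => b b1; rewrite -sh [in leRHS]sh.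
  exact/CK/(lt_le_trans ltr01 b1).
rewrite lee_fin => q1; have q0 := lt_le_trans ltr01 q1.
rewrite rinv_real ?gt_eqF// => qs CK.
have sh : s < a + 1.
  by rewrite -(mul1r (a + 1)) -ltr_pdivrMr// -subr_gt0 -qs invr_gt0.
have qE : q = (a + 1) / (a + 1 - s).
  rewrite -[LHS]invrK qs -[RHS]invf_div; congr (_^-1).
  by rewrite mulrBl divff ?gt_eqF.
apply: (@endpoint_unbounded _ a s (C * K) a1 s0 sh CK0) => b b1; rewrite -qE.
have b0 := lt_le_trans ltr01 b1.
have := poweR_Lnorm (mu_ a) (pot a s (gauss b)) (lt0r_neq0 q0).
rewrite [X in _ = X -> _](_ : _ = \int[mu_ a]_x (pot a s (gauss b) x `^ q))%E; last first.
  by apply: eq_integral => x _; rewrite gee0_abs// pot_ge0//; exact: gauss_ge0.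
move=> <-; rewrite -poweR_EFin.
apply: gt0_ler_poweR; rewrite ?(ltW q0)// ?in_itv/= ?leey ?andbT ?Lnorm_ge0 ?lee_fin//.
  by rewrite (mulr_ge0 CK0) ?powR_ge0.
exact: CK.
Qed.

(** Dual to [not_bounded_from_L1]: testing against [g] in [L^p], a bound into
    [L^oo] controls [int g (pot G)], which is [int G (pot g)], by the [L^1] norm
    of the Gaussian [G]. *)
Lemma not_bounded_to_Loo a s p : -1 < a -> 0 < s -> (1 <= p)%E ->
  rinv p = s / (a + 1) -> ~ potential_bounded a s p +oo.
Proof.
move=> a1 s0 p1 ps PB; have h0 : 0 < a + 1 by lra.
case: p p1 ps PB => [p|_|//]; last first.
  by rewrite rinv_y => /esym/eqP; rewrite gt_eqF// divr_gt0.
rewrite lee_fin => p1; have p0 := lt_le_trans ltr01 p1.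
rewrite rinv_real ?gt_eqF// => ps PB.
have [C C0 HC] := bounded_pot a1 (leey _) PB.
move: p1; rewrite le_eqVlt => /predU1P[p1|p1].
  apply: (@not_bounded_from_L1 a s +oo a1 s0 (leey _)); last by rewrite p1.
  by rewrite rinv_y -ps -p1 invr1 subrr.
have sh : s < a + 1.
  by rewrite -(mul1r (a + 1)) -ltr_pdivrMr// -ps invf_lt1.
have hs0 : 0 < a + 1 - s by rewrite subr_gt0.
set q := (a + 1) / (a + 1 - s).
have q1 : 1 < q by rewrite ltr_pdivlMr// mul1r; lra.
have qp : q^-1 + p^-1 = 1.
  by rewrite ps /q invf_div -mulrDl subrK divff ?gt_eqF.
set G := Gamma (a + 1) / 2.
have G0 : 0 < G by rewrite divr_gt0// Gamma_gt0.
apply: (@endpoint_unbounded _ a s (C * G) a1 s0 sh (mulr_ge0 (ltW C0) (ltW G0))).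
move=> b b1; have b0 := lt_le_trans ltr01 b1; rewrite -/q.
have cb : 0 <= C * G * b `^ (- (a + 1)).
  by rewrite (mulr_ge0 (mulr_ge0 (ltW C0) (ltW G0))) ?powR_ge0.
apply: (dual_Lp_bound q1 qp cb) => [|x|g mg g0 gp].
- exact: (measurable_pot a s (measurable_gauss b) (gauss_ge0 b)).
- exact: (pot_ge0 a s x (gauss_ge0 b)).
rewrite (pot_adjoint _ _ (measurable_gauss b) (gauss_ge0 b) mg g0).
have gN : ('N[mu_ a]_p%:E[EFin \o g] <= 1)%E.
  apply: (Lnorm_le_real p0 ler01) => [x|]; first by rewrite lee_fin.
  by rewrite powR1.
have := HC g mg g0 (le_lt_trans gN (ltry _)).
move=> /le_trans/(_ (lee_wpmul2l (_ : 0 <= C%:E)%E gN)); rewrite lee_fin => /(_ (ltW C0)).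
rewrite mule1 (LnormyE _ a1) => /ess_supP gC.
have -> : (C * G * b `^ (- (a + 1)))%:E = (C%:E * \int[mu_ a]_y (gauss b y)%:E)%E.
  by rewrite gauss_integral// -EFinM /G; congr EFin; ring.
have gE0 (y : RR) : setT y -> (0 <= (gauss b y)%:E)%E by rewrite lee_fin gauss_ge0.
have mgE : measurable_fun (setT : set RR) (fun y => (gauss b y)%:E).
  by apply/measurable_EFinP; exact: measurable_gauss.
have CE : (0 <= C%:E)%E by rewrite lee_fin ltW.
rewrite -(ge0_integralZl (mu_ a) measurableT mgE gE0 CE).
have mpot : measurable_fun (setT : set RR) (pot a s g) by exact: measurable_pot.
apply: ae_ge0_le_integral => //.
- by move=> y _; rewrite mule_ge0 ?pot_ge0// lee_fin gauss_ge0.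
- exact: emeasurable_funM.
- by move=> y _; rewrite mule_ge0// lee_fin gauss_ge0.
- exact: measurable_funeM.
apply: ae_mono gC => y /= gy _; rewrite muleC; apply: lee_wpmul2r.
  by rewrite lee_fin gauss_ge0.
by move: gy; rewrite gee0_abs// pot_ge0.
Qed.

End endpoint_exclusion.

(** * The admissible exponents *)
Section assembly.
Context {R : realType}.
Implicit Types (a s t x y b c e r u v K N : R) (p q : \bar R).

Lemma strong_bound_range a s p q : - (1 / 2) <= a -> 0 < s ->
  (1 <= p)%E -> (1 <= q)%E ->
  rinv p - s / (a + 1) <= rinv q -> rinv q <= rinv p ->
  ~ (rinv p = s / (a + 1) /\ rinv q = 0) ->
  ~ (rinv p = 1 /\ rinv q = 1 - s / (a + 1)) ->
  strong_bound a s p q.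
Proof.
move=> a2 s0; have a1 : -1 < a by lra.
have h0 : 0 < a + 1 by lra.
move=> p1 q1; case: q q1 => [q|_|//]; last first.
  case: p p1 => [p|_|//]; last by move=> *; exact: strong_bound_yy.
  rewrite lee_fin => p1; have p0 := lt_le_trans ltr01 p1.
  rewrite rinv_y rinv_real ?gt_eqF// subr_le0 => ps _ nps _.
  apply: strong_bound_py => //; rewrite mulrC -ltr_pdivlMr// lt_neqAle ps andbT.
  by apply/eqP => pse; apply: nps.
case: p p1 => [p|_|//]; last first.
  move=> q1; rewrite lee_fin in q1; have q0 := lt_le_trans ltr01 q1.
  by rewrite rinv_y rinv_real ?gt_eqF// => _; rewrite leNgt invr_gt0 q0.
move=> p1 q1; rewrite !lee_fin in p1 q1; have p0 := lt_le_trans ltr01 p1.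
have q0 := lt_le_trans ltr01 q1.
rewrite !rinv_real ?gt_eqF// => pqs; rewrite lef_pV2 ?posrE// => pq _.
move: pq; rewrite le_eqVlt => /predU1P[<- _|pq nqs].
  move: p1; rewrite le_eqVlt => /predU1P[<-|p1]; first exact: strong_bound_11.
  exact: strong_bound_pp.
move: p1; rewrite le_eqVlt => /predU1P[p1|p1]; last by apply: strong_bound_pq => //; lra.
subst p; have qn0 : q != 0 by rewrite gt_eqF.
have q10 : q - 1 != 0 by rewrite subr_eq0 gt_eqF.
apply: (@strong_bound_1q _ a s q (q / (q - 1))) => //; first by field; rewrite qn0 q10.
rewrite invf_div mulrC -ltr_pdivlMr// mulrBl mul1r divff// lt_neqAle.
move: pqs nqs; rewrite invr1 => pqs nqs; apply/andP; split; last by lra.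
by apply/eqP => e; apply: nqs; split => //; lra.
Qed.

Lemma rinv_inj p q : (1 <= p)%E -> (1 <= q)%E -> rinv p = rinv q -> p = q.
Proof.
case: p => [p||]; case: q => [q||] //; rewrite ?lee_fin.
- move=> p1 q1; rewrite !rinv_real ?gt_eqF ?(lt_le_trans ltr01)//.
  by move=> /invr_inj ->.
- move=> p1 _; rewrite rinv_y rinv_real ?gt_eqF ?(lt_le_trans ltr01)// => /eqP.
  by rewrite invr_eq0 gt_eqF// (lt_le_trans ltr01).
- move=> _ q1; rewrite rinv_y rinv_real ?gt_eqF ?(lt_le_trans ltr01)// => /esym/eqP.
  by rewrite invr_eq0 gt_eqF// (lt_le_trans ltr01).
Qed.

Lemma strong_bound_diag a s p : -1 < a -> 0 < s -> (1 <= p)%E -> strong_bound a s p p.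
Proof.
move=> a1 s0; case: p => [p|_|//]; last exact: strong_bound_yy.
rewrite lee_fin le_eqVlt => /predU1P[<-|p1]; first exact: strong_bound_11.
exact: strong_bound_pp.
Qed.

End assembly.

Theorem theorem2p8 (R : realType) (alpha sigma : R) (p q : \bar R)
  (halpha : -1 < alpha) (hsigma : 0 < sigma)
  (hp : (1 <= p)%E) (hq : (1 <= q)%E) :
  (- (1 / 2) <= alpha ->
    (potential_bounded alpha sigma p q <->
      [/\ (p^-1 - (sigma / (alpha + 1))%:E <= q^-1)%E,
          (q^-1 <= p^-1)%E
        & ((p^-1)%E, (q^-1)%E) \notin
            [set ((sigma / (alpha + 1))%:E, 0%:E);
                 (1%:E, (1 - sigma / (alpha + 1))%:E)]])) /\
  (alpha < - (1 / 2) ->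
    (potential_bounded alpha sigma p q <-> p = q)).
Proof.
split=> [a2|a2]; last first.
  split=> [PB|<-]; last exact/strong_bound_potential/strong_bound_diag.
  apply: rinv_inj => //; apply/eqP; rewrite eq_le.
  have [qp _] := bounded_scaling halpha hsigma hp hq PB.
  by rewrite qp (bounded_local halpha a2 hsigma hp hq PB).
rewrite !inv_rinv// -EFinB !lee_fin notin_setE/=.
split=> [PB|[pqs qp] npq].
  have [qp pqs] := bounded_scaling halpha hsigma hp hq PB; split => //.
  case=> -[/= ps qs].
  - have qy : q = +oo%E.
      by apply: rinv_inj; rewrite ?leey// qs rinv_y.
    by subst q; exact: not_bounded_to_Loo PB.
  - have p1 : p = 1%E by apply: rinv_inj => //; rewrite ps rinv_real ?invr1 ?oner_eq0.
    by subst p; exact: not_bounded_from_L1 PB.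
apply: strong_bound_potential => //; apply: strong_bound_range => // -[ps qs]; apply: npq.
- by left; rewrite ps qs.
- by right; rewrite ps qs.
Qed.
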